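(* Let $f_n$, $n\in\mathbb{N}$, be centred inner functions with $|f_n'(0)|\le\lambda<1$ for all $n\in\mathbb{N}$ (with $\lambda$ independent of $n$), and let $F_n=f_n\circ\cdots\circ f_1$. Then, for any shrinking target $(I_n)$ in $\partial\mathbb{D}$ that satisfies \[ \sum_{n=1}^\infty|I_n|=\infty, \] the sequence $(F_n(\zeta))$ hits $(I_n)$ for almost every $\zeta\in\partial\mathbb{D}$.
   Context: $\mathbb{D}=\{z\in\mathbb{C}:|z|<1\}$. An inner function is a holomorphic map $f:\mathbb{D}\to\mathbb{D}$ whose radial boundary extension (also denoted $f$, defined at almost every point of $\partial\mathbb{D}$) takes values in $\partial\mathbb{D}$ almost everywhere. An inner function $f$ is centred if $f(0)=0$. Compositions on the boundary are compositions of radial boundary extensions, defined almost everywhere. ''Almost every'' refers to arc length (Lebesgue) measure on $\partial\mathbb{D}$. A target is a sequence $(I_n)_{n\in\mathbb{N}}$ of arcs of $\partial\mathbb{D}$, not necessarily nested and not necessarily shrinking in length; it is a shrinking target if $|I_n|\to0$ as $n\to\infty$, where $|I_n|$ is the length of $I_n$. For $\zeta\in\partial\mathbb{D}$, $(F_n(\zeta))$ hits $(I_n)$ if $F_n(\zeta)\in I_n$ for infinitely many $n$. *)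

(* Defs.v *)
(* MathComp-Analysis; the complex plane is R[i] for an arbitrary R : realType.
   The topology and the normed-module structure over R[i] are those of R[i]^o. *)
From HB Require Import structures.
From mathcomp Require Export all_boot all_order all_algebra.
From mathcomp Require Export all_classical all_reals all_analysis.
From mathcomp Require Export complex.
Set Implicit Arguments.
Unset Strict Implicit.
Unset Printing Implicit Defensive.
Import Order.TTheory GRing.Theory Num.Theory.
Export numFieldNormedType.Exports.
Local Open Scope classical_set_scope.
Local Open Scope ring_scope.
Local Open Scope complex_scope.

Definition unit_disc (R : realType) : set R[i] := [set z | `|z| < 1].
Definition unit_circle (R : realType) : set R[i] := [set z | `|z| = 1].

Definition cis (R : realType) (t : R) : R[i] := cos t +i* sin t.

(* [cis] is a bijection from [0, 2 pi[ onto the circle carrying Lebesgue measure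
   to arc length (of total mass 2 pi). *)
Definition angles (R : realType) (A : set R[i]) : set R :=
  `[0, pi *+ 2[%classic `&` (@cis R @^-1` A).

Definition arc_length (R : realType) (A : set R[i]) : \bar R :=
  lebesgue_measure (angles A).

Definition ae_circle (R : realType) (P : set R[i]) : Prop :=
  (@lebesgue_measure R).-negligible (angles (~` P)).

Definition holomorphic_on_disc (R : realType) (f : R[i] -> R[i]) : Prop :=
  forall z : R[i], unit_disc z -> derivable (f : R[i]^o -> R[i]^o) z 1.

(* Only the values of [f] on the open disc are used below. *)
Definition radial (R : realType) (f : R[i] -> R[i]) (z : R[i]) (r : R) : R[i]^o :=
  f (r%:C * z).

(* The total operator [lim] returns 0 where the radial limit does not exist. *)
Definition radial_ext (R : realType) (f : R[i] -> R[i]) (z : R[i]) : R[i] :=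
  lim (radial f z r @[r --> (1 : R)^'-]).

Definition inner_function (R : realType) (f : R[i] -> R[i]) : Prop :=
  [/\ holomorphic_on_disc f,
      forall z : R[i], unit_disc z -> unit_disc (f z) &
      ae_circle [set z | cvg (radial f z r @[r --> (1 : R)^'-]) /\
                         unit_circle (radial_ext f z)]].

Definition centred_inner_function (R : realType) (f : R[i] -> R[i]) : Prop :=
  inner_function f /\ f 0 = 0.

(* The boundary map f_n o ... o f_1.  If the composition of the radial
   extensions is undefined at a point z of the circle, or leaves the circle,
   then (for centred inner f_n) all later values have modulus < 1, because 0 is
   fixed; such a z never hits an arc after that, so the default value of [lim]
   cannot help a sequence to hit a target. *)
Fixpoint boundary_comp (R : realType) (f : nat -> R[i] -> R[i]) (n : nat)
    (z : R[i]) : R[i] :=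
  if n is m.+1 then radial_ext (f m.+1) (boundary_comp f m z) else z.

(* Nondegenerate arcs, containing each of their endpoints or not. *)
Definition is_arc (R : realType) (A : set R[i]) : Prop :=
  exists (a b : R) (lclosed rclosed : bool),
    [/\ a < b, b <= a + pi *+ 2 &
        A = @cis R @` [set` Interval (BSide lclosed a) (BSide (~~ rclosed) b)]].

(* Sequences are indexed by n >= 1; the term of index 0 is ignored. *)
Definition target (R : realType) (I : nat -> set R[i]) : Prop :=
  forall n : nat, (0 < n)%N -> is_arc (I n).

Definition shrinking_target (R : realType) (I : nat -> set R[i]) : Prop :=
  target I /\ (arc_length (I n) @[n --> \oo] --> (0 : \bar R)).

Definition hits (R : realType) (x : nat -> R[i]) (I : nat -> set R[i]) : Prop :=
  infinite_set [set n : nat | (0 < n)%N /\ I n (x n)].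

(* Main.v *)
(* Harnack's inequality for f(z)/z sharpens the Schwarz lemma to
   |f(z)| <= |z| (1 - c (1 - |z|)) with c = (1 - lambda)/2, so that a composition
   G of k of the maps sends a point at distance s from the circle to distance
   at most (1 + c)^-k / s from 0.  On the other hand the boundary map of f
   carries the harmonic measure seen from z to the one seen from f(z).  Seen
   from near 0, harmonic measure is close to arc length m; averaging over points
   z close to an arc A, whose Poisson kernels are concentrated near A, gives
   exponential mixing m(A /\ G^-1 B) <= m(B) (m(A) + K q^k), where m has total
   mass 1.  Since m is invariant, the events F_n^-1(I_n) satisfy this pairwise
   estimate, and a second moment argument yields the divergence half of the
   Borel-Cantelli lemma. *)
From HB Require Import structures.
Require Import Defs.
From mathcomp Require Import all_boot all_order all_algebra.
From mathcomp Require Import all_classical all_reals all_analysis.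
From mathcomp Require Import measurable_realfun complex.
From mathcomp Require Import zify ring lra.
Import Order.TTheory GRing.Theory Num.Theory.
Import numFieldNormedType.Exports.
Set Implicit Arguments.
Unset Strict Implicit.
Unset Printing Implicit Defensive.
Local Open Scope classical_set_scope.
Local Open Scope ring_scope.
Local Open Scope complex_scope.
Local Notation Re := (@complex.Re _).
Local Notation Im := (@complex.Im _).

(** * The integral of a closed form around a rectangle *)

(** Only upper bounds are ever proved directly. The second moment argument uses the pairwise
    estimate in one direction, and the transport of harmonic measure is first an inequality on
    closed intervals, which is sharp because complementary intervals exhaust the total mass. Upper
    bounds come from smoothing: up to a factor near 1, the indicator of an arc lies below an average
    of Poisson kernels centred near the arc. Complex derivatives are not known to be continuous, so
    the mean value property rests on Goursat's bisection, done in polar coordinates. Points of mere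
    continuity are tolerated, which replaces the removable singularity theorem: difference quotients
    at w and f(z)/z at 0 are treated directly. The rate is q = (1 + c)^(-1/4). Kernels centred at
    distance s = sg^2 from the circle resolve arcs up to order sg, and G sends their centres to
    distance at most (1 + c)^-k / sg^2 from 0. With sg^4 = (1 + c)^-k this is sg^2, of smaller order
    than the smoothing error. *)

Lemma nested_intervals (R : realType) (a b : nat -> R) :
  (forall n, a n <= a n.+1) -> (forall n, b n.+1 <= b n) ->
  (forall n, a n <= b n) -> exists x, forall n, a n <= x <= b n.
Proof.
move=> ha hb hab.
have amono : {homo a : m n / (m <= n)%N >-> m <= n}.
  exact: (homo_leq (@lexx _ _) le_trans).
have bmono : {homo b : m n / (m <= n)%N >-> m >= n}.
  by apply: (homo_leq (r := fun x y => y <= x)) => // y x z yx zy; exact: le_trans yx.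
have ub n : ubound (range a) (b n).
  move=> _ [m _ <-]; apply: (le_trans (amono _ _ (leq_maxl m n))).
  exact: (le_trans (hab _) (bmono _ _ (leq_maxr m n))).
exists (sup (range a)) => n; apply/andP; split.
  by apply: ub_le_sup; [exists (b 0%N); exact: ub | exists n].
by apply: ge_sup; [exists (a 0%N); exists 0%N | exact: ub].
Qed.

Definition half (R : realType) (i : bool) (I : R * R) : R * R :=
  if i then ((I.1 + I.2) / 2, I.2) else (I.1, (I.1 + I.2) / 2).

Definition subitv (R : realType) (I I0 : R * R) : Prop :=
  [/\ I0.1 <= I.1, I.1 <= I.2 & I.2 <= I0.2].

Lemma half_bounds (R : realType) (i : bool) (I : R * R) : I.1 <= I.2 ->
  [/\ I.1 <= (half i I).1, (half i I).2 <= I.2, (half i I).1 <= (half i I).2 &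
      (half i I).2 - (half i I).1 = (I.2 - I.1) / 2].
Proof.
by case: I => a b; case: i => /= ab; split; lra.
Qed.

Lemma half_subitv (R : realType) (i : bool) (I I0 : R * R) :
  subitv I I0 -> subitv (half i I) I0.
Proof. by case: I => a b; case: i => -[/= ? ? ?]; split => /=; lra. Qed.

(* Bisect, each time keeping the quarter on which [|J|] is largest. *)
Lemma additive_rectangle0 (R : realType) (J : R * R -> R * R -> R)
    (I1 I2 : R * R) : I1.1 <= I1.2 -> I2.1 <= I2.2 ->
  (forall I K, subitv I I1 -> subitv K I2 ->
    J I K = J (half false I) K + J (half true I) K) ->
  (forall I K, subitv I I1 -> subitv K I2 ->
    J I K = J I (half false K) + J I (half true K)) ->
  (forall x y, I1.1 <= x <= I1.2 -> I2.1 <= y <= I2.2 ->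
    forall e, 0 < e -> exists2 d, 0 < d & forall I K,
      subitv I I1 -> subitv K I2 ->
      I.1 <= x <= I.2 -> K.1 <= y <= K.2 -> I.2 - I.1 < d -> K.2 - K.1 < d ->
      `|J I K| <= e * ((I.2 - I.1) + (K.2 - K.1)) ^+ 2) ->
  J I1 I2 = 0.
Proof.
move=> le1 le2 Jl Jr Jloc.
pose small (Q : (R * R) * (R * R)) := subitv Q.1 I1 /\ subitv Q.2 I2.
(* The premise [small Q] sits under the existential so that choice gives a total selector. If no
   quarter carried a fourth of |J|, additivity and the triangle inequality would give |J| < |J|. *)
have pick (Q : (R * R) * (R * R)) : exists ij : bool * bool, small Q ->
    `|J Q.1 Q.2| <= 4 * `|J (half ij.1 Q.1) (half ij.2 Q.2)|.
  apply/not_existsP => H; case: Q H => I K H.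
  have sQ : small (I, K) by apply: contrapT => nsQ; apply: (H (false, false)).
  have lt i j : 4 * `|J (half i I) (half j K)| < `|J I K|.
    by rewrite ltNge; apply/negP => le; exact: (H (i, j)).
  have : `|J I K| <= `|J (half false I) (half false K)|
      + `|J (half false I) (half true K)| + `|J (half true I) (half false K)|
      + `|J (half true I) (half true K)|.
    case: sQ => /= sI sK; rewrite Jl// Jr//; last exact: half_subitv.
    rewrite [X in _ + X]Jr//; last exact: half_subitv.
    rewrite addrA; do 2 (apply: le_trans (ler_normD _ _) _; rewrite lerD2r).
    exact: le_trans (ler_normD _ _) _.
  have := lt false false; have := lt false true; have := lt true false.
  have := lt true true; lra.
have [c cP] := choice pick.
pose next (Q : (R * R) * (R * R)) := (half (c Q).1 Q.1, half (c Q).2 Q.2).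
pose Q n := iter n next (I1, I2).
have Qs n : small (Q n).
  elim: n => [|n [? ?]]; first by split; split.
  by split; exact: half_subitv.
have Qle n : (Q n).1.1 <= (Q n).1.2 /\ (Q n).2.1 <= (Q n).2.2.
  by have [[_ ? _] [_ ? _]] := Qs n.
have Qw n : (Q n).1.2 - (Q n).1.1 = (I1.2 - I1.1) / 2 ^+ n /\
    (Q n).2.2 - (Q n).2.1 = (I2.2 - I2.1) / 2 ^+ n.
  elim: n => [|n [e1 e2]]; first by rewrite !expr0 !divr1.
  have [l1 l2] := Qle n.
  have [_ _ _ w1] := half_bounds (c (Q n)).1 l1.
  have [_ _ _ w2] := half_bounds (c (Q n)).2 l2.
  rewrite exprSr !invfM [Q n.+1]/= w1 w2 e1 e2; split; ring.
have QJ n : `|J I1 I2| <= 4 ^+ n * `|J (Q n).1 (Q n).2|.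
  elim: n => [|n IH]; first by rewrite expr0 mul1r.
  apply: (le_trans IH); rewrite exprSr -mulrA ler_pM2l ?exprn_gt0//.
  exact: (cP _ (Qs n)).
have [x xP] : exists x, forall n, (Q n).1.1 <= x <= (Q n).1.2.
  apply: nested_intervals => n; have [l1 l2] := Qle n => //.
    by have [? _ _ _] := half_bounds (c (Q n)).1 l1.
  by have [_ ? _ _] := half_bounds (c (Q n)).1 l1.
have [y yP] : exists y, forall n, (Q n).2.1 <= y <= (Q n).2.2.
  apply: nested_intervals => n; have [l1 l2] := Qle n => //.
    by have [? _ _ _] := half_bounds (c (Q n)).2 l2.
  by have [_ ? _ _] := half_bounds (c (Q n)).2 l2.
apply/eqP; rewrite -normr_eq0 eq_le normr_ge0 andbT.
pose W := (I1.2 - I1.1) + (I2.2 - I2.1).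
have W0 : 0 <= W by rewrite /W; lra.
suff JW e : 0 < e -> `|J I1 I2| <= e * W ^+ 2.
  apply/ler_addgt0Pl => e e0; rewrite addr0.
  have k0 : 0 < W ^+ 2 + 1 by rewrite ltr_wpDl ?sqr_ge0.
  apply: (le_trans (JW (e / (W ^+ 2 + 1)) _)); first exact: divr_gt0.
  by rewrite mulrAC ler_pdivrMr// ler_pM2l//; lra.
move=> e0; have [d d0 dP] := Jloc x y (xP 0%N) (yP 0%N) e e0.
have [n Wn] : exists n, W < d * 2 ^+ n.
  have [n nW] := filter_ex (nbhs_infty_gtr (W / d)); exists n.
  rewrite mulrC -ltr_pdivrMr//; apply: (lt_le_trans nW).
  rewrite -natrX ler_nat; exact/ltnW/ltn_expl.
have p0 : (0 : R) < 2 ^+ n by rewrite exprn_gt0.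
have [w1 w2] := Qw n.
have := dP _ _ (Qs n).1 (Qs n).2 (xP n) (yP n).
rewrite w1 w2 !ltr_pdivrMr// -mulrDl -/W.
have lW1 : I1.2 - I1.1 < d * 2 ^+ n by apply: le_lt_trans Wn; rewrite /W; lra.
have lW2 : I2.2 - I2.1 < d * 2 ^+ n by apply: le_lt_trans Wn; rewrite /W; lra.
(* The factor 4^n lost by keeping one quarter n times is the square of the factor 2^n by which the
   sides shrink, so e * W^2 remains. *)
move=> /(_ lW1 lW2) Jn; apply: (le_trans (QJ n)).
rewrite mulrC -ler_pdivlMr ?exprn_gt0//; apply: (le_trans Jn).
rewrite expr_div_n -exprM mulnC exprM (_ : 2 ^+ 2 = 4 :> R); last by ring.
by rewrite mulrA.
Qed.

Lemma continuous_integrable_itv (R : realType) (f : R -> R) (a b : R) :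
  {in `[a, b], forall x, {for x, continuous f}} ->
  (@lebesgue_measure R).-integrable `[a, b] (EFin \o f).
Proof.
move=> cf; apply: continuous_compact_integrable; first exact: segment_compact.
by apply: continuous_in_subspaceT => x; rewrite inE /=; exact: cf.
Qed.

Lemma Rintegral_itv_split (R : realType) (f : R -> R) (a c b : R) :
  a <= c -> c <= b ->
  (@lebesgue_measure R).-integrable `[a, b] (EFin \o f) ->
  \int[lebesgue_measure]_(x in `[a, b]) f x =
  \int[lebesgue_measure]_(x in `[a, c]) f x +
  \int[lebesgue_measure]_(x in `[c, b]) f x.
Proof.
move=> ac cb intf; apply/eqP; rewrite addrC -subr_eq; apply/eqP.
rewrite (Rintegral_itvB intf) ?bnd_simp//.
rewrite Rintegral_itv_obnd_cbnd//; apply: integrableS intf => //.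
by apply: subset_itv; rewrite bnd_simp.
Qed.

Lemma Rintegral_itv_cst (R : realType) (a b k : R) : a <= b ->
  \int[lebesgue_measure]_(x in `[a, b]) k = k * (b - a).
Proof.
move=> ab; rewrite Rintegral_cst//= lebesgue_measure_itv/= lte_fin.
by case: ltgtP ab => //= -> _; rewrite subrr.
Qed.

Lemma Rintegral_itv_near_cst (R : realType) (f : R -> R) (a b k M : R) :
  a <= b -> {in `[a, b], forall x, {for x, continuous f}} ->
  {in `[a, b], forall x, `|f x - k| <= M} ->
  `|\int[lebesgue_measure]_(x in `[a, b]) f x - k * (b - a)| <= M * (b - a).
Proof.
move=> ab cf fM; rewrite -(Rintegral_itv_cst _ ab) -RintegralB//; last 2 first.
- exact: continuous_integrable_itv.
- by apply: continuous_integrable_itv => x _; exact: cst_continuous.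
have ck : {in `[a, b], forall x, {for x, continuous (fun x => f x - k)}}.
  by move=> x xab; apply: continuousB; [exact: cf|exact: cst_continuous].
apply: (le_trans (le_normr_Rintegral _ _)) => //.
  exact: continuous_integrable_itv.
rewrite -(Rintegral_itv_cst _ ab); apply: le_Rintegral => //.
- apply: continuous_integrable_itv => x xab.
  by apply: continuous_comp; [exact: ck|exact: norm_continuous].
- by apply: continuous_integrable_itv => x _; exact: cst_continuous.
Qed.

Lemma continuous_dist (R : realType) (f : R -> R) (x : R) :
  (forall e, 0 < e -> exists2 d, 0 < d & forall t, `|t - x| < d ->
    `|f t - f x| <= e) -> {for x, continuous f}.
Proof.
move=> h; apply/(@cvgrPdist_le _ _ _ (nbhs x)) => e /h[d d0 dP].
apply/nbhs_ballP; exists d => //= t xt; rewrite distrC; apply: dP.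
by rewrite distrC.
Qed.

(** Total differentiability at (x, y) with gradient (al, be). *)
Definition first_order (R : realType) (p : R -> R -> R) (x y al be : R) :=
  forall e, 0 < e -> exists2 d, 0 < d &
    forall x' y', `|x' - x| < d -> `|y' - y| < d ->
    `|p x' y' - p x y - al * (x' - x) - be * (y' - y)| <=
      e * (`|x' - x| + `|y' - y|).

Lemma first_order_continuous (R : realType) (p : R -> R -> R) (x y al be : R) :
  first_order p x y al be ->
  {for x, continuous (p ^~ y)} /\ {for y, continuous (p x)}.
Proof.
move=> pxy.
have [d d0 dP] := pxy 1 ltr01.
pose M := 1 + `|al| + `|be|.
have M0 : 0 < M by rewrite /M -addrA ltr_wpDr// addr_ge0.
have bnd x' y' : `|x' - x| < d -> `|y' - y| < d ->
    `|p x' y' - p x y| <= M * (`|x' - x| + `|y' - y|).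
  move=> h1 h2; have := dP x' y' h1 h2; rewrite mul1r => h.
  have := ler_normD (p x' y' - p x y - al * (x' - x) - be * (y' - y))
    (al * (x' - x) + be * (y' - y)).
  have := ler_normD (al * (x' - x)) (be * (y' - y)).
  rewrite !normrM (_ : p x' y' - p x y - al * (x' - x) - be * (y' - y) +
    (al * (x' - x) + be * (y' - y)) = p x' y' - p x y); last by ring.
  have := mulr_ge0 (normr_ge0 al) (normr_ge0 (y' - y)).
  have := mulr_ge0 (normr_ge0 be) (normr_ge0 (x' - x)).
  rewrite /M; lra.
split; apply: continuous_dist => e e0;
  exists (Num.min d (e / M)); rewrite ?lt_min ?d0 ?divr_gt0// => t;
  rewrite lt_min ltr_pdivlMr// mulrC => /andP[td te].
- apply: (le_trans (bnd t y td _)); rewrite subrr normr0// addr0; exact: ltW.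
- apply: (le_trans (bnd x t _ td)); rewrite subrr normr0// add0r; exact: ltW.
Qed.

(* The form [p dx + q dy] is closed, but its partial derivatives need not be
   continuous. *)
Lemma goursat_rectangle (R : realType) (p q : R -> R -> R) (a b c d : R) :
  a <= b -> c <= d ->
  (forall x y, a <= x <= b -> c <= y <= d -> exists al be ga,
    first_order p x y al be /\ first_order q x y be ga) ->
  \int[lebesgue_measure]_(x in `[a, b]) p x c -
  \int[lebesgue_measure]_(x in `[a, b]) p x d +
  (\int[lebesgue_measure]_(y in `[c, d]) q b y -
   \int[lebesgue_measure]_(y in `[c, d]) q a y) = 0.
Proof.
move=> ab cd pq.
pose J (I K : R * R) :=
  \int[lebesgue_measure]_(x in `[I.1, I.2]) p x K.1 -
  \int[lebesgue_measure]_(x in `[I.1, I.2]) p x K.2 +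
  (\int[lebesgue_measure]_(y in `[K.1, K.2]) q I.2 y -
   \int[lebesgue_measure]_(y in `[K.1, K.2]) q I.1 y).
have cp I K y : subitv I (a, b) -> subitv K (c, d) -> K.1 <= y <= K.2 ->
    {in `[I.1, I.2], forall x, {for x, continuous (p ^~ y)}}.
  move=> [/= ? ? ?] [/= ? ? ?] ? x; rewrite in_itv/= => ?.
  have [||al [be [ga [h _]]]] := pq x y; [by lra | by lra |].
  by have [] := first_order_continuous h.
have cq I K x : subitv I (a, b) -> subitv K (c, d) -> I.1 <= x <= I.2 ->
    {in `[K.1, K.2], forall y, {for y, continuous (q x)}}.
  move=> [/= ? ? ?] [/= ? ? ?] ? y; rewrite in_itv/= => ?.
  have [||al [be [ga [_ h]]]] := pq x y; [by lra | by lra |].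
  by have [] := first_order_continuous h.
apply: (@additive_rectangle0 _ J (a, b) (c, d)) => //=.
- move=> I K sI sK; have [/= ? ? ?] := sI; have [/= ? ? ?] := sK.
  rewrite /J /half/= (Rintegral_itv_split (f := p ^~ K.1) (c := (I.1 + I.2) / 2)).
  + rewrite (Rintegral_itv_split (f := p ^~ K.2) (c := (I.1 + I.2) / 2)).
    * by ring.
    * by lra.
    * by lra.
    * by apply: continuous_integrable_itv; apply: (cp I K) => //; lra.
  + by lra.
  + by lra.
  + by apply: continuous_integrable_itv; apply: (cp I K) => //; lra.
- move=> I K sI sK; have [/= ? ? ?] := sI; have [/= ? ? ?] := sK.
  rewrite /J /half/= (Rintegral_itv_split (f := q I.2) (c := (K.1 + K.2) / 2)).
  + rewrite (Rintegral_itv_split (f := q I.1) (c := (K.1 + K.2) / 2)).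
    * by ring.
    * by lra.
    * by lra.
    * by apply: continuous_integrable_itv; apply: (cq I K) => //; lra.
  + by lra.
  + by lra.
  + by apply: continuous_integrable_itv; apply: (cq I K) => //; lra.
move=> x y xab ycd e e0; have [al [be [ga [hp hq]]]] := pq x y xab ycd.
have e40 : 0 < e / 2 by lra.
have [d1 d10 hp'] := hp _ e40; have [d2 d20 hq'] := hq _ e40.
exists (Num.min d1 d2); first by rewrite lt_min d10.
move=> I K sI sK; have [/= ? hI ?] := sI; have [/= ? hK ?] := sK.
rewrite !lt_min => xI yK /andP[I1 I2] /andP[K1 K2].
set w := I.2 - I.1; set h := K.2 - K.1.
have absl t u (L : R * R) : L.1 <= t <= L.2 -> L.1 <= u <= L.2 ->
  `|t - u| <= L.2 - L.1 by move=> ? ?; rewrite ler_norml; lra.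
(* Between opposite sides the constant and the [al] terms of the expansion cancel. What is left is a
   constant integrand, up to two errors with e / 2 each. *)
have bp : `|\int[lebesgue_measure]_(x' in `[I.1, I.2]) (p x' K.1 - p x' K.2)
    - (be * (K.1 - K.2)) * w| <= e * (w + h) * w.
  apply: Rintegral_itv_near_cst => // [x' x'I|x'].
    by apply: continuousB; apply: (cp I K _ sI sK) => //; lra.
  rewrite in_itv/= => x'I.
  have xw := absl _ _ _ x'I xI.
  have yh1 : `|K.1 - y| <= h by apply: absl => //; lra.
  have yh2 : `|K.2 - y| <= h by apply: absl => //; lra.
  have h1 := hp' x' K.1 (le_lt_trans xw I1) (le_lt_trans yh1 K1).
  have h2 := hp' x' K.2 (le_lt_trans xw I1) (le_lt_trans yh2 K1).
  rewrite (_ : _ - _ = (p x' K.1 - p x y - al * (x' - x) - be * (K.1 - y)) -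
    (p x' K.2 - p x y - al * (x' - x) - be * (K.2 - y))); last by ring.
  apply: (le_trans (ler_normB _ _)); apply: (le_trans (lerD h1 h2)).
  rewrite -mulrDr -mulrA ler_pM2l//; rewrite -/w in xw; lra.
have bq : `|\int[lebesgue_measure]_(y' in `[K.1, K.2]) (q I.2 y' - q I.1 y')
    - (be * (I.2 - I.1)) * h| <= e * (w + h) * h.
  apply: Rintegral_itv_near_cst => // [y' y'K|y'].
    by apply: continuousB; apply: (cq I K _ sI sK) => //; lra.
  rewrite in_itv/= => y'K.
  have yh := absl _ _ _ y'K yK.
  have xw1 : `|I.1 - x| <= w by apply: absl => //; lra.
  have xw2 : `|I.2 - x| <= w by apply: absl => //; lra.
  have h1 := hq' I.1 y' (le_lt_trans xw1 I2) (le_lt_trans yh K2).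
  have h2 := hq' I.2 y' (le_lt_trans xw2 I2) (le_lt_trans yh K2).
  rewrite (_ : _ - _ = (q I.2 y' - q x y - be * (I.2 - x) - ga * (y' - y)) -
    (q I.1 y' - q x y - be * (I.1 - x) - ga * (y' - y))); last by ring.
  apply: (le_trans (ler_normB _ _)); apply: (le_trans (lerD h2 h1)).
  rewrite -mulrDr -mulrA ler_pM2l//; rewrite -/h in yh; lra.
rewrite /J -RintegralB//; last 2 first.
- by apply: continuous_integrable_itv; apply: (cp I K) => //; lra.
- by apply: continuous_integrable_itv; apply: (cp I K) => //; lra.
rewrite -RintegralB//; last 2 first.
- by apply: continuous_integrable_itv; apply: (cq I K) => //; lra.
- by apply: continuous_integrable_itv; apply: (cq I K) => //; lra.
move: bp bq; set A := Rintegral _ _ _; set B := Rintegral _ _ _ => bp bq.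
(* Closedness enters here: [be] is at once the y-derivative of [p] and the x-derivative of [q], so
   the two linear contributions are - be * w * h and be * w * h. *)
rewrite (_ : A + B = (A - be * (K.1 - K.2) * w) + (B - be * (I.2 - I.1) * h));
  last by rewrite /w /h; ring.
apply: (le_trans (ler_normD _ _)); apply: (le_trans (lerD bp bq)).
by rewrite -mulrDr expr2 mulrA.
Qed.

(** * Differential calculus in two real variables *)

Lemma first_orderP (R : realType) (p : R -> R -> R) (x y al be : R) :
  (forall e, 0 < e -> exists2 d, 0 < d &
    forall x' y', `|x' - x| + `|y' - y| < d ->
    `|p x' y' - p x y - al * (x' - x) - be * (y' - y)| <=
      e * (`|x' - x| + `|y' - y|)) <-> first_order p x y al be.
Proof.
split=> h e /h[d d0 dP]; last first.
  by exists d => // x' y' xy; apply: dP; apply: le_lt_trans xy; rewrite ?lerDl ?lerDr.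
by exists (d / 2) => [|x' y' hx hy]; [exact: divr_gt0 | apply: dP; lra].
Qed.

Lemma first_order_lip (R : realType) (p : R -> R -> R) (x y al be : R) :
  first_order p x y al be ->
  exists2 M, 0 < M & exists2 d, 0 < d & forall x' y', `|x' - x| + `|y' - y| < d ->
    `|p x' y' - p x y| <= M * (`|x' - x| + `|y' - y|).
Proof.
move=> /first_orderP/(_ 1 ltr01)[d d0 dP].
exists (1 + `|al| + `|be|); first by rewrite -addrA ltr_wpDr// addr_ge0.
exists d => // x' y' h.
have := dP x' y' h; rewrite mul1r => {}h.
have := ler_normD (p x' y' - p x y - al * (x' - x) - be * (y' - y))
  (al * (x' - x) + be * (y' - y)).
have := ler_normD (al * (x' - x)) (be * (y' - y)).
rewrite !normrM (_ : p x' y' - p x y - al * (x' - x) - be * (y' - y) +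
  (al * (x' - x) + be * (y' - y)) = p x' y' - p x y); last by ring.
have := mulr_ge0 (normr_ge0 al) (normr_ge0 (y' - y)).
have := mulr_ge0 (normr_ge0 be) (normr_ge0 (x' - x)).
lra.
Qed.

Lemma first_order_comp (R : realType) (U X Y : R -> R -> R)
    (x y a b al be ga de : R) :
  first_order U (X x y) (Y x y) a b ->
  first_order X x y al be -> first_order Y x y ga de ->
  first_order (fun x y => U (X x y) (Y x y)) x y
    (a * al + b * ga) (a * be + b * de).
Proof.
move=> hU hX hY; apply/first_orderP => e e0.
have [M1 M10 [d1 d10 L1]] := first_order_lip hX.
have [M2 M20 [d2 d20 L2]] := first_order_lip hY.
have N0 : 0 < `|a| + `|b| + 1 by rewrite ltr_wpDl// addr_ge0.
have M0 : 0 < M1 + M2 by lra.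
(* [e1] is spent on [U], whose argument moves by at most (M1 + M2) * n, and [e2] on [X] and [Y],
   whose errors are multiplied by |a| and |b|. *)
pose e1 := e / 2 / (M1 + M2); pose e2 := e / 2 / (`|a| + `|b| + 1).
have e10 : 0 < e1 by rewrite !divr_gt0.
have e20 : 0 < e2 by rewrite !divr_gt0.
have [dU dU0 PU] := (first_orderP _ _ _ _ _).2 hU _ e10.
have [dX dX0 PX] := (first_orderP _ _ _ _ _).2 hX _ e20.
have [dY dY0 PY] := (first_orderP _ _ _ _ _).2 hY _ e20.
exists (Num.min (Num.min d1 d2) (Num.min (dU / (M1 + M2)) (Num.min dX dY))).
  by rewrite !lt_min d10 d20 dX0 dY0 divr_gt0.
move=> x' y'; set n := `|_| + `|_|; have n0 : 0 <= n by rewrite addr_ge0.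
rewrite !lt_min => /andP[/andP[nd1 nd2] /andP[nU /andP[nX nY]]].
rewrite ltr_pdivlMr// in nU.
have {}L1 := L1 _ _ nd1; have {}L2 := L2 _ _ nd2.
have {}PX := PX _ _ nX; have {}PY := PY _ _ nY.
have h12 : `|X x' y' - X x y| + `|Y x' y' - Y x y| <= (M1 + M2) * n.
  by rewrite mulrDl lerD.
have {}PU : `|U (X x' y') (Y x' y') - U (X x y) (Y x y) -
    a * (X x' y' - X x y) - b * (Y x' y' - Y x y)| <= e / 2 * n.
  apply: (le_trans (PU _ _ _)); first by apply: le_lt_trans h12 _; rewrite mulrC.
  rewrite (le_trans (ler_wpM2l (ltW e10) h12))// mulrA divfK//.
  by rewrite gt_eqF.
have PX' : `|a * (X x' y' - X x y - al * (x' - x) - be * (y' - y))| <=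
  `|a| * (e2 * n) by rewrite normrM ler_wpM2l.
have PY' : `|b * (Y x' y' - Y x y - ga * (x' - x) - de * (y' - y))| <=
  `|b| * (e2 * n) by rewrite normrM ler_wpM2l.
have h3 : `|a| * (e2 * n) + `|b| * (e2 * n) <= e / 2 * n.
  rewrite -mulrDl mulrA ler_wpM2r// /e2 mulrA ler_pdivrMr// mulrC.
  by rewrite ler_pM2l ?divr_gt0// lerDl.
set A := (_ - _ - _ - _ : R) in PU; set B := a * _ in PX'; set C := b * _ in PY'.
rewrite (_ : _ - _ - _ - _ = A + B + C); last by rewrite /A /B /C; ring.
apply: le_trans (ler_normD _ _) _; apply: le_trans (lerD (ler_normD _ _) PY') _.
rewrite -/n; lra.
Qed.

Lemma first_order_mul (R : realType) (x y : R) :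
  first_order (fun x y => x * y) x y y x.
Proof.
apply/first_orderP => e e0; exists e => // x' y' h.
rewrite (_ : _ - _ = (x' - x) * (y' - y)); last by ring.
rewrite normrM; apply: ler_pM => //; last by rewrite lerDr.
by apply: ltW; apply: le_lt_trans h; rewrite lerDl.
Qed.

Lemma is_derive_expand (R : realType) (f : R -> R) (x f' : R) :
  is_derive x 1 f f' -> forall e, 0 < e -> exists2 d, 0 < d &
    forall x', `|x' - x| < d -> `|f x' - f x - f' * (x' - x)| <= e * `|x' - x|.
Proof.
case=> df dfE e e0.
have /cvgrPdist_le /(_ e e0) : h^-1 *: (f (h *: 1 + x) - f x) @[h --> 0^'] --> f'.
  by rewrite -dfE; exact: df.
rewrite -nbhs_nearE => /nbhs_ballP[d /= d0 dP]; exists d => // x' xx'.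
have [->|x'x] := eqVneq x' x; first by rewrite !subrr mulr0 subrr normr0 mulr0.
have hn : x' - x != 0 by rewrite subr_eq0.
have := dP (x' - x); rewrite /ball/= sub0r normrN => /(_ xx' hn).
rewrite [_ *: 1]mulr1 subrK [_ *: _]/(_ * _) => h.
rewrite -ler_pdivrMr ?normr_gt0// -normfV -normrM distrC in h *.
rewrite (_ : (f x' - _ - _) / _ = (x' - x)^-1 * (f x' - f x) - f')//.
by rewrite mulrDl mulNr mulfK// mulrC.
Qed.

Lemma first_order_fst (R : realType) (f : R -> R) (x y f' : R) :
  is_derive x 1 f f' -> first_order (fun x _ => f x) x y f' 0.
Proof.
move=> /is_derive_expand h e /[dup] e0 /h[d d0 dP]; exists d => // x' y' xx' _.
rewrite mul0r subr0; apply: (le_trans (dP _ xx')).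
by rewrite ler_pM2l// lerDl.
Qed.

Lemma first_order_snd (R : realType) (f : R -> R) (x y f' : R) :
  is_derive y 1 f f' -> first_order (fun _ y => f y) x y 0 f'.
Proof.
move=> /is_derive_expand h e /[dup] e0 /h[d d0 dP]; exists d => // x' y' _ yy'.
rewrite mul0r subr0; apply: (le_trans (dP _ yy')).
by rewrite ler_pM2l// lerDr.
Qed.

(** * The modulus as a real number *)

(** The norm of [R[i]] is valued in [R[i]], whose order is only partial; linear arithmetic and real
    analysis need the modulus in [R]. *)
Definition cabs (R : realType) (z : R[i]) : R := Re `|z|.

Section cabs.
Variable R : realType.
Implicit Types z w : R[i].

Lemma cabsE z : `|z| = (cabs z)%:C.
Proof. by rewrite /cabs normc_def. Qed.

Lemma cabs_ge0 z : 0 <= cabs z.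
Proof. by rewrite -ler0c -cabsE. Qed.

Lemma cabs_eq0 z : (cabs z == 0) = (z == 0).
Proof. by rewrite -(normr_eq0 z) cabsE -(inj_eq (@complexI R)). Qed.

Lemma cabs_gt0 z : (0 < cabs z) = (z != 0).
Proof. by rewrite lt_def cabs_ge0 andbT cabs_eq0. Qed.

Lemma cabs0 : cabs (0 : R[i]) = 0.
Proof. by apply/eqP; rewrite cabs_eq0. Qed.

Lemma cabsM z w : cabs (z * w) = cabs z * cabs w.
Proof. by apply: complexI; rewrite rmorphM/= -!cabsE normrM. Qed.

Lemma cabsV z : cabs z^-1 = (cabs z)^-1.
Proof. by apply: complexI; rewrite fmorphV/= -!cabsE normfV. Qed.

Lemma cabsN z : cabs (- z) = cabs z.
Proof. by rewrite /cabs normrN. Qed.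

Lemma cabsB z w : cabs (z - w) = cabs (w - z).
Proof. by rewrite /cabs distrC. Qed.

Lemma le_cabsD z w : cabs (z + w) <= cabs z + cabs w.
Proof. by rewrite -lecR rmorphD/= -!cabsE ler_normD. Qed.

Lemma cabs_sqr z : cabs z ^+ 2 = Re z ^+ 2 + Im z ^+ 2.
Proof. by apply: complexI; rewrite rmorphXn/= -cabsE add_Re2_Im2. Qed.

Lemma cabs_real (x : R) : cabs x%:C = `|x|.
Proof. by rewrite /cabs normc_def/= expr0n/= addr0 sqrtr_sqr. Qed.

Lemma normr_Re_le z : `|Re z| <= cabs z.
Proof.
rewrite -ler_sqr ?nnegrE ?cabs_ge0// cabs_sqr -normrX ger0_norm ?sqr_ge0//.
by rewrite lerDl sqr_ge0.
Qed.

Lemma normr_Im_le z : `|Im z| <= cabs z.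
Proof.
rewrite -ler_sqr ?nnegrE ?cabs_ge0// cabs_sqr -normrX ger0_norm ?sqr_ge0//.
by rewrite lerDr sqr_ge0.
Qed.

Lemma cabs_le z : cabs z <= `|Re z| + `|Im z|.
Proof.
rewrite -ler_sqr ?nnegrE ?cabs_ge0 ?addr_ge0// cabs_sqr sqrrD.
rewrite -2!normrX (ger0_norm (sqr_ge0 (Re z))) (ger0_norm (sqr_ge0 (Im z))).
by rewrite addrAC lerDl mulrn_wge0// mulr_ge0.
Qed.

Lemma cabs_cis (t : R) : cabs (cis t) = 1.
Proof. by rewrite /cabs normc_def/= cos2Dsin2 sqrtr1. Qed.

Lemma unit_discE z : unit_disc z <-> cabs z < 1.
Proof. by rewrite /unit_disc/= cabsE -ltcR. Qed.

Lemma unit_circleE z : unit_circle z <-> cabs z = 1.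
Proof.
rewrite /unit_circle/= cabsE; split=> [|->//].
exact: (@complexI _ _ 1).
Qed.

Lemma ReD z w : Re (z + w) = Re z + Re w.
Proof. by case: z w => [? ?] [? ?]. Qed.

Lemma ImD z w : Im (z + w) = Im z + Im w.
Proof. by case: z w => [? ?] [? ?]. Qed.

Lemma ReN z : Re (- z) = - Re z. Proof. by case: z. Qed.

Lemma ImN z : Im (- z) = - Im z. Proof. by case: z. Qed.

Lemma ReM z w : Re (z * w) = Re z * Re w - Im z * Im w.
Proof. by case: z w => [? ?] [? ?]. Qed.

Lemma ImM z w : Im (z * w) = Re z * Im w + Im z * Re w.
Proof. by case: z w => [? ?] [? ?] /=; rewrite (mulrC (_ : R)). Qed.

Lemma complex_eta z : z = Re z +i* Im z. Proof. by case: z. Qed.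

Lemma nbhs_complexP (z : R[i]^o) (A : set R[i]) :
  nbhs z A <-> exists2 d : R, 0 < d & forall w, cabs (w - z) < d -> A w.
Proof.
split=> [/nbhs_ballP[d /= d0 dA]|[d d0 dA]].
  have dE : d = (Re d)%:C by rewrite RRe_real// gtr0_real.
  exists (Re d) => [|w wz]; first by rewrite -ltcR -dE.
  by apply: dA; rewrite /ball/= distrC cabsE dE ltcR.
apply/nbhs_ballP; exists d%:C; rewrite /= ?ltcR// => w.
by rewrite /ball/= distrC cabsE ltcR; exact: dA.
Qed.

Lemma derivable_expandc (G : R[i] -> R[i]) (z : R[i]) :
  derivable (G : R[i]^o -> R[i]^o) z 1 ->
    forall e, 0 < e -> exists2 d, 0 < d & forall w, cabs (w - z) < d ->
    cabs (G w - G z - derive1 (G : R[i]^o -> R[i]^o) z * (w - z)) <=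
      e * cabs (w - z).
Proof.
move=> hA e e0; rewrite derive1E.
have ec0 : 0 < e%:C by rewrite ltcR.
move: hA; rewrite /derivable /derive; set A := lim _ => hA.
move/cvgrPdist_le : hA => /(_ _ ec0).
rewrite /dnbhs near_withinE -nbhs_nearE => /nbhs_complexP[d d0 dP]; exists d => // w wz.
have [->|wz'] := eqVneq w z; first by rewrite !subrr mulr0 subrr cabs0 mulr0.
have hn : w - z != 0 by rewrite subr_eq0.
have := dP (w - z); rewrite subr0 => /(_ wz hn).
rewrite /= [_ *: 1]mulr1 subrK [_ *: _]/(_ * _) cabsE lecR => h.
rewrite -ler_pdivrMr ?cabs_gt0// -cabsV -cabsM cabsB in h *.
rewrite (_ : (G w - _ - _) / _ = (w - z)^-1 * (G w - G z) - A)//.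
by rewrite mulrDl mulNr mulfK// mulrC.
Qed.

(** The Cauchy-Riemann equations: the differential of G is multiplication by G' = a + ib, whose real
    and imaginary parts on (dx, dy) are a dx - b dy and b dx + a dy. *)
Lemma derivable_first_order (G : R[i] -> R[i]) (x y : R) :
  derivable (G : R[i]^o -> R[i]^o) (x +i* y) 1 -> exists a b,
  first_order (fun x y => Re (G (x +i* y))) x y a (- b) /\
  first_order (fun x y => Im (G (x +i* y))) x y b a.
Proof.
move=> /derivable_expandc; case: (derive1 _ _) => a b h; exists a, b.
split; apply/first_orderP => e /[dup] e0 /h[d d0 dP]; exists d => // x' y' xy;
  have cle : cabs ((x' +i* y') - (x +i* y)) <= `|x' - x| + `|y' - y|;
  try exact: (cabs_le ((x' +i* y') - (x +i* y))).
- have := dP _ (le_lt_trans cle xy) => {}h.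
  rewrite (_ : _ - _ - _ - _ = Re (G (x' +i* y') - G (x +i* y) -
    (a +i* b) * ((x' +i* y') - (x +i* y)))); last first.
    by rewrite !(ReD, ReN, ReM)/=; ring.
  by apply: (le_trans (normr_Re_le _)); apply: (le_trans h); rewrite ler_pM2l.
- have := dP _ (le_lt_trans cle xy) => {}h.
  rewrite (_ : _ - _ - _ - _ = Im (G (x' +i* y') - G (x +i* y) -
    (a +i* b) * ((x' +i* y') - (x +i* y)))); last first.
    by rewrite !(ImD, ImN, ImM)/=; ring.
  by apply: (le_trans (normr_Im_le _)); apply: (le_trans h); rewrite ler_pM2l.
Qed.
End cabs.

(** * Circle means of holomorphic functions *)

Definition circle_mean (R : realType) (G : R[i] -> R[i]) (r : R) : R :=
  \int[lebesgue_measure]_(t in `[0, pi *+ 2]) Re (G (r%:C * cis t)).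

Lemma scale_cis (R : realType) (r t : R) :
  r%:C * cis t = (r * cos t) +i* (r * sin t).
Proof. by rewrite /cis; simpc. Qed.

(* In polar coordinates [G] gives the closed form [(Im G / r) dr + Re G dt]. *)
Lemma circle_mean_const (R : realType) (G : R[i] -> R[i]) (r1 r2 : R) :
  0 < r1 -> r1 <= r2 ->
  (forall z, r1 <= cabs z <= r2 -> derivable (G : R[i]^o -> R[i]^o) z 1) ->
  circle_mean G r1 = circle_mean G r2.
Proof.
move=> r10 r12 dG.
pose q (x y : R) := Re (G ((x * cos y) +i* (x * sin y))).
pose v (x y : R) := Im (G ((x * cos y) +i* (x * sin y))).
pose p (x y : R) := v x y * x^-1.
have pi20 : 0 <= pi *+ 2 :> R by rewrite mulrn_wge0// pi_ge0.
have := @goursat_rectangle R p q r1 r2 0 (pi *+ 2) r12 pi20.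
(* The two radial sides of the polar rectangle lie on one ray, as cis 0 = cis (2 pi), and they
   cancel. *)
rewrite (_ : (fun x => p x 0) = (fun x => p x (pi *+ 2))); last first.
  apply/funext => x; by rewrite /p /v cos0 sin0 cos2pi sin2pi.
rewrite subrr add0r => H.
have {}H : circle_mean G r2 - circle_mean G r1 = 0.
  under [X in X - _]eq_Rintegral do rewrite scale_cis.
  under [X in _ - X]eq_Rintegral do rewrite scale_cis.
  apply: H => x y xr _.
  have x0 : x != 0 by rewrite gt_eqF//; lra.
  have [|a [b [hRe hIm]]] := @derivable_first_order R G (x * cos y) (x * sin y).
    apply: dG; rewrite -scale_cis cabsM cabs_cis cabs_real mulr1.
    by rewrite ger0_norm//; lra.
  have hX : first_order (fun x y => x * cos y) x y (cos y * 1 + x * 0)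
      (cos y * 0 + x * - sin y).
    apply: (first_order_comp (first_order_mul x (cos y))).
      exact: (first_order_fst y (is_derive_id x 1)).
    exact: (first_order_snd x (is_derive_cos y)).
  have hY : first_order (fun x y => x * sin y) x y (sin y * 1 + x * 0)
      (sin y * 0 + x * cos y).
    apply: (first_order_comp (first_order_mul x (sin y))).
      exact: (first_order_fst y (is_derive_id x 1)).
    exact: (first_order_snd x (is_derive_sin y)).
  have hq := first_order_comp (X := fun x y => x * cos y)
    (Y := fun x y => x * sin y) hRe hX hY.
  have hv := first_order_comp (X := fun x y => x * cos y)
    (Y := fun x y => x * sin y) hIm hX hY.
  have /derivableP hV : derivable (fun x : R => x^-1) x 1.
    by apply: derivableV => //; exact: derivable_id.
  have hp := first_order_comp (X := v) (Y := fun x _ => x^-1) (first_order_mul (v x y) x^-1) hv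
    (first_order_fst y hV).
  do 3 eexists; split; [exact: hp | rewrite -/q].
  (* Cauchy-Riemann in polar form: the t-derivative of Im G / r, already fixed by [hp], equals the
     r-derivative of Re G. *)
  move: hq; rewrite -/q; congr first_order; field; exact: x0.
by apply/eqP; rewrite eq_sym -subr_eq0 H.
Qed.

Lemma continuous_cabsP (R : realType) (G : R[i] -> R[i]) (z : R[i]) :
  {for z, continuous (G : R[i]^o -> R[i]^o)} <->
  forall e, 0 < e -> exists2 d, 0 < d & forall w, cabs (w - z) < d ->
    cabs (G w - G z) <= e.
Proof.
split=> [cG e e0|h].
  have ec0 : 0 < e%:C by rewrite ltcR.
  move/cvgrPdist_le : cG => /(_ _ ec0).
  rewrite -nbhs_nearE => /nbhs_complexP[d d0 dP]; exists d => // w /dP.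
  by rewrite /= cabsE lecR cabsB.
apply/(@cvgrPdist_le _ _ _ (nbhs (z : R[i]^o))) => e e0.
have eE : e = (Re e)%:C by rewrite RRe_real// gtr0_real.
have [|d d0 dP] := h (Re e); first by rewrite -ltcR -eE.
apply/nbhs_complexP; exists d => // w /dP.
by rewrite /= cabsE eE lecR cabsB.
Qed.

Lemma cis_dist (R : realType) (r r' t t' : R) :
  cabs (r'%:C * cis t' - r%:C * cis t) <=
  `|r' - r| + `|r| * (`|cos t' - cos t| + `|sin t' - sin t|).
Proof.
rewrite (_ : _ - _ = (r' - r)%:C * cis t' + r%:C * (cis t' - cis t)); last first.
  by rewrite rmorphB/=; ring.
apply: (le_trans (le_cabsD _ _)); rewrite !cabsM !cabs_real cabs_cis mulr1.
by rewrite lerD2l ler_wpM2l//; exact: (cabs_le (cis t' - cis t)).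
Qed.

Lemma cis_near (R : realType) (t e : R) : 0 < e -> \forall t' \near t,
  `|cos t' - cos t| + `|sin t' - sin t| < e.
Proof.
move=> e0; have e20 : 0 < e / 2 by rewrite divr_gt0.
have /cvgrPdist_lt/(_ _ e20) hc := @continuous_cos R t.
have /cvgrPdist_lt/(_ _ e20) hs := @continuous_sin R t.
near=> t'.
have : `|cos t - cos t'| < e / 2 by near: t'.
have : `|sin t - sin t'| < e / 2 by near: t'.
rewrite (distrC (cos t)) (distrC (sin t)); lra.
Unshelve. all: by end_near. Qed.

Lemma cis_ray_continuous (R : realType) (G : R[i] -> R[i]) (r t : R) :
  {for r%:C * cis t, continuous (G : R[i]^o -> R[i]^o)} ->
  {for t, continuous (fun t => Re (G (r%:C * cis t)))}.
Proof.
move=> /continuous_cabsP cG; apply: continuous_dist => e /cG[d d0 dP].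
have k0 : 0 < `|r| + 1 by rewrite ltr_wpDl.
have := @cis_near R t (d / (`|r| + 1)) (divr_gt0 d0 k0).
rewrite -nbhs_nearE => /nbhs_ballP[c /= c0 cP]; exists c => // t' tt'.
rewrite -ReN -ReD; apply: (le_trans (normr_Re_le _)); apply: dP.
apply: (le_lt_trans (cis_dist _ _ _ _)); rewrite subrr normr0 add0r.
have := cP t'; rewrite /ball/= distrC => /(_ tt').
rewrite ltr_pdivlMr// => h; apply: le_lt_trans h.
by rewrite mulrC ler_wpM2l ?addr_ge0// lerDl.
Qed.

Lemma circle_mean_le (R : realType) (G1 G2 : R[i] -> R[i]) (r1 r2 e : R) :
  (forall t, {for r1%:C * cis t, continuous (G1 : R[i]^o -> R[i]^o)}) ->
  (forall t, {for r2%:C * cis t, continuous (G2 : R[i]^o -> R[i]^o)}) ->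
  (forall t, 0 <= t <= pi *+ 2 ->
    `|Re (G1 (r1%:C * cis t)) - Re (G2 (r2%:C * cis t))| <= e) ->
  `|circle_mean G1 r1 - circle_mean G2 r2| <= e * (pi *+ 2).
Proof.
move=> c1 c2 h; have pi20 : 0 <= pi *+ 2 :> R by rewrite mulrn_wge0// pi_ge0.
have i1 := continuous_integrable_itv (a := 0) (b := pi *+ 2)
  (fun t _ => cis_ray_continuous (c1 t)).
have i2 := continuous_integrable_itv (a := 0) (b := pi *+ 2)
  (fun t _ => cis_ray_continuous (c2 t)).
rewrite /circle_mean -RintegralB//.
have /= := @Rintegral_itv_near_cst R (fun t => Re (G1 (r1%:C * cis t)) -
  Re (G2 (r2%:C * cis t))) 0 (pi *+ 2) 0 e pi20.
rewrite mul0r !subr0; apply.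
  by move=> t _; apply: continuousB; exact: cis_ray_continuous.
by move=> t; rewrite in_itv/= subr0; exact: h.
Qed.

(** Continuity at the points of the circle becomes uniform in the angle by compactness of [0, 2 pi].
    This makes the mean continuous in the radius. *)
Lemma cis_ray_unif_continuous (R : realType) (G : R[i] -> R[i]) (r0 e : R) :
  (forall t, {for r0%:C * cis t, continuous (G : R[i]^o -> R[i]^o)}) ->
  0 < e ->
  exists2 d, 0 < d & forall r, `|r - r0| < d ->
    forall t, 0 <= t <= pi *+ 2 ->
    `|Re (G (r%:C * cis t)) - Re (G (r0%:C * cis t))| <= e.
Proof.
move=> cG e0; have e20 : 0 < e / 2 by rewrite divr_gt0.
pose P (r t : R) := `|Re (G (r%:C * cis t)) - Re (G (r0%:C * cis t))| <= e.
have := (@segment_compact R 0 (pi *+ 2)).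
move=> /compact_near_coveringP/(_ _ (nbhs r0) P); case.
  move=> t _.
  have /continuous_cabsP/(_ _ e20)[d d0 dP] := cG t.
  have k0 : 0 < `|r0| + 1 by rewrite ltr_wpDl.
  have d20 : 0 < d / 2 by rewrite divr_gt0.
  have ht := @cis_near R t (d / 2 / (`|r0| + 1)) (divr_gt0 d20 k0).
  near=> t' r; rewrite /P.
  have h1 : `|cos t' - cos t| + `|sin t' - sin t| < d / 2 / (`|r0| + 1) by near: t'.
  have h2 : `|r - r0| < d / 2.
    by rewrite distrC; near: r; exact: nbhsx_ballx.
  have h3 : `|r0| * (`|cos t' - cos t| + `|sin t' - sin t|) < d / 2.
    move: h1; rewrite ltr_pdivlMr// => h; apply: le_lt_trans h.
    by rewrite mulrC ler_wpM2l ?addr_ge0// lerDl.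
  have c1 : cabs (G (r%:C * cis t') - G (r0%:C * cis t)) <= e / 2.
    apply: dP; apply: (le_lt_trans (cis_dist _ _ _ _)); lra.
  have c2 : cabs (G (r0%:C * cis t') - G (r0%:C * cis t)) <= e / 2.
    apply: dP; apply: (le_lt_trans (cis_dist _ _ _ _)); rewrite subrr normr0; lra.
  rewrite -ReN -ReD; apply: (le_trans (normr_Re_le _)).
  rewrite (_ : _ - _ = (G (r%:C * cis t') - G (r0%:C * cis t)) +
    - (G (r0%:C * cis t') - G (r0%:C * cis t))); last by ring.
  by apply: (le_trans (le_cabsD _ _)); rewrite cabsN; lra.
move=> d /= d0 dP; exists d => // r rr0 t t0; apply: dP; rewrite /ball/= ?in_itv//=.
by rewrite distrC.
Unshelve. all: by end_near. Qed.

Lemma eq_dist_le (R : realType) (a b : R) :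
  (forall e, 0 < e -> `|a - b| <= e) -> a = b.
Proof.
move=> h; apply/eqP; rewrite -subr_eq0 -normr_eq0 eq_le normr_ge0 andbT.
by apply/ler_addgt0Pl => e /h; rewrite addr0.
Qed.

Lemma circle_mean_continuous (R : realType) (G : R[i] -> R[i]) (r0 Q e : R) :
  (forall z, cabs z < Q -> {for z, continuous (G : R[i]^o -> R[i]^o)}) ->
  0 <= r0 < Q -> 0 < e ->
  exists2 d, 0 < d & forall r, 0 <= r < Q -> `|r - r0| < d ->
    `|circle_mean G r - circle_mean G r0| <= e.
Proof.
move=> cG r0Q e0; have pi20 : 0 < pi *+ 2 :> R by rewrite mulrn_wgt0// pi_gt0.
have cGr r t : 0 <= r < Q ->
    {for r%:C * cis t, continuous (G : R[i]^o -> R[i]^o)}.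
  move=> rQ; apply: cG; rewrite cabsM cabs_real cabs_cis mulr1 ger0_norm; lra.
have [d d0 dP] := cis_ray_unif_continuous (fun t => cGr r0 t r0Q)
  (divr_gt0 e0 pi20).
exists d => // r rQ /dP h.
have := circle_mean_le (fun t => cGr r t rQ) (fun t => cGr r0 t r0Q) h.
by rewrite divfK// gt_eqF.
Qed.

(** The mean is constant on each range of radii that avoids 0 and |z0|, and its continuity in the
    radius joins these ranges to the value at radius 0. The two exceptional points serve for f(z)/z
    at 0 and for a difference quotient at z0. *)
Lemma circle_mean_center (R : realType) (G : R[i] -> R[i]) (z0 : R[i]) (Q r : R) :
  (forall z, cabs z < Q -> {for z, continuous (G : R[i]^o -> R[i]^o)}) ->
  (forall z, cabs z < Q -> z != 0 -> z != z0 ->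
    derivable (G : R[i]^o -> R[i]^o) z 1) ->
  0 <= r < Q -> circle_mean G r = Re (G 0) * (pi *+ 2).
Proof.
move=> cG dG; pose s := cabs z0; pose M := circle_mean G.
have s0 : 0 <= s := cabs_ge0 z0.
have pi20 : 0 <= pi *+ 2 :> R by rewrite mulrn_wge0// pi_ge0.
have M0 : M 0 = Re (G 0) * (pi *+ 2).
  rewrite /M /circle_mean; under eq_Rintegral do rewrite mul0r.
  by rewrite Rintegral_itv_cst// subr0.
(* An annulus on one side of the radius [s] contains neither 0 nor [z0]. *)
have Mc r1 r2 : 0 < r1 -> r1 <= r2 -> r2 < Q -> r2 < s \/ s < r1 -> M r1 = M r2.
  move=> r10 r12 r2Q sr; apply: circle_mean_const => // z zr.
  apply: dG; first lra.
    by rewrite -cabs_eq0 gt_eqF//; lra.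
  by apply: contraPneq zr => ->; rewrite -/s; lra.
have near0 r1 : 0 < r1 < Q -> r1 < s \/ s = 0 -> M r1 = M 0.
  move=> r1Q r1s; apply: eq_dist_le => e e0.
  have [|d d0 dP] := @circle_mean_continuous R G 0 Q e cG _ e0; first lra.
  have m0 : 0 < Num.min r1 (d / 2) by rewrite lt_min divr_gt0// andbT; lra.
  rewrite -(Mc (Num.min r1 (d / 2)) r1)//.
  - apply: dP; first by rewrite ltW// gt_min; apply/orP; left; lra.
    by rewrite subr0 gtr0_norm// gt_min; apply/orP; right; lra.
  - by rewrite ge_min lexx.
  - by lra.
  - by case: r1s => [|->]; [left|right].
rewrite -M0 -/M => rQ; have [->//|rn0] := eqVneq r 0.
have r0 : 0 < r by rewrite lt_def rn0; lra.
have Ms : 0 < s < Q -> M s = M 0.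
  move=> sQ; apply: eq_dist_le => e e0.
  have [|d d0 dP] := @circle_mean_continuous R G s Q e cG _ e0; first lra.
  pose l := Num.max (s / 2) (s - d / 2).
  have l1 : s / 2 <= l by rewrite le_max lexx.
  have l2 : s - d / 2 <= l by rewrite le_max lexx orbT.
  have l3 : l < s by rewrite gt_max; apply/andP; split; lra.
  rewrite -(near0 l); [|lra|by left].
  by rewrite distrC; apply: dP; [lra | rewrite ltr_norml; lra].
have [rs|sr|rs] := ltgtP r s; first by apply: near0; [lra|left].
  have [s00|sn0] := eqVneq s 0; first by apply: near0; [lra|right].
  have s1 : 0 < s by rewrite lt_def sn0.
  rewrite -Ms; last lra.
  apply: eq_dist_le => e e0.
  have [|d d0 dP] := @circle_mean_continuous R G s Q e cG _ e0; first lra.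
  pose u := Num.min r (s + d / 2).
  have u1 : u <= r by rewrite ge_min lexx.
  have u2 : u <= s + d / 2 by rewrite ge_min lexx orbT.
  have u3 : s < u by rewrite lt_min sr/=; lra.
  rewrite -(Mc u r); [|lra|lra|lra|by right].
  by apply: dP; [lra | rewrite ltr_norml; lra].
by rewrite rs; apply: Ms; lra.
Qed.

(** * Closure rules for holomorphic functions *)

Section holomorphic_at.
Variable C : numFieldType.
Implicit Types f g : C -> C.

Definition holomorphic_at f (z : C) := derivable (f : C^o -> C^o) z 1.

Lemma holomorphic_atE f z :
  holomorphic_at f z <-> derivable (f : C^o -> C^o) z 1.
Proof. by []. Qed.

Lemma holomorphic_cst (c z : C) : holomorphic_at (fun=> c) z.
Proof. exact: derivable_cst. Qed.

Lemma holomorphic_id (z : C) : holomorphic_at id z.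
Proof. exact: derivable_id. Qed.

Arguments holomorphic_cst c z : clear implicits.
Arguments holomorphic_id z : clear implicits.

Lemma holomorphicD f g (z : C) : holomorphic_at f z -> holomorphic_at g z ->
  holomorphic_at (fun x => f x + g x) z.
Proof. exact: derivableD. Qed.

Lemma holomorphicB f g (z : C) : holomorphic_at f z -> holomorphic_at g z ->
  holomorphic_at (fun x => f x - g x) z.
Proof. exact: derivableB. Qed.

Lemma holomorphicM f g (z : C) : holomorphic_at f z -> holomorphic_at g z ->
  holomorphic_at (fun x => f x * g x) z.
Proof. exact: derivableM. Qed.

Lemma holomorphicV f (z : C) : f z != 0 -> holomorphic_at f z ->
  holomorphic_at (fun x => (f x)^-1) z.
Proof. exact: derivableV. Qed.

Lemma holomorphic_scale f (c z : C) : holomorphic_at f (c * z) ->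
  holomorphic_at (fun x => f (c * x)) z.
Proof.
rewrite /holomorphic_at => /derivable1_diffP df; apply/derivable1_diffP.
apply: (@differentiable_comp _ _ _ _ (fun x : C^o => c * x : C^o) f) => //.
Qed.

Lemma holomorphic_continuous f (z : C) : holomorphic_at f z ->
  {for z, continuous (f : C^o -> C^o)}.
Proof. by move=> /derivable1_diffP /differentiable_continuous. Qed.

Lemma holomorphic_slope f (w A z : C) : z != w -> holomorphic_at f z ->
  holomorphic_at (fun x => A + (f x - f w - A * (x - w)) / (x - w)) z.
Proof.
move=> zw df; have hw := holomorphicB (holomorphic_id z) (holomorphic_cst w z).
have zw0 : z - w != 0 by rewrite subr_eq0.
have hV := holomorphicV (f := fun x => x - w) zw0 hw.
have hf := holomorphicB df (holomorphic_cst (f w) z).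
have hN := holomorphicB hf (holomorphicM (holomorphic_cst A z) hw).
exact: (holomorphicD (holomorphic_cst A z) (holomorphicM hN hV)).
Qed.

Lemma ccontinuousD f g (z : C) :
  {for z, continuous (f : C^o -> C^o)} -> {for z, continuous (g : C^o -> C^o)} ->
  {for z, continuous ((fun x => f x + g x) : C^o -> C^o)}.
Proof. exact: continuousD. Qed.

Lemma ccontinuousM f g (z : C) :
  {for z, continuous (f : C^o -> C^o)} -> {for z, continuous (g : C^o -> C^o)} ->
  {for z, continuous ((fun x => f x * g x) : C^o -> C^o)}.
Proof. exact: continuousM. Qed.

Lemma ccontinuous_scale f (c z : C) : {for c * z, continuous (f : C^o -> C^o)} ->
  {for z, continuous ((fun x => f (c * x)) : C^o -> C^o)}.
Proof.
move=> cf; apply: (@continuous_comp _ _ _ (fun x : C^o => c * x : C^o)) => //.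
exact: mulrl_continuous.
Qed.

End holomorphic_at.

Arguments holomorphic_cst {C} c z.
Arguments holomorphic_id {C} z.
Opaque holomorphic_at.

(** * The Poisson formula and Harnack's inequality *)

(* The difference quotient of [g] at [w], with value [A] at [w] itself since
   [0 / 0 = 0]. *)
Definition slope (R : realType) (g : R[i] -> R[i]) (w A x : R[i]) : R[i] :=
  A + (g x - g w - A * (x - w)) / (x - w).

Section slope.
Variable R : realType.
Implicit Types (g : R[i] -> R[i]) (w A x z : R[i]).

Lemma slopeE g w A x : x != w -> slope g w A x = (g x - g w) / (x - w).
Proof.
rewrite -subr_eq0 => xw; rewrite /slope mulrBl mulfK//.
by rewrite addrC subrK.
Qed.

Lemma slope_at g w A : slope g w A w = A.
Proof. by rewrite /slope !subrr mulr0 subrr mul0r addr0. Qed.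

Lemma slope_continuous g w A :
  (forall e, 0 < e -> exists2 d, 0 < d & forall x, cabs (x - w) < d ->
    cabs (g x - g w - A * (x - w)) <= e * cabs (x - w)) ->
  {for w, continuous (slope g w A : R[i]^o -> R[i]^o)}.
Proof.
move=> h; apply/continuous_cabsP => e /[dup] e0 /h[d d0 dP].
exists d => // x /dP xP; rewrite slope_at /slope addrC addKr cabsM cabsV.
have [->|xw] := eqVneq x w; first by rewrite !subrr cabs0 invr0 mulr0 ltW.
by rewrite ler_pdivrMr// cabs_gt0 subr_eq0.
Qed.

Lemma holomorphic_expand g w : holomorphic_at g w -> exists A,
  forall e, 0 < e -> exists2 d, 0 < d & forall x, cabs (x - w) < d ->
    cabs (g x - g w - A * (x - w)) <= e * cabs (x - w).
Proof.
by move=> /holomorphic_atE /derivable_expandc h; eexists; exact: h.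
Qed.

End slope.

Definition poisson (R : realType) (w : R[i]) (t : R) : R :=
  (1 - cabs w ^+ 2) / cabs (cis t - w) ^+ 2.

Section poisson.
Variable R : realType.
Implicit Types (g : R[i] -> R[i]) (w z : R[i]) (t : R).

Lemma cabs_sqrC z : (cabs z ^+ 2)%:C = z * z^*.
Proof. by rewrite rmorphXn/= -cabsE sqr_normc. Qed.

Lemma cis_conj t : cis t * (cis t)^* = 1.
Proof. by rewrite -cabs_sqrC cabs_cis expr1n. Qed.

Lemma cis_neq0 t : cis t != 0.
Proof. by rewrite -cabs_gt0 cabs_cis. Qed.

Lemma cis_neq w t : cabs w < 1 -> cis t - w != 0.
Proof.
by move=> w1; rewrite subr_eq0; apply: contraTneq w1 => <-; rewrite cabs_cis ltxx.
Qed.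

Lemma conj_mul_neq1 w z : cabs w * cabs z < 1 -> 1 - w^* * z != 0.
Proof.
move=> wz; rewrite subr_eq0; apply: contraTneq wz => e1.
have : cabs (w^* * z) = 1 by rewrite -e1 (cabs_real 1) normr1.
by rewrite cabsM {1}/cabs normcJ -/(cabs w) => ->; rewrite ltxx.
Qed.

(** The Herglotz kernel (1 + conj(w) z) / (1 - conj(w) z) is [1 + 2 * herglotz w z]. In this form it
    is holomorphic in z past the closed disc and vanishes at z = 0. *)
Definition herglotz w z : R[i] := w^* * z / (1 - w^* * z).

Lemma herglotz_field (F : fieldType) (c w d : F) :
  c - w != 0 -> c != 0 -> c * d = 1 -> c / (c - w) = 1 + w * d / (1 - w * d).
Proof.
move=> cw c0 cd; have -> : d = c^-1 by apply: (mulfI c0); rewrite cd divff.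
by field; rewrite cw c0.
Qed.

Lemma herglotz_conj w z : (herglotz w z)^* = w * z^* / (1 - w * z^*).
Proof.
by rewrite /herglotz rmorphM fmorphV rmorphB rmorph1 rmorphM /= conjcK.
Qed.

(** On the circle 1 - conj(w) z = z (conj(z) - conj(w)), so both fractions have the common
    denominator |z - w|^2. The first is the Cauchy kernel with its pole at [w], the second a
    correction holomorphic in the disc. *)
Lemma poissonE w t : cabs w < 1 ->
  (poisson w t)%:C = cis t / (cis t - w) + herglotz w (cis t).
Proof.
move=> w1; have cw := cis_neq t w1; have c0 := cis_neq0 t.
have cw1 : 1 - w^* * cis t != 0 by apply: conj_mul_neq1; rewrite cabs_cis mulr1.
rewrite /poisson rmorphM/= fmorphV/= rmorphB/= !cabs_sqrC rmorphB/=.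
have e : 1 - w^* * cis t = cis t * ((cis t)^* - w^*).
  by rewrite mulrBr cis_conj [w^* * _]mulrC.
rewrite /herglotz e; have : (cis t)^* - w^* != 0.
  by apply: contra_neq cw1; rewrite e => ->; rewrite mulr0.
move: (cis_conj t) cw c0; move: (cis t) (cis t)^* => c c' cc' cw c0 c'w.
rewrite (_ : 1%:C = c * c^*)//; move: (c^*) (w^*) c'w => d v dv.
by field; rewrite dv c0.
Qed.

Lemma poisson_Re w t : cabs w < 1 ->
  poisson w t = 1 + 2 * Re (herglotz w (cis t)).
Proof.
move=> w1; have cw := cis_neq t w1; have c0 := cis_neq0 t.
have cw1 : 1 - w^* * cis t != 0 by apply: conj_mul_neq1; rewrite cabs_cis mulr1.
apply: complexI; rewrite poissonE// rmorphD/= rmorphM/=.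
rewrite (_ : 2%:C = 2%:R) ?rmorph_nat// -addcJ addrA [RHS]addrAC; congr (_ + _).
rewrite herglotz_conj (_ : 1%:C = 1)//.
exact: (herglotz_field cw c0 (cis_conj t)).
Qed.

Lemma holomorphic_herglotz w z : cabs w * cabs z < 1 ->
  holomorphic_at (herglotz w) z.
Proof.
move=> wz; have hm := holomorphicM (holomorphic_cst w^* z) (holomorphic_id z).
have hd : holomorphic_at (fun z => 1 - w^* * z) z.
  by apply: holomorphicB hm; exact: holomorphic_cst.
exact: (holomorphicM hm (holomorphicV (f := fun z => 1 - w^* * z)
  (conj_mul_neq1 wz) hd)).
Qed.

Lemma poisson0 t : poisson 0 t = 1.
Proof. by rewrite /poisson cabs0 subr0 cabs_cis expr1n expr0n subr0 divr1. Qed.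

Lemma cabs_lt_inv w z : cabs z < (cabs w)^-1 -> cabs w * cabs z < 1.
Proof.
have [->|w0] := eqVneq w 0; first by rewrite cabs0 mul0r.
by rewrite -ltr_pdivlMl ?cabs_gt0// mulr1.
Qed.

Lemma invr_cabs_gt1 w : w != 0 -> cabs w < 1 -> 1 < (cabs w)^-1.
Proof. by move=> w0 w1; rewrite invf_gt1// cabs_gt0. Qed.

Lemma mean_herglotz w : w != 0 -> cabs w < 1 -> circle_mean (herglotz w) 1 = 0.
Proof.
move=> w0 w1; have Q1 := invr_cabs_gt1 w0 w1.
rewrite (@circle_mean_center _ _ 0 (cabs w)^-1); last by rewrite ler01.
- by rewrite /herglotz mulr0 mul0r mul0r.
- by move=> z /cabs_lt_inv /holomorphic_herglotz; exact: holomorphic_continuous.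
- by move=> z /cabs_lt_inv /holomorphic_herglotz hz _ _; exact/holomorphic_atE.
Qed.

End poisson.

Section poisson_formula.
Variable R : realType.
Implicit Types (g : R[i] -> R[i]) (w z : R[i]) (t : R).

Lemma cis_continuous_Re (G : R[i] -> R[i]) :
  (forall t, {for cis t, continuous (G : R[i]^o -> R[i]^o)}) ->
  forall t, {for t, continuous (fun t => Re (G (cis t)))}.
Proof.
move=> cG t; have := @cis_ray_continuous R G 1 t.
rewrite mul1r => /(_ (cG t)).
by under [X in {for _, continuous X}]eq_fun do rewrite mul1r.
Qed.

Lemma circle_mean1 (G : R[i] -> R[i]) :
  circle_mean G 1 = \int[lebesgue_measure]_(t in `[0, pi *+ 2]) Re (G (cis t)).
Proof. by apply: eq_Rintegral => t _; rewrite mul1r. Qed.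

Lemma poisson_continuous w : cabs w < 1 ->
  forall t, {for t, continuous (poisson w)}.
Proof.
move=> w1 t.
have -> : poisson w = (fun t => 1 + 2 * Re (herglotz w (cis t))).
  by apply/funext => s; rewrite poisson_Re.
apply: continuousD; first exact: cst_continuous.
apply: continuousM; first exact: cst_continuous.
apply: cis_continuous_Re => s; apply: holomorphic_continuous.
by apply: holomorphic_herglotz; rewrite cabs_cis mulr1.
Qed.

Lemma mean_poisson w : cabs w < 1 ->
  \int[lebesgue_measure]_(t in `[0, pi *+ 2]) poisson w t = pi *+ 2.
Proof.
move=> w1; have pi20 : 0 <= pi *+ 2 :> R by rewrite mulrn_wge0// pi_ge0.
have [->|w0] := eqVneq w 0.
  under eq_Rintegral do rewrite poisson0.
  by rewrite Rintegral_itv_cst// subr0 mul1r.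
under eq_Rintegral do rewrite poisson_Re//.
have ch t : {for t, continuous (fun t => Re (herglotz w (cis t)))}.
  apply: cis_continuous_Re => s; apply: holomorphic_continuous.
  by apply: holomorphic_herglotz; rewrite cabs_cis mulr1.
have ih := continuous_integrable_itv (a := 0) (b := pi *+ 2) (fun t _ => ch t).
rewrite RintegralD//; last 2 first.
- by apply: continuous_integrable_itv => t _; exact: cst_continuous.
- apply: continuous_integrable_itv => t _.
  by apply: continuousM; [exact: cst_continuous | exact: ch].
rewrite RintegralZl// -circle_mean1 mean_herglotz// mulr0 addr0.
by rewrite Rintegral_itv_cst// subr0 mul1r.
Qed.

(** Mere continuity at 0 is assumed because the formula will be applied to f(z)/z. A single function
    G with mean zero and real part (Re g - Re (g w)) times the kernel gives the result, as the
    kernel has mass 2 pi. *)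
Lemma poisson_formula g (Q : R) w : 1 < Q ->
  (forall z, cabs z < Q -> {for z, continuous (g : R[i]^o -> R[i]^o)}) ->
  (forall z, cabs z < Q -> z != 0 -> holomorphic_at g z) ->
  cabs w < 1 ->
  \int[lebesgue_measure]_(t in `[0, pi *+ 2]) (Re (g (cis t)) * poisson w t) =
  Re (g w) * (pi *+ 2).
Proof.
move=> Q1 cg hg w1; have [->|w0] := eqVneq w 0.
  under eq_Rintegral do rewrite poisson0 mulr1.
  rewrite -circle_mean1 (@circle_mean_center _ _ 0 Q)//; last by rewrite ler01.
  by move=> z zQ z0 _; apply/holomorphic_atE; exact: hg.
have wQ : cabs w < Q by lra.
have [A hA] := holomorphic_expand (hg w wQ w0).
(* On the circle [Re (z / (z - w) + herglotz w z)] is the Poisson kernel, and the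
   singularity of [(g z - g w) * z / (z - w)] at [w] is removable. *)
pose G z := slope g w A z * z + (g z - g w) * herglotz w z.
(* Radii below 1 / |w| keep away from the pole of [herglotz w]. *)
pose Q' := Num.min Q (cabs w)^-1.
have Q'1 : 1 < Q' by rewrite lt_min Q1 invr_cabs_gt1.
have lt1 z : cabs z < Q' -> cabs z < Q by rewrite lt_min => /andP[].
have lt2 z : cabs z < Q' -> cabs w * cabs z < 1.
  by rewrite lt_min => /andP[_ /cabs_lt_inv].
have cid z : {for z, continuous (id : R[i]^o -> R[i]^o)}.
  exact: holomorphic_continuous (holomorphic_id z).
have ccst c z : {for z, continuous ((fun=> c) : R[i]^o -> R[i]^o)}.
  exact: holomorphic_continuous (holomorphic_cst c z).
have cgw z : cabs z < Q' ->
    {for z, continuous ((fun z => g z + - g w) : R[i]^o -> R[i]^o)}.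
  by move=> /lt1/cg h; exact: (ccontinuousD h (ccst _ z)).
have cH z : cabs z < Q' -> {for z, continuous (herglotz w : R[i]^o -> R[i]^o)}.
  by move=> /lt2/holomorphic_herglotz; exact: holomorphic_continuous.
have cS z : cabs z < Q' -> {for z, continuous (slope g w A : R[i]^o -> R[i]^o)}.
  move=> zQ; have [->|zw] := eqVneq z w; first exact: slope_continuous.
  have [z0|z0] := eqVneq z 0; last first.
    by apply: holomorphic_continuous; apply: holomorphic_slope => //; apply: hg => //; exact: lt1.
  have hl : holomorphic_at (fun z => z - w) z.
    exact: holomorphicB (holomorphic_id z) (holomorphic_cst w z).
  have zw0 : z - w != 0 by rewrite subr_eq0.
  have cV := holomorphic_continuous (holomorphicV (f := fun z => z - w) zw0 hl).
  have cN := ccontinuousD (cgw z zQ) (holomorphic_continuous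
    (holomorphicM (holomorphic_cst (- A) z) hl)).
  have := ccontinuousD (ccst A z) (ccontinuousM cN cV).
  have -> // : (fun x => A + (g x + - g w + - A * (x - w)) / (x - w)) = slope g w A.
  by apply/funext => x; rewrite mulNr.
(* Both summands of [G] vanish at 0: one through the factor z, the other through
   [herglotz w 0 = 0]. *)
have M0 : circle_mean G 1 = 0.
  rewrite (@circle_mean_center _ G w Q').
  - by rewrite /G /herglotz !mulr0 mul0r mulr0 addr0 mul0r.
  - move=> z zQ; exact: (ccontinuousD (ccontinuousM (cS z zQ) (cid z))
      (ccontinuousM (cgw z zQ) (cH z zQ))).
  - move=> z zQ z0 zw; apply/holomorphic_atE.
    have hgz := hg z (lt1 z zQ) z0.
    have hS := holomorphic_slope (A := A) zw hgz.
    have hB := holomorphicB hgz (holomorphic_cst (g w) z).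
    exact: (holomorphicD (holomorphicM hS (holomorphic_id z))
      (holomorphicM hB (holomorphic_herglotz (lt2 z zQ)))).
  - by rewrite ler01.
have GE t : Re (G (cis t)) = Re (g (cis t)) * poisson w t - Re (g w) * poisson w t.
  have cw : cis t != w by rewrite -subr_eq0 cis_neq.
  rewrite /G slopeE// mulrAC -mulrA -mulrDr -poissonE//.
  by rewrite ReM ReD ReN /= mulr0 subr0 mulrBl.
have cgc t : {for t, continuous (fun t => Re (g (cis t)))}.
  by apply: cis_continuous_Re => s; apply: cg; rewrite cabs_cis.
have cp := poisson_continuous w1.
move: M0; rewrite circle_mean1; under eq_Rintegral do rewrite GE.
rewrite RintegralB//; last 2 first.
- by apply: continuous_integrable_itv => t _; exact: (continuousM (cgc t) (cp t)).
- apply: continuous_integrable_itv => t _.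
  by apply: continuousM; [exact: cst_continuous | exact: cp].
rewrite RintegralZl//; last exact: continuous_integrable_itv (fun t _ => cp t).
by rewrite mean_poisson// => /eqP; rewrite subr_eq0 => /eqP.
Qed.

End poisson_formula.

Section harnack.
Variable R : realType.
Implicit Types (g h : R[i] -> R[i]) (w z : R[i]) (t : R).

Lemma poisson_ge w t : cabs w < 1 ->
  (1 - cabs w) / (1 + cabs w) <= poisson w t.
Proof.
move=> w1; have w0 := cabs_ge0 w.
have d0 : 0 < cabs (cis t - w) by rewrite cabs_gt0 cis_neq.
have dle : cabs (cis t - w) <= 1 + cabs w.
  by apply: (le_trans (le_cabsD _ _)); rewrite cabsN cabs_cis.
rewrite /poisson ler_pdivlMr ?exprn_gt0// mulrAC ler_pdivrMr; last lra.
rewrite (_ : 1 - _ ^+ 2 = (1 - cabs w) * (1 + cabs w)); last by ring.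
rewrite -mulrA ler_pM2l; last lra.
by rewrite -expr2 ler_sqr ?nnegrE// ?ltW//; lra.
Qed.

Lemma poisson_ge0 w t : cabs w < 1 -> 0 <= poisson w t.
Proof.
move=> w1; apply: le_trans (poisson_ge t w1); have := cabs_ge0 w => w0.
by rewrite divr_ge0//; lra.
Qed.

Lemma poisson_le w t : cabs w < 1 ->
  poisson w t <= (1 + cabs w) / (1 - cabs w).
Proof.
move=> w1; have w0 := cabs_ge0 w.
have w10 : 0 < 1 - cabs w by rewrite subr_gt0.
have dge : 1 - cabs w <= cabs (cis t - w).
  have := le_cabsD (cis t - w) w; rewrite subrK cabs_cis; lra.
have d0 : 0 < cabs (cis t - w) by lra.
rewrite /poisson ler_pdivrMr ?exprn_gt0// mulrAC ler_pdivlMr//.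
rewrite (_ : 1 - _ ^+ 2 = (1 + cabs w) * (1 - cabs w)); last by ring.
rewrite -mulrA ler_pM2l; last lra.
by rewrite -expr2 ler_sqr ?nnegrE// ltW.
Qed.

(** The nonnegative function M - Re h is integrated against the Poisson kernel of [w], which is at
    least (1 - |w|) / (1 + |w|) times that of 0. *)
Lemma harnack h (Q M : R) w : 1 < Q ->
  (forall z, cabs z < Q -> {for z, continuous (h : R[i]^o -> R[i]^o)}) ->
  (forall z, cabs z < Q -> z != 0 -> holomorphic_at h z) ->
  (forall t, Re (h (cis t)) <= M) -> cabs w < 1 ->
  Re (h 0) <= M /\
  (1 - cabs w) / (1 + cabs w) * (M - Re (h 0)) <= M - Re (h w).
Proof.
move=> Q1 ch hh hM w1.
have pi20 : 0 < pi *+ 2 :> R by rewrite mulrn_wgt0// pi_gt0.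
have chc t : {for t, continuous (fun t => Re (h (cis t)))}.
  by apply: cis_continuous_Re => s; apply: ch; rewrite cabs_cis.
have cM t : {for t, continuous (fun t => M - Re (h (cis t)))}.
  by apply: continuousB; [exact: cst_continuous | exact: chc].
have main v : cabs v < 1 -> \int[lebesgue_measure]_(t in `[0, pi *+ 2])
    ((M - Re (h (cis t))) * poisson v t) = (M - Re (h v)) * (pi *+ 2).
  move=> v1; have cp := poisson_continuous v1.
  under eq_Rintegral do rewrite mulrBl.
  rewrite RintegralB//; last 2 first.
  - apply: continuous_integrable_itv => t _.
    by apply: continuousM; [exact: cst_continuous | exact: cp].
  - by apply: continuous_integrable_itv => t _; exact: (continuousM (chc t) (cp t)).
  rewrite RintegralZl//; last exact: continuous_integrable_itv (fun t _ => cp t).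
  by rewrite mean_poisson// (poisson_formula Q1)// mulrBl.
have m0 := main 0; rewrite cabs0 in m0; have {}m0 := m0 ltr01.
have intp v : cabs v < 1 -> (@lebesgue_measure R).-integrable `[0, pi *+ 2]
    (EFin \o (fun t => (M - Re (h (cis t))) * poisson v t)).
  move=> v1; have cp := poisson_continuous v1.
  by apply: continuous_integrable_itv => t _; exact: (continuousM (cM t) (cp t)).
have cabs01 : cabs (0 : R[i]) < 1 by rewrite cabs0.
split.
  rewrite -subr_ge0 -(pmulr_lge0 _ pi20) -m0; apply: Rintegral_ge0 => t _.
  by rewrite mulr_ge0 ?poisson_ge0// subr_ge0.
set k := _ / _; rewrite -(ler_pM2r pi20) -(mulrA k) -m0 -(main w)//.
rewrite -RintegralZl//; last exact: intp.
apply: le_Rintegral => //; [|exact: intp|].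
  have cp := poisson_continuous cabs01.
  apply: continuous_integrable_itv => t _; apply: continuousM.
    exact: cst_continuous.
  exact: (continuousM (cM t) (cp t)).
move=> t _; rewrite poisson0 mulr1 mulrC; apply: ler_wpM2l; rewrite ?subr_ge0//.
exact: poisson_ge.
Qed.

Lemma unit_rotation z : exists2 c : R[i], cabs c = 1 & c * z = (cabs z)%:C.
Proof.
have [->|z0] := eqVneq z 0.
  by exists 1; rewrite ?(cabs_real 1) ?normr1// mulr0 cabs0.
have cz0 : cabs z != 0 by rewrite cabs_eq0.
exists ((cabs z)%:C / z); last by rewrite divfK.
by rewrite cabsM cabsV cabs_real ger0_norm ?cabs_ge0// divff.
Qed.

(** Harnack's inequality is applied to the real part of c * g(x)/x, where |c| = 1 rotates the value
    at x = z onto the nonnegative axis; the value at x = 0 is c * g'(0), of real part at most [lam].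
    The factor 1 / 2 comes from 1 + |z| <= 2. *)
Lemma schwarz_contraction g z (lam : R) :
  (forall z, cabs z < 1 -> holomorphic_at g z) ->
  (forall z, cabs z < 1 -> cabs (g z) < 1) -> g 0 = 0 ->
  cabs (derive1 (g : R[i]^o -> R[i]^o) 0) <= lam -> lam <= 1 -> cabs z < 1 ->
  cabs (g z) <= cabs z * (1 - (1 - lam) / 2 * (1 - cabs z)).
Proof.
move=> hg g1 g0; set A := derive1 _ _ => Alam lam1 z1.
have lam0 : 0 <= lam := le_trans (cabs_ge0 _) Alam.
have [->|z0] := eqVneq z 0; first by rewrite g0 cabs0 mul0r.
pose q := slope g 0 A.
have o0 : cabs (0 : R[i]) < 1 by rewrite cabs0.
have qE x : x != 0 -> q x = g x / x by move=> x0; rewrite /q slopeE// g0 !subr0.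
have hq x : cabs x < 1 -> x != 0 -> holomorphic_at q x.
  by move=> x1 x0; apply: holomorphic_slope => //; exact: hg.
have cq x : cabs x < 1 -> {for x, continuous (q : R[i]^o -> R[i]^o)}.
  move=> x1; have [->|x0] := eqVneq x 0; last exact: holomorphic_continuous (hq x x1 x0).
  apply: slope_continuous; apply: derivable_expandc; apply/holomorphic_atE.
  exact: hg.
have q0 : q 0 = A by exact: slope_at.
(* Harnack asks for a disc of radius above 1, so the quotient is dilated by rho < 1. On the unit
   circle |g| < 1 then gives the bound 1 / rho, and [w] is the point that the dilation sends to
   [z]. *)
have main rho c : cabs c = 1 -> cabs z < rho < 1 -> let w := z / rho%:C in
    Re (c * A) <= rho^-1 /\
    (1 - cabs w) / (1 + cabs w) * (rho^-1 - Re (c * A)) <= rho^-1 - Re (c * q z).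
  move=> c1 zr w; have rho0 : 0 < rho by have := cabs_ge0 z; lra.
  have rhoC0 : rho%:C != 0 by rewrite -cabs_eq0 cabs_real normr_eq0 gt_eqF.
  pose h x := c * q (rho%:C * x).
  have Q1 : 1 < rho^-1 by rewrite invf_gt1//; lra.
  have lt1 x : cabs x < rho^-1 -> cabs (rho%:C * x) < 1.
    by rewrite cabsM cabs_real gtr0_norm// -ltr_pdivlMl// mulr1.
  have w1 : cabs w < 1.
    rewrite cabsM cabsV cabs_real gtr0_norm// ltr_pdivrMr//; lra.
  have := @harnack h rho^-1 rho^-1 w Q1.
  rewrite /h mulr0 q0 [rho%:C * w]mulrC divfK//; apply => //.
  - move=> x /lt1/cq/ccontinuous_scale cx.
    exact: (ccontinuousM (holomorphic_continuous (holomorphic_cst c x)) cx).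
  - move=> x /lt1 x1 x0.
    have /holomorphic_scale hs := hq _ x1 (mulf_neq0 rhoC0 x0).
    exact: (holomorphicM (holomorphic_cst c x) hs).
  - move=> t; have x0 : rho%:C * cis t != 0 by rewrite mulf_neq0// cis_neq0.
    have x1 : cabs (rho%:C * cis t) < 1 by rewrite lt1// cabs_cis.
    apply: (le_trans (ler_norm _)); apply: (le_trans (normr_Re_le _)).
    rewrite cabsM c1 mul1r qE// cabsM cabsV cabsM cabs_cis mulr1 cabs_real.
    by rewrite gtr0_norm// ler_piMl ?invr_ge0 ?ltW// g1.
have [c c1 cqz] := unit_rotation (q z).
have cz0 : 0 < cabs z by rewrite cabs_gt0.
rewrite -ler_pdivrMl//; have -> : (cabs z)^-1 * cabs (g z) = cabs (q z).
  by rewrite qE// cabsM cabsV mulrC.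
have rc : Re (c * q z) = cabs (q z) by rewrite cqz.
have rA : Re (c * A) <= lam.
  apply: (le_trans (ler_norm _)); apply: (le_trans (normr_Re_le _)).
  by rewrite cabsM c1 mul1r.
have key rho : cabs z < rho < 1 ->
    (rho - cabs z) / 2 * (1 - lam) <= 1 - rho * cabs (q z).
  move=> /andP zr; have [zr1 zr2] := zr; have rho0 : 0 < rho by lra.
  have [] := main rho c c1 (introT andP zr); rewrite /= rc cabsM cabsV cabs_real gtr0_norm//.
  move=> A1 h; have {h} : (rho - cabs z) / (rho + cabs z) * (1 - rho * Re (c * A)) <=
      1 - rho * cabs (q z).
    rewrite -(ler_pM2l rho0) in h.
    have -> : (rho - cabs z) / (rho + cabs z) * (1 - rho * Re (c * A)) =
      rho * ((1 - cabs z / rho) / (1 + cabs z / rho) * (rho^-1 - Re (c * A))).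
      have n1 : rho != 0 by rewrite gt_eqF.
      have n2 : rho + cabs z != 0 by rewrite gt_eqF// addr_gt0.
      by field; rewrite n1 n2.
    by apply: (le_trans h); rewrite mulrBr divff// gt_eqF.
  move=> h; apply: le_trans h.
  have rlam : rho * Re (c * A) <= lam.
    by have := ler_wpM2l (ltW rho0) rA; have := ler_piMl lam0 (ltW zr2); lra.
  apply: ler_pM; [by rewrite divr_ge0//; lra|lra| |lra].
  by rewrite ler_pM2l ?subr_gt0// lef_pV2 ?posrE; lra.
rewrite leNgt; apply/negP => qgt.
(* The limit rho -> 1, by contradiction: with S = |q z| + k, [key] says rho * S <= T whenever |z| <
   rho < 1, while the negated claim is T < S. *)
pose k := (1 - lam) / 2; pose T := 1 + k * cabs z.
have k0 : 0 <= k by rewrite divr_ge0//; lra.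
have T0 : 0 < T by rewrite ltr_wpDr// mulr_ge0// ltW.
have TS : T < cabs (q z) + k by move: qgt; rewrite -/k /T; lra.
pose S := cabs (q z) + k; have S0 : 0 < S := lt_trans T0 TS.
have TS1 : T / S < 1 by rewrite ltr_pdivrMr// mul1r.
pose rho := Num.max ((1 + cabs z) / 2) ((T / S + 1) / 2).
have rho1 : (1 + cabs z) / 2 <= rho by rewrite le_max lexx.
have rho2 : (T / S + 1) / 2 <= rho by rewrite le_max lexx orbT.
have rho3 : rho < 1 by rewrite gt_max; apply/andP; split; lra.
have TrS : T < rho * S by rewrite -ltr_pdivrMr//; lra.
have := key rho; rewrite (_ : _ / 2 * _ = rho * k - k * cabs z); last first.
  by rewrite /k; ring.
move: TrS; rewrite /T /S mulrDr => TrS h.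
have [|h1] := boolP (cabs z < rho < 1); first by move/h; lra.
by move/negP: h1; apply; apply/andP; split; lra.
Qed.

End harnack.

(** * Boundary maps *)

(** The angle in [0, 2 pi[ of a point x + iy of the unit circle, split by the sign of y so that
    measurability reduces to that of [acos]. *)
Definition arg (R : realType) (x y : R) : R :=
  if 0 <= y then acos x else pi *+ 2 - acos x.

(* The measurable structure on [R] of which [lebesgue_measure] is a measure. *)
Local Notation RM := measurableTypeR.

Definition circ (R : realType) : set (RM R) := `[0%R, (pi *+ 2)%R[%classic.

Section arg.
Variable R : realType.
Implicit Types (x y t : R).

Lemma circle_bounds x y : x ^+ 2 + y ^+ 2 = 1 -> -1 <= x <= 1.
Proof. by move=> h; have := sqr_ge0 y => y0; apply/andP; split; nra. Qed.

Lemma cis_arg x y : x ^+ 2 + y ^+ 2 = 1 -> cis (arg x y) = x +i* y.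
Proof.
move=> h; have xb := circle_bounds h.
have ys : Num.sqrt (1 - x ^+ 2) = `|y| by rewrite -h addrC addKr sqrtr_sqr.
rewrite /cis /arg; case: ifPn => y0.
  by rewrite acosK ?in_itv//= sin_acos// ys ger0_norm.
rewrite -[pi *+ 2 - _]addrC cosD2pi sinD2pi cosN sinN acosK ?in_itv//= sin_acos//.
by rewrite ys ltr0_norm ?opprK// ltNge.
Qed.

Lemma arg_circ x y : x ^+ 2 + y ^+ 2 = 1 -> circ (arg x y).
Proof.
move=> h; have xb := circle_bounds h; have p0 := pi_gt0 R.
have a0 := acos_ge0 xb; have a1 := acos_lepi xb.
rewrite /circ/= in_itv/= /arg mulr2n; case: ifPn => y0; first lra.
have x1 : x < 1.
  rewrite lt_neqAle; case/andP: xb => _ ->; rewrite andbT.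
  apply: contra y0 => /eqP x1; have : y ^+ 2 == 0 by apply/eqP; move: h; rewrite x1 expr1n; lra.
  by rewrite sqrf_eq0 => /eqP ->.
have := @acos_gt0 R x; case/andP: xb => -> _; rewrite x1 => /(_ isT); lra.
Qed.

Lemma measurable_acos : measurable_fun (`[-1, 1]%classic : set (RM R)) (@acos R : RM R -> RM R).
Proof.
apply: (@measurable_fun_itv_cc _ _ _ false true).
apply: open_continuous_measurable_fun; first exact: interval_open.
by move=> x; rewrite inE/= in_itv/=; exact: continuous_acos.
Qed.

Lemma measurable_arg (E : set (RM R)) (X Y : RM R -> RM R) : measurable E ->
  measurable_fun E X -> measurable_fun E Y ->
  (forall t, E t -> X t ^+ 2 + Y t ^+ 2 = 1) ->
  measurable_fun E (fun t => arg (X t) (Y t)).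
Proof.
move=> mE mX mY XY.
have mac : measurable_fun E (fun t => acos (X t)).
  apply: (measurable_comp (F := `[-1, 1]%classic : set (RM R))) mX => //.
    by move=> _ [t Et <-]; rewrite /= in_itv/=; exact: circle_bounds (XY t Et).
  exact: measurable_acos.
apply: measurable_fun_if => //.
- exact: (measurable_fun_ler (measurable_cst _) mY).
- by apply: measurable_funS mac => //; exact: subIsetl.
- apply: measurable_funB; first exact: measurable_cst.
  by apply: measurable_funS mac => //; exact: subIsetl.
Qed.

End arg.

(* Radial limits are evaluated along this sequence, so that they are measurable. *)
Definition rad (R : realType) (n : nat) : R := 1 - n.+2%:R^-1.

Lemma measurable_circ (R : realType) : measurable (@circ R).
Proof. exact: measurable_itv. Qed.
#[local] Hint Resolve measurable_circ : core.

Section boundary_map.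
Variable R : realType.
Implicit Types (f : R[i] -> R[i]) (t : R).

Lemma rad_gt0 n : 0 < rad R n.
Proof. by rewrite subr_gt0 invf_lt1// ltr1n. Qed.

Lemma rad_lt1 n : rad R n < 1.
Proof. by rewrite ltrBlDr ltrDl invr_gt0. Qed.

Lemma cabs_rad n t : cabs ((rad R n)%:C * cis t) < 1.
Proof.
by rewrite cabsM cabs_cis cabs_real mulr1 gtr0_norm ?rad_gt0// rad_lt1.
Qed.

Lemma near_rad (e : R) : 0 < e -> \forall n \near \oo, 1 - rad R n < e.
Proof.
move=> e0; have := near_infty_natSinv_lt (PosNum e0); apply: filterS => n /= ne.
rewrite /rad opprB addrC subrK; apply: le_lt_trans ne.
by rewrite lef_pV2 ?posrE// ler_nat.
Qed.

Lemma cvg_rad : rad R n @[n --> \oo] --> (1 : R)^'-.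
Proof.
have h : rad R n @[n --> \oo] --> (1 : R); last first.
  by move=> A /h; rewrite /nbhs/=; apply: filterS => n; apply; exact: rad_lt1.
apply/cvgrPdist_lt => e e0.
have := near_rad e0; apply: filterS => n.
by rewrite ger0_norm// subr_ge0 ltW// rad_lt1.
Qed.

Lemma radial_cvg_rad f (z : R[i]) :
  cvg (radial f z r @[r --> (1 : R)^'-]) -> forall e, 0 < e ->
  \forall n \near \oo, cabs (f ((rad R n)%:C * z) - radial_ext f z) <= e.
Proof.
move=> h e e0; have ec0 : 0 < e%:C by rewrite ltcR.
have := cvg_comp _ _ cvg_rad h => /cvgrPdist_le /(_ _ ec0).
by apply: filterS => n; rewrite cabsE lecR cabsB.
Qed.

(** [E] is obtained by removing a measurable null set that covers the bad angles, which avoids any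
    question about the measurability of the set of convergence. Off [E] the map takes the angle 0,
    so [T] is total, measurable and can be iterated inside [circ]. *)
Lemma boundary_map f : inner_function f -> exists (T : RM R -> RM R) (E : set (RM R)),
  [/\ measurable E /\ measurable_fun setT T, forall t, circ (T t),
      E `<=` @circ R /\ lebesgue_measure (@circ R `\` E) = 0%E,
      forall t, E t -> radial_ext f (cis t) = cis (T t) &
      forall t, E t -> forall e, 0 < e -> \forall n \near \oo,
        cabs (f ((rad R n)%:C * cis t) - cis (T t)) <= e].
Proof.
move=> [hf f1 fN].
have {fN}[N [mN N0 fN]] : exists N : set (RM R), [/\ measurable N,
    lebesgue_measure N = 0%E &
    angles (~` [set z | cvg (radial f z r @[r --> (1 : R)^'-]) /\
      unit_circle (radial_ext f z)]) `<=` N].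
  by case: fN => N [mN N0 fN]; exists N.
pose E := @circ R `\` N.
have mE : measurable E.
  rewrite /E; apply: measurableD; [exact: measurable_circ | exact: mN].
pose L t := radial_ext f (cis t).
have EP t : E t -> cvg (radial f (cis t) r @[r --> (1 : R)^'-]) /\ cabs (L t) = 1.
  move=> [ct Nt]; apply: contrapT => h; apply: Nt; apply: fN; split => //.
  by rewrite /preimage/= => -[? /unit_circleE ?]; exact: h.
pose X (t : RM R) : RM R := Re (L t); pose Y (t : RM R) : RM R := Im (L t).
have XY t : E t -> X t ^+ 2 + Y t ^+ 2 = 1.
  by move=> /EP[_ L1]; rewrite -cabs_sqr L1 expr1n.
have cf n t : {for (rad R n)%:C * cis t, continuous (f : R[i]^o -> R[i]^o)}.
  apply: holomorphic_continuous; apply/holomorphic_atE; apply: hf.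
  by apply/unit_discE; exact: cabs_rad.
have mX : measurable_fun E X.
  apply: (@measurable_fun_cvg _ _ _ _ (fun n t => Re (f ((rad R n)%:C * cis t)))).
    move=> n; apply: measurable_funTS; apply: continuous_measurable_fun => t.
    exact: cis_ray_continuous (cf n t).
  move=> t /EP[h _]; apply/cvgrPdist_le => e e0.
  have := radial_cvg_rad h e0; apply: filterS => n hn.
  by rewrite distrC -ReN -ReD (le_trans (normr_Re_le _)).
have mY : measurable_fun E Y.
  apply: (@measurable_fun_cvg _ _ _ _ (fun n t => Im (f ((rad R n)%:C * cis t)))).
    move=> n; apply: measurable_funTS; apply: continuous_measurable_fun => t.
    have ImE (z : R[i]) : Im z = Re ((0 -i* 1) * z) by rewrite ReM/=; ring.
    under eq_fun do rewrite ImE.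
    apply: (@cis_ray_continuous R (fun z => (0 -i* 1) * f z)).
    exact: (ccontinuousM (holomorphic_continuous (holomorphic_cst _ _)) (cf n t)).
  move=> t /EP[h _]; apply/cvgrPdist_le => e e0.
  have := radial_cvg_rad h e0; apply: filterS => n hn.
  by rewrite distrC -ImN -ImD (le_trans (normr_Im_le _)).
pose T := (fun t => arg (X t) (Y t)) \_ E.
have TE t : E t -> radial_ext f (cis t) = cis (T t).
  by move=> Et; rewrite /T patchE mem_set// cis_arg ?XY// -complex_eta.
exists T, E; split => //.
- split; first exact: mE.
  exact: (measurable_restrictT _ mE).1 (measurable_arg mE mX mY XY).
- move=> t; rewrite /T patchE; case: ifPn => [|_]; first by rewrite inE => /XY; exact: arg_circ.
  by rewrite /circ/= in_itv/= lexx mulrn_wgt0// pi_gt0.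
- split; first by move=> t [].
  apply/eqP; rewrite -measure_le0 -N0; apply: le_measure; rewrite ?inE//.
    have mcE : measurable (@circ R `\` E).
      by apply: measurableD; [exact: measurable_circ | exact: mE].
    exact: mcE.
  by move=> t [ct]; rewrite /E/= not_andE => -[//|/contrapT].
- by move=> t Et e e0; have [h _] := EP t Et; rewrite -TE//; exact: radial_cvg_rad.
Qed.
End boundary_map.

(** * Poisson integrals of boundary maps *)

Section boundary_poisson.
Variable R : realType.
Implicit Types (f : R[i] -> R[i]) (t : R) (w z p : R[i]).

(** Up to conjugation both sides depend only on the product r * conj(cis s) * p, so the dilation can
    be moved from one point to the other. With p = f(z) this yields a Poisson kernel centred at r *
    f(z). *)
Lemma herglotz_poisson (r s : R) p : cabs (r%:C * p) < 1 ->
  1 + 2 * Re (herglotz (r%:C * cis s) p) = poisson (r%:C * p) s.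
Proof.
move=> rp; rewrite poisson_Re//; congr (_ + _ * _).
have -> : Re (herglotz (r%:C * cis s) p) = Re (herglotz (r%:C * cis s) p)^*.
  by case: (herglotz _ _).
have e' : conjc (r%:C * p) = r%:C * conjc p by case: p {rp} => a b; simpc.
have e : Num.conj (r%:C * p) = r%:C * Num.conj p by exact: e'.
rewrite herglotz_conj /herglotz e.
by congr (Re (_ / (1 - _))); exact: mulrAC.
Qed.

Lemma herglotz_le w p : cabs w < 1 -> cabs p <= 1 ->
  `|1 + 2 * Re (herglotz w p)| <= 1 + 2 * (cabs w / (1 - cabs w)).
Proof.
move=> w1 p1; have w0 := cabs_ge0 w; have p0 := cabs_ge0 p.
have wp : cabs w * cabs p <= cabs w by rewrite ler_piMr.
apply: (le_trans (ler_normD _ _)); rewrite normr1 lerD2l normrM ger0_norm//.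
rewrite ler_pM2l//; apply: (le_trans (normr_Re_le _)).
have d0 : 0 < 1 - cabs w by rewrite subr_gt0.
have wpC : cabs (w^* * p) <= cabs w.
  by rewrite cabsM {1}/cabs normcJ.
have dge : 1 - cabs w <= cabs (1 - w^* * p).
  have := le_cabsD (1 - w^* * p) (w^* * p); rewrite subrK (cabs_real 1) normr1; lra.
rewrite /herglotz cabsM cabsV; apply: ler_pM; rewrite ?cabs_ge0 ?invr_ge0 ?cabs_ge0//.
by rewrite lef_pV2// posrE (lt_le_trans d0).
Qed.

Lemma integral_circ_full (E : set (RM R)) (h : RM R -> \bar R) : measurable E ->
  E `<=` @circ R -> lebesgue_measure (@circ R `\` E) = 0%E ->
  lebesgue_measure.-integrable `[0, pi *+ 2] h ->
  (\int[lebesgue_measure]_(t in `[0%R, (pi *+ 2)%R]) h t =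
   \int[lebesgue_measure]_(t in E) h t)%E.
Proof.
move=> mE Ec E0 ih.
have ihc : lebesgue_measure.-integrable (@circ R) h.
  apply: integrableS ih; rewrite /circ; [exact: measurable_itv|exact: measurable_itv|].
  by apply: subset_itvl; rewrite bnd_simp.
rewrite -integral_itv_bndo_bndc; last exact: measurable_int ihc.
have mcE : measurable (@circ R `\` E).
  by apply: measurableD; [exact: measurable_circ | exact: mE].
rewrite (negligible_integral mcE _ ihc E0) ?setDD ?(setIidr Ec)//.
Qed.

(** The Poisson formula is applied to x |-> 1 + 2 herglotz w (f (rad n * x)), holomorphic past the
    circle. On [E] its real part tends to poisson w (T t), boundedly by [herglotz_le], and dominated
    convergence passes to the limit. This is transport of harmonic measure, tested on Poisson
    kernels only. *)
Lemma boundary_poisson f (T : RM R -> RM R) (E : set (RM R)) z w :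
  holomorphic_on_disc f -> (forall z, unit_disc z -> unit_disc (f z)) ->
  measurable E -> measurable_fun setT T ->
  E `<=` @circ R -> lebesgue_measure (@circ R `\` E) = 0%E ->
  (forall t, E t -> forall e, 0 < e -> \forall n \near \oo,
        cabs (f ((rad R n)%:C * cis t) - cis (T t)) <= e) ->
  cabs z < 1 -> cabs w < 1 ->
  (\int[lebesgue_measure]_(t in E) (poisson w (T t) * poisson z t)%R%:E =
    ((1 + 2 * Re (herglotz w (f z))) * (pi *+ 2))%R%:E)%E.
Proof.
move=> hf f1 mE mT Ec E0 fT z1 w1.
have {}hf x : cabs x < 1 -> holomorphic_at f x.
  by move=> /unit_discE/hf/holomorphic_atE.
have {}f1 x : cabs x < 1 -> cabs (f x) < 1.
  by move=> /unit_discE/f1/unit_discE.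
pose g (n : nat) x := 1 + 2%:R * herglotz w (f ((rad R n)%:C * x)).
have ReG n x : Re (g n x) = 1 + 2 * Re (herglotz w (f ((rad R n)%:C * x))).
  by rewrite /g mulr_natl !mulr2n !ReD/= mulrDl mul1r.
pose Q n := (rad R n)^-1.
have ltQ n x : cabs x < Q n -> cabs ((rad R n)%:C * x) < 1.
  by rewrite cabsM cabs_real gtr0_norm ?rad_gt0// -ltr_pdivlMl ?rad_gt0// mulr1.
have hg n x : cabs x < Q n -> holomorphic_at (g n) x.
  move=> /ltQ xQ; have wf : cabs w * cabs (f ((rad R n)%:C * x)) < 1.
    have := f1 _ xQ; have := cabs_ge0 (f ((rad R n)%:C * x)); have := cabs_ge0 w; nra.
  have hfs := holomorphic_scale (hf _ xQ).
  have hn := holomorphicM (holomorphic_cst w^* x) hfs.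
  have hd := holomorphicB (holomorphic_cst 1 x) hn.
  have hV := holomorphicV (f := fun x => 1 - w^* * f ((rad R n)%:C * x))
    (conj_mul_neq1 wf) hd.
  exact: (holomorphicD (holomorphic_cst 1 x)
    (holomorphicM (holomorphic_cst 2%:R x) (holomorphicM hn hV))).
have Q1 n : 1 < Q n by rewrite invf_gt1 ?rad_gt0 ?rad_lt1.
have cgc n t : {for t, continuous (fun t => Re (g n (cis t)))}.
  apply: cis_continuous_Re => s; apply: holomorphic_continuous; apply: hg.
  by rewrite cabs_cis.
have cp := poisson_continuous z1.
pose F n t := Re (g n (cis t)) * poisson z t.
have iF n : lebesgue_measure.-integrable `[0, pi *+ 2] (EFin \o F n).
  by apply: continuous_integrable_itv => t _; exact: (continuousM (cgc n t) (cp t)).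
have FE n : (\int[lebesgue_measure]_(t in E) (F n t)%:E =
    (Re (g n z) * (pi *+ 2))%R%:E)%E.
  rewrite -integral_circ_full//; last exact: iF.
  have cgn x : cabs x < Q n -> {for x, continuous (g n : R[i]^o -> R[i]^o)}.
    by move=> xQ; exact: holomorphic_continuous (hg n x xQ).
  rewrite -(poisson_formula (Q1 n) cgn (fun x xQ _ => hg n x xQ) z1).
  rewrite /Rintegral fineK//; exact: integrable_fin_num (iF n).
pose C := 1 + 2 * (cabs w / (1 - cabs w)).
have ip : lebesgue_measure.-integrable `[0, pi *+ 2] (EFin \o (fun t => C * poisson z t)).
  apply: continuous_integrable_itv => t _; apply: continuousM; [exact: cst_continuous|exact: cp].
have Eitv : E `<=` `[0, pi *+ 2]%classic.
  by apply: (subset_trans Ec); apply: subset_itvl; rewrite bnd_simp.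
have iE h : lebesgue_measure.-integrable `[0, pi *+ 2] h ->
    lebesgue_measure.-integrable E h.
  by move=> ih; apply: integrableS ih; [exact: measurable_itv|exact: mE|].
have wc t : cabs w * cabs (cis t) < 1 by rewrite cabs_cis mulr1.
have lim1 : (\int[lebesgue_measure]_(t in E) (F n t)%:E @[n --> \oo] -->
    \int[lebesgue_measure]_(t in E) (poisson w (T t) * poisson z t)%R%:E)%E.
  apply: (@dominated_cvg _ (RM R) R lebesgue_measure E mE
    (fun n t => (F n t)%:E) (fun t => (poisson w (T t) * poisson z t)%:E)
    (fun t => (C * poisson z t)%:E)).
  - move=> n; exact: measurable_int (iE _ (iF n)).
  - move=> t Et; apply: cvg_EFin; first exact: nearW.
    apply: cvgMl; rewrite poisson_Re//.
    apply/cvgrPdist_le => e e0.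
    have e20 : 0 < e / 2 by rewrite divr_gt0.
    have /continuous_cabsP/(_ _ e20)[d d0 dP] :=
      holomorphic_continuous (holomorphic_herglotz (wc (T t))).
    have d20 : 0 < d / 2 by rewrite divr_gt0.
    have := fT t Et _ d20; apply: filterS => n hn.
    rewrite ReG distrC.
    have := le_trans (normr_Re_le _) (dP (f ((rad R n)%:C * cis t)) _).
    rewrite ReD ReN => /(_ (le_lt_trans hn _)) h.
    rewrite (_ : _ - _ = 2 * (Re (herglotz w (f ((rad R n)%:C * cis t))) -
      Re (herglotz w (cis (T t))))); last by ring.
    rewrite normrM ger0_norm//; have : d / 2 < d by lra.
    by move/h; lra.
  - by [].
  - exact: iE _ ip.
  - move=> n t Et; rewrite abse_EFin lee_fin normrM (ger0_norm (poisson_ge0 t z1)).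
    apply: ler_wpM2r; first exact: poisson_ge0.
    by rewrite ReG; apply: herglotz_le => //; rewrite ltW// f1// cabs_rad.
have lim2 : (\int[lebesgue_measure]_(t in E) (F n t)%:E @[n --> \oo] -->
    ((1 + 2 * Re (herglotz w (f z))) * (pi *+ 2))%R%:E)%E.
  under eq_fun do rewrite FE.
  apply: cvg_EFin; first exact: nearW.
  apply: cvgMl; apply/cvgrPdist_le => e e0.
  have e20 : 0 < e / 2 by rewrite divr_gt0.
  have wf : cabs w * cabs (f z) < 1.
    have := f1 _ z1; have := cabs_ge0 (f z); have := cabs_ge0 w; nra.
  have hn := holomorphicM (holomorphic_cst w^* z) (hf z z1).
  have hd := holomorphicB (holomorphic_cst 1 z) hn.
  have hV := holomorphicV (f := fun x => 1 - w^* * f x) (conj_mul_neq1 wf) hd.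
  have /continuous_cabsP/(_ _ e20)[d d0 dP] :=
    holomorphic_continuous (holomorphicM hn hV).
  have := near_rad d0; apply: filterS => n hr.
  have zd : cabs ((rad R n)%:C * z - z) < d.
    rewrite -[X in _ - X]mul1r -mulrBl cabsM -(rmorphB (real_complex R)).
    rewrite cabs_real distrC ger0_norm ?subr_ge0 ?ltW ?rad_lt1//.
    by apply: le_lt_trans hr; rewrite ler_piMr// ?subr_ge0 ltW ?rad_lt1.
  have := le_trans (normr_Re_le _) (dP _ zd).
  rewrite ReD ReN ReG distrC => h.
  rewrite (_ : _ - _ = 2 * (Re (herglotz w (f z)) -
    Re (herglotz w (f ((rad R n)%:C * z))))); last by ring.
  by rewrite normrM ger0_norm//; move: h; rewrite /herglotz; lra.
exact: cvg_unique lim1 lim2.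
Qed.

End boundary_poisson.

(** * Concentration of the Poisson kernel *)

Section kernel.
Variable R : realType.
Implicit Types (r s t x : R).

Lemma cabs_cis_sub_sqr r s t :
  cabs (cis t - r%:C * cis s) ^+ 2 = 1 + r ^+ 2 - 2 * r * cos (s - t).
Proof.
rewrite cabs_sqr scale_cis !ReD !ImD !ReN !ImN /= cosB.
transitivity ((cos t ^+ 2 + sin t ^+ 2) + r ^+ 2 * (cos s ^+ 2 + sin s ^+ 2) -
  2 * r * (cos s * cos t + sin s * sin t)); first by ring.
by rewrite !cos2Dsin2 mulr1.
Qed.

Lemma poisson_scale_cis r s t :
  poisson (r%:C * cis s) t = (1 - r ^+ 2) / (1 + r ^+ 2 - 2 * r * cos (s - t)).
Proof.
rewrite /poisson cabs_cis_sub_sqr cabsM cabs_cis cabs_real mulr1.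
by rewrite -normrX ger0_norm ?sqr_ge0.
Qed.

Lemma sin_le x : 0 <= x -> `|sin x| <= x.
Proof.
move=> x0; have [|c cx] := @MVT_segment R sin cos 0 x x0.
  by apply: continuous_subspaceT => y; exact: continuous_sin.
rewrite sin0 !subr0 => ->; rewrite normrM (ger0_norm x0) ler_piMl//.
by rewrite ler_norml cos_geN1 cos_le1.
Qed.

Lemma cos_ge x : 1 - x ^+ 2 / 2 <= cos x.
Proof.
wlog x0 : x / 0 <= x.
  move=> h; have [x0|x0] := leP 0 x; first exact: h.
  by have := h (- x); rewrite cosN sqrrN; apply; rewrite oppr_ge0 ltW.
have -> : cos x = cos ((x / 2) *+ 2) by rewrite -mulr_natr divfK.
rewrite cos_mulr2n cos2sin2; have := @sin_le (x / 2).
have h0 : 0 <= x / 2 by rewrite divr_ge0.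
move/(_ h0); rewrite -ler_sqr ?nnegrE// -normrX ger0_norm ?sqr_ge0//.
move: (sin _) => y; rewrite expr_div_n -mulr_natr; lra.
Qed.

Lemma atan_le x : 0 <= x -> atan x <= x.
Proof.
move=> x0; have [|c cx] := @MVT_segment R atan (fun x => (1 + x ^+ 2)^-1) 0 x x0.
  by apply: continuous_subspaceT => y; exact: continuous_atan.
rewrite atan0 !subr0 => ->; rewrite ler_piMl//.
by rewrite invf_le1 ?lerDl ?sqr_ge0// ltr_wpDr ?sqr_ge0.
Qed.

Lemma atan_ge x : 0 < x -> pi / 2 - x^-1 <= atan x.
Proof.
move=> x0; pose u := atan x^-1; have xV0 : 0 < x^-1 by rewrite invr_gt0.
have u0 : 0 < u by rewrite -(@atan0 R) lt_atan.
have u1 : u < pi / 2 := atan_ltpi2 _.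
have tu : tan u = x^-1 := atanK _.
have su0 : sin u != 0.
  apply: contraTneq xV0 => su; by rewrite -tu /tan su mul0r ltxx.
have tE : tan (pi / 2 - u) = x.
  rewrite /tan sinB cosB cos_pihalf sin_pihalf !mul0r !mul1r add0r subr0.
  by rewrite -[x]invrK -tu /tan invf_div.
have -> : atan x = pi / 2 - u.
  by rewrite -tE tanK// in_itv/=; apply/andP; split; lra.
by rewrite lerD2l lerN2; apply: atan_le; rewrite ltW.
Qed.

(** By cos x >= 1 - x^2 / 2 the denominator of the kernel is at most (1 - r)^2 + r x^2. The Cauchy
    density that results has an arctangent as primitive. *)
Lemma poisson_ge_cauchy r s t : 0 < r < 1 ->
  (1 + r) * (1 - r) / ((1 - r) ^+ 2 + (s - t) ^+ 2) <= poisson (r%:C * cis s) t.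
Proof.
move=> /andP[r0 r1]; rewrite poisson_scale_cis.
have -> : 1 - r ^+ 2 = (1 + r) * (1 - r) by ring.
rewrite ler_pM2l; last by rewrite mulr_gt0//; lra.
have d0 : 0 < 1 + r ^+ 2 - 2 * r * cos (s - t).
  have : r * cos (s - t) <= r by rewrite ler_piMr ?cos_le1// ltW.
  have : 0 < (1 - r) ^+ 2 by rewrite exprn_gt0// subr_gt0.
  rewrite sqrrB; lra.
rewrite lef_pV2 ?posrE//.
  have := ler_wpM2l (ltW r0) (cos_ge (s - t)).
  have := sqr_ge0 (s - t); move: (s - t) => x; rewrite sqrrB => x2 h.
  have : r * x ^+ 2 <= x ^+ 2 by rewrite ler_piMl// ltW.
  lra.
by rewrite ltr_pwDl ?sqr_ge0// exprn_gt0// subr_gt0.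
Qed.

End kernel.

Section kernel_mass.
Variable R : realType.
Implicit Types (r s t x : R).

Lemma poisson_sym r s t : poisson (r%:C * cis s) t = poisson (r%:C * cis t) s.
Proof. by rewrite !poisson_scale_cis -cosN opprB. Qed.

Lemma cabs_scale_cis r s : 0 <= r -> cabs (r%:C * cis s) = r.
Proof. by move=> r0; rewrite cabsM cabs_cis cabs_real mulr1 ger0_norm. Qed.

Lemma poisson_continuous_center r t s : 0 < r < 1 ->
  {for s, continuous (fun s => poisson (r%:C * cis s) t)}.
Proof.
move=> /andP[r0 r1].
have -> : (fun s => poisson (r%:C * cis s) t) = poisson (r%:C * cis t).
  by apply/funext => u; rewrite poisson_sym.
by apply: poisson_continuous; rewrite cabs_scale_cis// ltW.
Qed.

(** With r = 1 - sg^2 the Cauchy density has width sg^2, much less than the window sg: its mass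
    there is 2 (1 + r) atan (1 / sg) >= 2 (2 - sg^2) (pi / 2 - sg). The integral runs over the
    centre [s] with [t] fixed, as needed after Tonelli. *)
Lemma kernel_mass (sg t : R) : 0 < sg < 1 / 2 ->
  (((1 - 2 * sg) * (pi *+ 2))%R%:E <=
   \int[lebesgue_measure]_(s in `[(t - sg)%R, (t + sg)%R])
     (poisson ((1 - sg ^+ 2)%:C * cis s) t)%:E)%E.
Proof.
move=> /andP[s0 s1]; pose e := sg ^+ 2; pose r := 1 - e.
have e0 : 0 < e by rewrite exprn_gt0.
have e1 : e < 1 by rewrite /e expr2; nra.
have r01 : 0 < r < 1 by rewrite /r; apply/andP; split; lra.
pose f (s : R) : R := (1 + r) * (1 - r) / ((1 - r) ^+ 2 + (s - t) ^+ 2).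
pose F (s : R) : R := (1 + r) * atan ((s - t) * e^-1).
have dF s : is_derive s 1 F (f s).
  have h1 : is_derive s 1 (fun s : R => (s - t) * e^-1) e^-1.
    have hb : is_derive s 1 (fun s : R => s - t) (1 - 0).
      exact: (is_deriveB (is_derive_id s 1) (is_derive_cst t s 1)).
    have := is_deriveM hb (is_derive_cst e^-1 s 1).
    by move/is_derive_eq; apply; rewrite scaler0 add0r subr0 [_ *: _]mulr1.
  have h2 := @is_derive1_atan R ((s - t) * e^-1).
  have h3 := is_derive1_comp (g := fun s : R => (s - t) * e^-1) h2 h1.
  have := is_deriveM (is_derive_cst (1 + r) s 1) h3.
  move/is_derive_eq; apply; rewrite scaler0 addr0 /f.
  transitivity ((1 + r) * ((1 + ((s - t) / e) ^+ 2)^-1 * e^-1)) => //.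
  have d0 : e ^+ 2 + (s - t) ^+ 2 != 0.
    by rewrite gt_eqF// ltr_pwDl ?sqr_ge0// exprn_gt0.
  have -> : 1 - r = e by rewrite /r; ring.
  have en0 : e != 0 by rewrite gt_eqF.
  by move: d0; move: (s - t) => x d0; field; rewrite d0 en0.
have cF s : {for s, continuous F}.
  have [df _] := dF s; exact/differentiable_continuous/derivable1_diffP.
have cf s : {for s, continuous f}.
  apply: continuousM; first exact: cst_continuous.
  apply: continuousV.
    by rewrite gt_eqF// ltr_pwDl ?sqr_ge0// exprn_gt0// /r; lra.
  apply: continuousD; first exact: cst_continuous.
  have cs : {for s, continuous (fun s : R => s - t)}.
    by apply: continuousB; [exact: cvg_id | exact: cst_continuous].
  exact: (continuousM cs cs).
have cP s : {for s, continuous (fun s => poisson (r%:C * cis s) t)}.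
  exact: poisson_continuous_center.
have lt1 : t - sg < t + sg by lra.
have intf : (\int[lebesgue_measure]_(s in `[(t - sg)%R, (t + sg)%R]) (f s)%:E =
    (F (t + sg))%:E - (F (t - sg))%:E)%E.
  apply: continuous_FTC2 => //.
  - apply: continuous_subspaceT => s; exact: cf.
  - split.
    + by move=> s _; have [] := dF s.
    + exact: cvg_at_right_filter (cF _).
    + exact: cvg_at_left_filter (cF _).
  - by move=> s _; rewrite derive1E; have [_ ->] := dF s.
apply: (@le_trans _ _ (\int[lebesgue_measure]_(s in `[(t - sg)%R, (t + sg)%R]) (f s)%:E)%E).
  rewrite intf -EFinB lee_fin /F.
  rewrite (_ : t + sg - t = sg); last by ring.
  rewrite (_ : t - sg - t = - sg); last by ring.
  rewrite mulNr atanN (_ : sg * e^-1 = sg^-1); last first.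
    by rewrite /e; field; rewrite gt_eqF.
  have := @atan_ge R sg^-1; rewrite invr_gt0 invrK => /(_ s0) h.
  have p2 : 2 <= pi :> R := pi_ge2 R.
  have h' : (2 - e) * (pi / 2 - sg) <= (2 - e) * atan sg^-1 by rewrite ler_pM2l//; lra.
  rewrite mulrN opprK (_ : 1 + r = 2 - e); last by rewrite /r; ring.
  have he : e <= sg / 2 by rewrite /e expr2 ler_pM2l//; lra.
  have h2 : e * pi <= sg / 2 * pi by rewrite ler_wpM2r// pi_ge0.
  have h3 : 2 * sg <= pi * sg by rewrite ler_pM2r.
  have h4 : 0 <= e * sg by rewrite mulr_ge0// ltW.
  rewrite mulr2n; lra.
apply: ge0_le_integral => //.
- move=> s _; rewrite lee_fin; apply: divr_ge0.
    by apply: mulr_ge0; rewrite /r; lra.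
  by apply: addr_ge0; exact: sqr_ge0.
- apply/measurable_EFinP; apply: measurable_funTS.
  by apply: continuous_measurable_fun => s; exact: cf.
- apply/measurable_EFinP; apply: measurable_funTS.
  by apply: continuous_measurable_fun => s; exact: cP.
- by move=> s _; rewrite lee_fin; exact: poisson_ge_cauchy.
Qed.

End kernel_mass.

(** * Averages of kernels over centres near an arc *)

Section smoothing.
Variable R : realType.
Implicit Types (r s t x : R).
Local Notation leb := (@lebesgue_measure R).

Lemma poisson_cis_eq (w : R[i]) s t : cis s = cis t -> poisson w s = poisson w t.
Proof. by rewrite /poisson => ->. Qed.

Lemma measurable_poisson (w : R[i]) : cabs w < 1 ->
  measurable_fun [set: RM R] (poisson w : RM R -> RM R).
Proof.
by move=> w1; apply: continuous_measurable_fun => t; exact: poisson_continuous.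
Qed.

(** The kernel sees the two angles only through their difference, so joint measurability follows
    from continuity in one variable. *)
Lemma measurable_poisson2 r (T : RM R -> RM R) : 0 < r < 1 ->
  measurable_fun setT T ->
  measurable_fun [set: RM R * RM R]
    ((fun p => poisson (r%:C * cis p.1) (T p.2)) : _ -> RM R).
Proof.
move=> r01 mT.
have -> : (fun p : RM R * RM R => poisson (r%:C * cis p.1) (T p.2)) =
    (fun x => poisson (r%:C * cis x) 0) \o (fun p : RM R * RM R => p.1 - T p.2).
  by apply/funext => p /=; rewrite !poisson_scale_cis subr0.
apply: (@measurableT_comp _ _ _ _ (RM R)).
  by apply: continuous_measurable_fun => s; exact: poisson_continuous_center.
apply: measurable_funB; first exact: measurable_fst.
by apply: measurableT_comp mT _; exact: measurable_snd.
Qed.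

(** Tonelli: for t in [S] the centres within [sg] of [t'] all lie in the domain of integration and
    already contribute the mass of [kernel_mass]. The lift [t'] of [T t] lets [a, b] run past 2 pi.
    [T] will be a boundary map in the transport theorem and the identity in the mixing estimate. *)
Lemma poisson_smoothing (psi : RM R -> RM R) (T : RM R -> RM R) (S : set (RM R))
    (a b sg : R) : 0 < sg < 1 / 2 ->
  measurable_fun setT psi -> (forall t, 0 <= psi t) -> measurable_fun setT T ->
  measurable S ->
  (forall t, S t -> exists2 t', cis t' = cis (T t) & a <= t' <= b) ->
  (((1 - 2 * sg) * (pi *+ 2))%R%:E * \int[leb]_(t in S) (psi t)%:E <=
   \int[leb]_(s in `[(a - sg)%R, (b + sg)%R])
     \int[leb]_t (psi t * poisson ((1 - sg ^+ 2)%:C * cis s) (T t))%:E)%E.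
Proof.
move=> sg12 mpsi psi0 mT mS ST.
have [s0 s1] : 0 < sg /\ sg < 1 / 2 by apply/andP.
set r := 1 - sg ^+ 2; set J := `[_, _]%classic; set c := _ * (pi *+ 2).
have c0 : 0 <= c by apply: mulr_ge0; [lra | rewrite mulrn_wge0// pi_ge0].
have r01 : 0 < r < 1.
  by have := exprn_gt0 2 s0; rewrite /r expr2 => ?; apply/andP; split; nra.
have r1 s : cabs (r%:C * cis s) < 1.
  by have /andP[? ?] := r01; rewrite cabs_scale_cis// ltW.
pose K (p : RM R * RM R) : RM R := psi p.2 * poisson (r%:C * cis p.1) (T p.2).
have K0 p : 0 <= K p by rewrite mulr_ge0// poisson_ge0.
have mK : measurable_fun setT K.
  apply: measurable_funM; last exact: measurable_poisson2.
  by apply: measurableT_comp mpsi _; exact: measurable_snd.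
have mJ : measurable J by exact: measurable_itv.
pose h (p : RM R * RM R) : \bar R := ((K p)%:E * (\1_J p.1)%:E)%E.
have mh : measurable_fun setT h.
  apply: emeasurable_funM; apply/measurable_EFinP => //.
  apply: measurableT_comp; last exact: measurable_fst.
  exact: measurable_indic.
have h0 p : (0 <= h p)%E by rewrite mule_ge0// lee_fin.
have -> : (\int[leb]_(s in J) \int[leb]_t (K (s, t))%:E =
    \int[leb]_s \int[leb]_t h (s, t))%E.
  rewrite integral_mkcond; apply: eq_integral => s _; rewrite patchE /h /=.
  case: ifPn => sJ; rewrite indicE ?sJ; last first.
    by rewrite (negbTE sJ); under eq_integral do rewrite mule0; rewrite integral0.
  by under [RHS]eq_integral do rewrite mule1.
rewrite fubini_tonelli//.
rewrite -ge0_integralZl//; last 2 first.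
- by apply/measurable_EFinP; exact: measurable_funTS.
- by move=> t _; rewrite lee_fin.
rewrite integral_mkcond; apply: ge0_le_integral => //.
- by move=> t _; rewrite patchE; case: ifP => // _; rewrite mule_ge0// lee_fin.
- apply/(measurable_restrictT _ mS); apply: emeasurable_funM; first exact: measurable_cst.
  by apply/measurable_EFinP; exact: measurable_funTS.
- exact: measurable_fun_fubini_tonelli_G.
move=> t _; rewrite patchE; case: ifPn => tS; last exact: integral_ge0.
have [t' tt' abt'] := ST t (set_mem tS).
have -> : (\int[leb]_s h (s, t) = \int[leb]_(s in J) (K (s, t))%:E)%E.
  rewrite [RHS]integral_mkcond; apply: eq_integral => s _; rewrite patchE /h /=.
  by case: ifPn => sJ; rewrite indicE ?sJ ?mule1// (negbTE sJ) mule0.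
have mKt : measurable_fun [set: RM R] (fun s => poisson (r%:C * cis s) (T t) : RM R).
  by apply: continuous_measurable_fun => s; exact: poisson_continuous_center.
apply: (@le_trans _ _ ((psi t)%:E *
    \int[leb]_(s in J) (poisson (r%:C * cis s) (T t))%:E)%E); last first.
  rewrite -ge0_integralZl//.
  - by apply/measurable_EFinP; exact: measurable_funTS.
  - by move=> s _; rewrite lee_fin poisson_ge0.
  - by rewrite lee_fin.
rewrite muleC; apply: lee_wpmul2l; first by rewrite lee_fin.
apply: (le_trans (kernel_mass t' sg12)).
under eq_integral do rewrite (poisson_cis_eq _ tt').
apply: ge0_subset_integral => //.
- by apply/measurable_EFinP; exact: measurable_funTS.
- by move=> s _; rewrite lee_fin poisson_ge0.
- by apply: subset_itv; rewrite bnd_simp; lra.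
Qed.

End smoothing.

(** * Transport of harmonic measure *)

(* [2 * pi] times the harmonic measure seen from [w]. *)
Definition harm (R : realType) (w : R[i]) (w1 : cabs w < 1) (A : set (RM R)) : \bar R :=
  (\int[lebesgue_measure]_(t in @circ R `&` A) (poisson w t)%:E)%E.

Section harm_measure.
Variables (R : realType) (w : R[i]) (w1 : cabs w < 1).
Local Notation leb := (@lebesgue_measure R).

Lemma harmE A : harm w1 A =
  (\int[leb]_(t in A) ((fun t => (poisson w t)%:E) \_ (@circ R)) t)%E.
Proof. by rewrite /harm setIC integral_mkcondr. Qed.

Lemma measurable_poisson_circ :
  measurable_fun setT ((fun t => (poisson w t)%:E) \_ (@circ R)).
Proof.
apply: (measurable_restrictT _ (@measurable_circ R)).1; apply: measurable_funTS.
by apply/measurable_EFinP; exact: measurable_poisson.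
Qed.

Lemma poisson_circ_ge0 t : (0 <= ((fun t => (poisson w t)%:E) \_ (@circ R)) t)%E.
Proof. by rewrite patchE; case: ifP => // _; rewrite lee_fin poisson_ge0. Qed.

Let harm0 : harm w1 set0 = 0%E.
Proof. by rewrite harmE integral_set0. Qed.

Let harm_ge0 A : (0 <= harm w1 A)%E.
Proof. by rewrite harmE; apply: integral_ge0 => t _; exact: poisson_circ_ge0. Qed.

Let harm_sigma_additive : semi_sigma_additive (harm w1).
Proof.
have -> : harm w1 = (fun A => \int[leb]_(t in A)
    ((fun t => (poisson w t)%:E) \_ (@circ R)) t)%E.
  by apply/funext => A; exact: harmE.
apply: semi_sigma_additive_nng_induced; first exact: measurable_poisson_circ.
exact: poisson_circ_ge0.
Qed.

HB.instance Definition _ :=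
  isMeasure.Build _ _ _ (harm w1) harm0 harm_ge0 harm_sigma_additive.

Lemma integrable_poisson (a b : R) :
  leb.-integrable `[a, b] (EFin \o poisson w).
Proof.
by apply: continuous_integrable_itv => t _; exact: (poisson_continuous w1).
Qed.

Lemma integral_poisson_itv (a b : R) :
  (\int[leb]_(t in `[a, b]) (poisson w t)%:E =
   (\int[leb]_(t in `[a, b]) poisson w t)%R%:E)%E.
Proof.
by rewrite /Rintegral fineK//; exact: (integrable_fin_num _ (integrable_poisson a b)).
Qed.

Lemma harm_itv (a b : R) : 0 <= a -> b <= pi *+ 2 ->
  harm w1 `[a, b]%classic = (\int[leb]_(t in `[a, b]) poisson w t)%R%:E.
Proof.
move=> a0 b2; rewrite -integral_poisson_itv /harm.
have -> : @circ R `&` `[a, b] = `[a, b] `\ (pi *+ 2).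
  apply/seteqP; split => t /=; rewrite /circ/= !in_itv/=.
    by move=> [/andP[? ?] ?]; split => // e; lra.
  move=> [tab tp]; split => //; apply/andP; split; first lra.
  by rewrite lt_neqAle; apply/andP; split; [exact/eqP|lra].
have mp : measurable_fun [set: RM R] (EFin \o (poisson w : RM R -> RM R)).
  by apply/measurable_EFinP; exact: measurable_poisson.
apply: integral_setD1; last exact: measurable_funTS.
by apply: measurableD; [exact: measurable_itv | exact: measurable_set1].
Qed.

Lemma harm_setT : harm w1 setT = (pi *+ 2)%:E.
Proof.
rewrite -(mean_poisson w1) -integral_poisson_itv /harm setIT.
apply: integral_itv_bndo_bndc; apply: measurable_funTS.
by apply/measurable_EFinP; exact: measurable_poisson.
Qed.

Lemma harm_circ A : harm w1 A = harm w1 (@circ R `&` A).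
Proof. by rewrite /harm setIA setIid. Qed.

Lemma harm_lebesgue A : measurable A ->
  (harm w1 A <= ((1 + cabs w) / (1 - cabs w))%R%:E * leb (@circ R `&` A))%E.
Proof.
move=> mA; have mcA : measurable (@circ R `&` A).
  by apply: measurableI => //; exact: measurable_circ.
rewrite /harm -integral_cst//; apply: ge0_le_integral => //.
- by move=> t _; rewrite lee_fin poisson_ge0.
- by apply: measurable_funTS; apply/measurable_EFinP; exact: measurable_poisson.
- by move=> t _; rewrite lee_fin poisson_le.
Qed.

End harm_measure.

(** * Effect of a dilation on the Poisson kernel *)

Section poisson_variation.
Variable R : realType.
Implicit Types (p : R[i]) (r s t sg : R).
Local Notation leb := (@lebesgue_measure R).

(** Both kernels are 1 + 2 Re (x / (1 - x)), taken at x and at r x with |x| = |p|; the two quotients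
    differ by (r - 1) x / ((1 - r x) (1 - x)). *)
Lemma poisson_dilate r p s : 0 <= r <= 1 -> cabs p < 1 ->
  poisson (r%:C * p) s <= poisson p s + 2 / (1 - cabs p) ^+ 2 * (1 - r).
Proof.
move=> /andP[r0 r1] p1; have p0 := cabs_ge0 p.
have rp : cabs (r%:C * p) <= cabs p by rewrite cabsM cabs_real ger0_norm// ler_piMl.
have rp1 : cabs (r%:C * p) < 1 := le_lt_trans rp p1.
rewrite !poisson_Re//.
set x := conjc p * cis s; have xp : cabs x = cabs p.
  by rewrite /x cabsM cabs_cis mulr1 /cabs normcJ.
have e1 : herglotz p (cis s) = x / (1 - x) by [].
have e2 : herglotz (r%:C * p) (cis s) = r%:C * x / (1 - r%:C * x).
  rewrite /herglotz (_ : Num.conj (r%:C * p) = r%:C * conjc p) ?mulrA//.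
  by rewrite /x; case: p {p1 p0 rp rp1 x xp e1} => a b; apply/eqP; rewrite eq_complex /=; simpc.
have rx : cabs (r%:C * x) <= cabs p by rewrite cabsM cabs_real ger0_norm// xp ler_piMl.
have d1 : 1 - cabs p <= cabs (1 - x).
  have := le_cabsD (1 - x) x; rewrite subrK (cabs_real 1) normr1 xp; lra.
have d2 : 1 - cabs p <= cabs (1 - r%:C * x).
  have := le_cabsD (1 - r%:C * x) (r%:C * x); rewrite subrK (cabs_real 1) normr1; lra.
have q0 : 0 < 1 - cabs p by rewrite subr_gt0.
have n1 : 1 - x != 0 by rewrite -cabs_gt0; lra.
have n2 : 1 - r%:C * x != 0 by rewrite -cabs_gt0; lra.
clearbody x.
have h : cabs (herglotz (r%:C * p) (cis s) - herglotz p (cis s)) <=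
    (1 - r) / (1 - cabs p) ^+ 2.
  have -> : herglotz (r%:C * p) (cis s) - herglotz p (cis s) =
      (r%:C - 1) * x / ((1 - r%:C * x) * (1 - x)).
    by rewrite e1 e2; move: (r%:C) n2 => c n2; field; rewrite n1 n2.
  rewrite -(rmorphB (real_complex R)) !cabsM cabsV cabsM cabs_real xp distrC.
  rewrite ger0_norm ?subr_ge0//; apply: ler_pM.
  - by rewrite mulr_ge0// subr_ge0.
  - by rewrite invr_ge0 mulr_ge0// cabs_ge0.
  - by rewrite ler_piMr ?subr_ge0// ltW.
  - rewrite lef_pV2 ?posrE ?exprn_gt0//; last by rewrite mulr_gt0//; lra.
    by rewrite expr2; apply: ler_pM => //; rewrite ltW.
have := le_trans (ler_norm _) (le_trans (normr_Re_le _) h); rewrite ReD ReN.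
by rewrite -mulrA (mulrC _ (1 - r)); lra.
Qed.

Lemma integrable_poisson_dilate (a b r : R) p : 0 <= r <= 1 -> cabs p < 1 ->
  leb.-integrable `[a, b] (EFin \o poisson (r%:C * p)).
Proof.
move=> /andP[r0 r1] p1; apply: integrable_poisson; rewrite cabsM cabs_real.
by rewrite ger0_norm//; apply: le_lt_trans p1; rewrite ler_piMl ?cabs_ge0.
Qed.

Lemma Rintegral_itv_le (f : R -> R) (a b M : R) : a <= b ->
  leb.-integrable `[a, b] (EFin \o f) -> (forall x, f x <= M) ->
  \int[leb]_(x in `[a, b]) f x <= M * (b - a).
Proof.
move=> ab intf fM; rewrite -(Rintegral_itv_cst _ ab); apply: le_Rintegral => //.
by apply: continuous_integrable_itv => x _; exact: cst_continuous.
Qed.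

(** The end pieces of length [sg] cost at most 2 C sg and the dilation D sg^2 per unit length. As
    [K] is independent of [sg], the smoothing can be removed by sg -> 0. *)
Lemma mean_poisson_dilate (a b : R) p : a <= b -> cabs p < 1 ->
  exists2 K, 0 <= K & forall sg, 0 < sg < 1 / 2 ->
  \int[leb]_(s in `[a - sg, b + sg]) poisson ((1 - sg ^+ 2)%:C * p) s <=
  \int[leb]_(s in `[a, b]) poisson p s + sg * K.
Proof.
move=> ab p1; have p0 := cabs_ge0 p; have q0 : 0 < 1 - cabs p by rewrite subr_gt0.
pose C := (1 + cabs p) / (1 - cabs p); pose D := 2 / (1 - cabs p) ^+ 2.
have C0 : 0 <= C by apply: divr_ge0; lra.
have D0 : 0 <= D by rewrite divr_ge0// sqr_ge0.
have abD : 0 <= D * (b - a) by rewrite mulr_ge0// subr_ge0.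
exists (2 * C + D * (b - a)) => [|sg /andP[s0 s1]]; first lra.
set r := 1 - sg ^+ 2.
have rE : 1 - r = sg * sg by rewrite /r; ring.
have ss : sg * sg <= sg by rewrite ler_piMr; lra.
have ss0 : 0 < sg * sg by rewrite mulr_gt0.
have r01 : 0 <= r <= 1 by apply/andP; split; lra.
have intp (x y : R) := integrable_poisson_dilate x y r01 p1.
have pC s : poisson (r%:C * p) s <= C.
  have rp : cabs (r%:C * p) <= cabs p.
    by rewrite cabsM cabs_real ger0_norm ?ler_piMl//; lra.
  apply: (le_trans (poisson_le s (le_lt_trans rp p1))).
  apply: ler_pM; rewrite ?addr_ge0 ?invr_ge0 ?subr_ge0 ?cabs_ge0 ?lerD2l//.
    by apply: ltW; exact: le_lt_trans rp p1.
  by rewrite lef_pV2 ?posrE ?subr_gt0 ?(le_lt_trans rp p1)// lerB.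
have l1 : a - sg <= a by lra.
have l2 : a <= b + sg by lra.
have l3 : b <= b + sg by lra.
rewrite (Rintegral_itv_split l1 l2 (intp _ _)) (Rintegral_itv_split ab l3 (intp _ _)).
have h1 : \int[leb]_(x in `[(a - sg), a]) poisson (r%:C * p) x <= C * (a - (a - sg)).
  by apply: Rintegral_itv_le => //; lra.
have h2 : \int[leb]_(x in `[b, (b + sg)]) poisson (r%:C * p) x <= C * (b + sg - b).
  by apply: Rintegral_itv_le => //; lra.
have h3 : \int[leb]_(x in `[a, b]) poisson (r%:C * p) x <=
    \int[leb]_(x in `[a, b]) poisson p x + D * (1 - r) * (b - a).
  rewrite -[X in _ + X](Rintegral_itv_cst _ ab).
  have ic : leb.-integrable `[a, b] (EFin \o (fun=> D * (1 - r))).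
    by apply: continuous_integrable_itv => x _; exact: cst_continuous.
  have ip := integrable_poisson p1 a b.
  have isum : leb.-integrable `[a, b] (EFin \o (fun s => poisson p s + D * (1 - r))).
    apply: continuous_integrable_itv => s _; apply: continuousD.
      exact: (poisson_continuous p1).
    exact: cst_continuous.
  rewrite -RintegralD//; apply: le_Rintegral => //.
  by move=> s _; exact: poisson_dilate.
have h4 : D * (1 - r) * (b - a) <= sg * (D * (b - a)).
  by rewrite rE mulrAC mulrC ler_wpM2r.
rewrite mulrDr; lra.
Qed.

End poisson_variation.

Section transport.
Variable R : realType.
Local Notation leb := (@lebesgue_measure R).
Variables (f : R[i] -> R[i]) (T : RM R -> RM R) (E : set (RM R)).
Hypothesis hf : holomorphic_on_disc f.
Hypothesis f1 : forall z, unit_disc z -> unit_disc (f z).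
Hypotheses (mE : measurable E) (mT : measurable_fun setT T).
Hypothesis Tc : forall t, circ (T t).
Hypotheses (Ec : E `<=` @circ R) (E0 : leb (@circ R `\` E) = 0%E).
Hypothesis fT : forall t, E t -> forall e, 0 < e -> \forall n \near \oo,
  cabs (f ((rad R n)%:C * cis t) - cis (T t)) <= e.
Variables (z : R[i]) (z1 : cabs z < 1) (fz1 : cabs (f z) < 1).

Lemma measurable_preimage (B : set (RM R)) : measurable B -> measurable (T @^-1` B).
Proof. by move=> mB; rewrite -[X in measurable X]setTI; exact: mT. Qed.

Lemma harm_le_setT (A : set (RM R)) : measurable A ->
  (harm z1 A <= (pi *+ 2)%:E)%E.
Proof. by move=> mA; rewrite -(harm_setT z1); apply: le_measure; rewrite ?inE. Qed.

Lemma harm_fin_num (A : set (RM R)) : measurable A -> harm z1 A \is a fin_num.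
Proof.
move=> mA; rewrite ge0_fin_numE ?measure_ge0//.
exact: le_lt_trans (harm_le_setT mA) (ltry _).
Qed.

(** The average of kernels that dominates the left side is evaluated by [boundary_poisson]: for each
    centre it is 2 pi times a kernel centred at r * f(z). Letting sg -> 0 leaves the harmonic
    measure seen from f(z). *)
Lemma transport_le (a b : R) : 0 <= a -> a <= b -> b <= pi *+ 2 ->
  (harm z1 (E `&` T @^-1` `[a, b]%classic) <= harm fz1 `[a, b]%classic)%E.
Proof.
move=> a0 ab b2; set S := E `&` _.
have mS : measurable S.
  by apply: measurableI => //; apply: measurable_preimage; exact: measurable_itv.
pose psi (t : RM R) : RM R := poisson z t * \1_E t.
have mpsi : measurable_fun setT psi.
  apply: measurable_funM; first exact: measurable_poisson.
  exact: measurable_indic.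
have psi0 t : 0 <= psi t by rewrite mulr_ge0// poisson_ge0.
rewrite harm_itv//.
have p20 : 0 < pi *+ 2 :> R by rewrite mulrn_wgt0// pi_gt0.
have hS : (harm z1 S = \int[leb]_(t in S) (psi t)%:E)%E.
  rewrite /harm (setIidr (subset_trans _ Ec)); last exact: subIsetl.
  apply: eq_integral => t; rewrite inE => -[Et _].
  by rewrite /psi indicE mem_set// mulr1.
have inner r s : 0 < r < 1 ->
    (\int[leb]_t (psi t * poisson (r%:C * cis s) (T t))%R%:E =
     (poisson (r%:C * f z) s * (pi *+ 2))%R%:E)%E.
  move=> /andP[r0 r1].
  have w1 : cabs (r%:C * cis s) < 1 by rewrite cabs_scale_cis// ltW.
  have rf1 : cabs (r%:C * f z) < 1.
    rewrite cabsM cabs_real gtr0_norm//; apply: le_lt_trans fz1.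
    by rewrite ler_piMl ?cabs_ge0// ltW.
  rewrite -(herglotz_poisson s rf1).
  rewrite -(boundary_poisson hf f1 mE mT Ec E0 fT z1 w1) [RHS]integral_mkcond.
  apply: eq_integral => t _; rewrite patchE /psi indicE.
  by case: ifP => tE; rewrite ?mulr1 ?mulr0 ?mul0r// mulrC.
have [K K0 hK] := mean_poisson_dilate ab fz1.
rewrite -(fineK (harm_fin_num mS)) lee_fin.
set m := fine _; set I := Rintegral _ _ _ in hK *.
have m0 : 0 <= m by rewrite fine_ge0 ?measure_ge0.
have key sg : 0 < sg < 1 / 2 -> (1 - 2 * sg) * m <= I + sg * K.
  move=> sg12; have r01 : 0 < 1 - sg ^+ 2 < 1.
    have /andP[s0 s1] := sg12; rewrite expr2.
    have : sg * sg < 1 * 1 by apply: ltr_pM; lra.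
    have : 0 < sg * sg by rewrite mulr_gt0.
    by move=> ? ?; apply/andP; split; lra.
  have ST t : S t -> exists2 t', cis t' = cis (T t) & a <= t' <= b.
    by move=> [_]; rewrite /= in_itv/= => ?; exists (T t).
  have := poisson_smoothing sg12 mpsi psi0 mT mS ST.
  under [X in (_ <= X)%E]eq_integral do rewrite inner//.
  rewrite -hS -(fineK (harm_fin_num mS)) -/m -EFinM => h.
  apply: le_trans (hK sg sg12).
  rewrite -(ler_pM2r p20) -lee_fin mulrAC; apply: (le_trans h).
  have r01' : 0 <= 1 - sg ^+ 2 <= 1 by have /andP[? ?] := r01; rewrite !ltW.
  have ii := integrable_poisson_dilate (a - sg) (b + sg) r01' fz1.
  under eq_integral do rewrite EFinM.
  rewrite integralZr//= /Rintegral EFinM fineK//.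
  exact: integrable_fin_num ii.
apply/ler_addgt0Pl => e e0.
have M0 : 0 < K + 2 * m + 1 by lra.
pose sg := Num.min (1 / 4) (e / (K + 2 * m + 1)).
have sg0 : 0 < sg by rewrite lt_min; apply/andP; split; [lra|exact: divr_gt0].
have sg4 : sg <= 1 / 4 by rewrite ge_min lexx.
have sge : sg * (K + 2 * m + 1) <= e by rewrite -ler_pdivlMr// ge_min lexx orbT.
have := key sg; have -> : 0 < sg < 1 / 2 by apply/andP; split; lra.
move=> /(_ isT); rewrite mulrBl mul1r; rewrite !mulrDr mulr1 in sge.
have -> : 2 * sg * m = sg * (2 * m) by ring.
lra.
Qed.

Lemma harm_setI_full (A : set (RM R)) : measurable A -> harm z1 (E `&` A) = harm z1 A.
Proof.
move=> mA; rewrite /harm; apply/esym.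
have mcE : measurable (@circ R `\` E).
  by apply: measurableD; [exact: measurable_circ | exact: mE].
have -> : @circ R `&` (E `&` A) = (@circ R `&` A) `\` (@circ R `\` E).
  apply/seteqP; split => t.
    by move=> [ct [Et At]]; split => // -[].
  by move=> [[ct At] nE]; split => //; split => //; apply: contrapT => nEt; apply: nE.
apply: ge0_negligible_integral E0 => //.
- by apply: measurableI => //; exact: measurable_circ.
- by apply: measurable_funTS; apply/measurable_EFinP; exact: measurable_poisson.
- by move=> t _; rewrite lee_fin poisson_ge0.
Qed.

Lemma harm_ray (w : R[i]) (w1 : cabs w < 1) (x : R) : 0 <= x ->
  harm w1 `[x, +oo[%classic = harm w1 `[x, (pi *+ 2)%R]%classic.
Proof.
move=> x0; rewrite harm_circ [RHS]harm_circ; congr harm.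
apply/seteqP; split => t; rewrite /circ/= !in_itv/= ?andbT.
  by move=> [/andP[t0 t2] xt]; split; apply/andP; split => //; exact: ltW.
by move=> [ct /andP[xt _]].
Qed.

Lemma harm_itv_sum (w : R[i]) (w1 : cabs w < 1) (x : R) : 0 <= x <= pi *+ 2 ->
  (harm w1 `[0%R, x]%classic + harm w1 `[x, (pi *+ 2)%R]%classic = (pi *+ 2)%:E)%E.
Proof.
move=> /andP[x0 x2]; rewrite !harm_itv// -EFinD; congr EFin.
by rewrite -(Rintegral_itv_split x0 x2 (integrable_poisson w1 _ _)) mean_poisson.
Qed.

Let push (A : set (RM R)) : \bar R := harm z1 (T @^-1` A).

Let push0 : push set0 = 0%E.
Proof. by rewrite /push preimage_set0 measure0. Qed.

Let push_ge0 A : (0 <= push A)%E.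
Proof. exact: measure_ge0. Qed.

Let push_sigma_additive : semi_sigma_additive push.
Proof.
move=> F mF tF mUF; rewrite /push preimage_bigcup.
apply: measure_semi_sigma_additive.
- by move=> n; exact: measurable_preimage.
- apply/trivIsetP => /= i j _ _ ij; rewrite -preimage_setI.
  by move/trivIsetP : tF => /(_ _ _ _ _ ij) ->//; rewrite preimage_set0.
- by rewrite -preimage_bigcup; exact: measurable_preimage.
Qed.

HB.instance Definition _ :=
  isMeasure.Build _ _ _ push push0 push_ge0 push_sigma_additive.

Let push_le (a b : R) : 0 <= a -> a <= b -> b <= pi *+ 2 ->
  (push `[a, b]%classic <= harm fz1 `[a, b]%classic)%E.
Proof.
move=> a0 ab b2; rewrite /push -harm_setI_full; first exact: transport_le.
by apply: measurable_preimage; exact: measurable_itv.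
Qed.

(* Both measures have the same mass, and [push_le] bounds [push] on both sides
   of [x]. *)
Let push_ray (x : R) : push `[x, +oo[%classic = harm fz1 `[x, +oo[%classic.
Proof.
have pushT : push setT = (pi *+ 2)%:E by rewrite /push preimage_setT harm_setT.
have [x0|x0] := ltP x 0.
  rewrite -[RHS](_ : (pi *+ 2)%:E = _); last first.
    rewrite -(harm_setT fz1) harm_circ [RHS]harm_circ setIT; congr harm.
    rewrite setIidl// => t; rewrite /circ/= !in_itv/= andbT => /andP[t0 _].
    by apply: le_trans t0; exact: ltW.
  rewrite -pushT; congr (harm z1 _); apply/seteqP; split => // t _ /=.
  have := Tc t; rewrite /circ/= !in_itv/= andbT => /andP[t0 _].
  by apply: le_trans t0; exact: ltW.
have [x2|x2] := leP x (pi *+ 2); last first.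
  have -> : push `[x, +oo[%classic = 0%E.
    rewrite -push0; congr (harm z1 _); apply/seteqP; split => // t /=.
    have := Tc t; rewrite /circ/= !in_itv/= andbT => /andP[_ t2] xt.
    by have := lt_trans t2 x2; rewrite ltNge xt.
  rewrite harm_circ (_ : _ `&` _ = set0) ?measure0//.
  apply/seteqP; split => // t; rewrite /circ/= !in_itv/= andbT => -[/andP[_ t2] xt].
  by have := lt_trans t2 x2; rewrite ltNge xt.
have pE : push `[x, +oo[%classic = push `[x, (pi *+ 2)%R]%classic.
  congr (harm z1 _); apply/seteqP; split => t; rewrite /= !in_itv/= ?andbT.
    by move=> ->; have := Tc t; rewrite /circ/= !in_itv/= => /andP[_ /ltW].
  by move=> /andP[].
have hE := harm_ray fz1 x0.
have x02 : 0 <= x <= pi *+ 2 by rewrite x0.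
apply/eqP; rewrite eq_le pE hE push_le//=.
have le0 : (push `[0%R, x]%classic <= harm fz1 `[0%R, x]%classic)%E by exact: push_le.
have cover : ((pi *+ 2)%:E <= push `[0%R, x]%classic + push `[x, (pi *+ 2)%R]%classic)%E.
  have <- : push (`[0%R, x]%classic `|` `[x, (pi *+ 2)%R]%classic) = (pi *+ 2)%:E.
    rewrite -pushT; congr (harm z1 _); apply/seteqP; split => // t _.
    have := Tc t; rewrite /circ/= !in_itv/= => /andP[t0 /ltW t2].
    by have [xt|tx] := leP x (T t); [right; rewrite t2|left; rewrite t0 ltW].
  by apply: measureU2; exact: measurable_itv.
move: cover; rewrite -(harm_itv_sum fz1 x02) => cover.
have fin0 : harm fz1 `[0%R, x]%classic \is a fin_num.
  by rewrite harm_itv.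
rewrite -(@leeD2lE _ (harm fz1 `[0%R, x]%classic))//; apply: (le_trans cover).
by apply: leeD2r.
Qed.

(** The rays [x, +oo[ are stable under intersection and generate the Borel sets; two finite measures
    that agree on them are equal. *)
Lemma harm_transport (B : set (RM R)) : measurable B -> harm z1 (T @^-1` B) = harm fz1 B.
Proof.
move=> mB; rewrite -[LHS]/(push B).
have := @measure_unique _ R (RM R) (@RGenCInfty.G R) (fun n : nat => `[(- n%:R)%R, +oo[%classic)
  _ _ _ _ push (harm fz1) _ _ B mB; apply.
- exact: RGenCInfty.measurableE.
- move=> _ _ [x ->] [y ->]; exists (Num.max x y).
  by apply/seteqP; split => t /=; rewrite !in_itv/= !andbT ge_max => /andP.
- by move=> n; eexists.
- apply/seteqP; split => // t _; have [n nt] := filter_ex (nbhs_infty_gtr (- t)).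
  by exists n => //=; rewrite in_itv/= andbT lerNl ltW.
- by move=> _ [x ->]; exact: push_ray.
- move=> k; apply: le_lt_trans (harm_le_setT _) (ltry _).
  by apply: measurable_preimage; exact: measurable_itv.
Qed.

End transport.

(** * The Borel-Cantelli lemma *)

Section geometric_bounds.
Variable R : realType.

Lemma geometric_sum_le (q : R) n : 0 <= q < 1 ->
  \sum_(0 <= k < n) q ^+ k <= (1 - q)^-1.
Proof.
move=> /andP[q0 q1]; have d0 : 0 < 1 - q by rewrite subr_gt0.
rewrite -(ler_pM2l d0) mulfV ?gt_eqF// big_mkord.
rewrite -[_ * _]opprK -mulNr opprB -subrX1 opprB gerBl exprn_ge0//.
Qed.

(** Truncated subtraction makes (i - j) + (j - i) the distance |i - j|. Cutting at j = i leaves two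
    geometric sums. *)
Lemma geometric_dist_sum_le (q : R) i n : 0 <= q < 1 -> (i < n)%N ->
  \sum_(0 <= j < n) q ^+ ((i - j) + (j - i)) <= 2 / (1 - q).
Proof.
move=> q01 iln; have /andP[q0 q1] := q01.
rewrite (big_cat_nat (n := i)) ?(ltnW iln)//= -[2]/(1 + 1) mulrDl mul1r.
apply: lerD.
  apply: le_trans (geometric_sum_le i q01); rewrite big_nat_rev/= add0n.
  rewrite [leLHS]big_nat [leRHS]big_nat; apply: ler_sum => j /= ji.
  rewrite -{1}(add0n j) (_ : (_ + _)%N = j.+1); last by lia.
  by rewrite exprS ler_piMl ?exprn_ge0// ltW.
apply: le_trans (geometric_sum_le (n - i) q01).
rewrite -{1}(add0n i) big_addn; apply: ler_sum => j _.
by rewrite (_ : (_ + _)%N = j)//; lia.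
Qed.
End geometric_bounds.

Section borel_cantelli.
Context d (X : measurableType d) (R : realType) (mu : {measure set X -> \bar R}).
Variables (M K q : R) (B : nat -> set X).
Hypotheses (M0 : 0 < M) (K0 : 0 <= K) (q01 : 0 <= q < 1).
Hypothesis muT : mu setT = M%:E.
Hypothesis mB : forall n, measurable (B n).
Let b n := fine (mu (B n)).
Hypothesis pair : forall i j, (i <= j)%N ->
  M * fine (mu (B i `&` B j)) <= b i * b j + K * q ^+ (j - i) * b j.

Let mu_fin A : measurable A -> mu A \is a fin_num.
Proof.
move=> mA; rewrite ge0_fin_numE ?measure_ge0//.
by apply: (@le_lt_trans _ _ (mu setT)); [apply: le_measure; rewrite ?inE | rewrite muT ltry].
Qed.

Let b0 n : 0 <= b n.
Proof. by rewrite fine_ge0 ?measure_ge0. Qed.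

(** The error in [pair] carries the measure of the later event only. Adding that of the earlier one
    makes the bound symmetric, so that all pairs can be summed at once. *)
Let pair_sym i j : M * fine (mu (B i `&` B j)) <=
  b i * b j + K * q ^+ ((i - j) + (j - i)) * (b i + b j).
Proof.
have /andP[q0 q1] := q01.
have c0 k x : 0 <= x -> 0 <= K * q ^+ k * x by move=> ?; rewrite !mulr_ge0 ?exprn_ge0.
have [ij|/ltnW ji] := leqP i j.
  apply: (le_trans (pair ij)); rewrite (_ : (i - j + (j - i))%N = (j - i)%N).
    by rewrite lerD2l mulrDr lerDr c0.
  lia.
rewrite setIC; apply: (le_trans (pair ji)).
rewrite (_ : (i - j + (j - i))%N = (i - j)%N); last lia.
by rewrite [b j * b i]mulrC lerD2l mulrDr lerDl c0.
Qed.

(** The row sum 2 / (1 - q) counts twice, once for each summand of [b i + b j]. *)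
Let C := 4 * K / (1 - q).

(* The correlations [q ^+ |i - j|] have bounded row sums. *)
Lemma second_moment_le n :
  M * (\sum_(0 <= i < n) \sum_(0 <= j < n) fine (mu (B i `&` B j))) <=
  (\sum_(0 <= i < n) b i) ^+ 2 + C * \sum_(0 <= i < n) b i.
Proof.
have /andP[q0 q1] := q01.
pose D i j := q ^+ ((i - j) + (j - i)).
have Dsum : \sum_(0 <= i < n) b i * \sum_(0 <= j < n) D i j <=
    2 / (1 - q) * \sum_(0 <= i < n) b i.
  rewrite mulr_sumr big_nat [leRHS]big_nat; apply: ler_sum => i /= lin.
  by rewrite mulrC ler_wpM2r// geometric_dist_sum_le.
apply: (@le_trans _ _ (\sum_(0 <= i < n) \sum_(0 <= j < n)
    (b i * b j + K * D i j * (b i + b j)))).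
  rewrite mulr_sumr; apply: ler_sum => i _; rewrite mulr_sumr; apply: ler_sum => j _.
  exact: pair_sym.
have -> : \sum_(0 <= i < n) \sum_(0 <= j < n) (b i * b j + K * D i j * (b i + b j)) =
    (\sum_(0 <= i < n) b i) ^+ 2 +
    (K * (\sum_(0 <= i < n) b i * \sum_(0 <= j < n) D i j) +
     K * (\sum_(0 <= i < n) b i * \sum_(0 <= j < n) D i j)).
  rewrite expr2 mulr_suml -[X in _ = _ + X]mulrDr.
  have {2}-> : \sum_(0 <= i < n) b i * \sum_(0 <= j < n) D i j =
      \sum_(0 <= i < n) \sum_(0 <= j < n) D i j * b j.
    rewrite exchange_big/=; apply: eq_bigr => i _; rewrite mulr_sumr.
    by apply: eq_bigr => j _; rewrite mulrC /D addnC.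
  rewrite -big_split mulr_sumr -big_split; apply: eq_bigr => i _ /=.
  rewrite mulr_sumr mulr_sumr -big_split mulr_sumr -big_split.
  by apply: eq_bigr => j _ /=; ring.
rewrite lerD2l -mulrDr; apply: (le_trans (ler_wpM2l K0 (lerD Dsum Dsum))).
by rewrite -mulrDl mulrA /C le_eqVlt; apply/orP; left; apply/eqP; ring.
Qed.

(** Chebyshev's inequality for the number N of events: N = 0 on [Z], while [second_moment_le] bounds
    the variance by a multiple of the sum S. The pointwise inequality is integrated as 2 a N + a^2
    1_Z <= N^2 + a^2, so that all integrands are nonnegative. *)
Lemma measure_missed_le n (Z : set X) : measurable Z ->
  (forall i, (i < n)%N -> Z `&` B i = set0) ->
  0 < \sum_(0 <= i < n) b i -> fine (mu Z) <= M * C / \sum_(0 <= i < n) b i.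
Proof.
move=> mZ ZB; set S := \sum_(0 <= i < n) b i => S0.
pose a := S / M; have a0 : 0 <= a by rewrite divr_ge0// ltW.
have mI i j : measurable (B i `&` B j) by exact: measurableI.
have mE (A : set X) c : measurable A ->
    measurable_fun setT (fun x => (c * \1_A x)%:E : \bar R).
  by move=> mA; apply/measurable_EFinP; apply: measurable_funM.
have iE (A : set X) c : measurable A -> 0 <= c ->
    (\int[mu]_x (c * \1_A x)%:E = (c * fine (mu A))%:E)%E.
  move=> mA c0; under eq_integral do rewrite EFinM.
  rewrite ge0_integralZl_EFin//; last exact/measurable_EFinP.
  by rewrite integral_indic// setIT EFinM fineK// mu_fin.
have a2 : 0 <= 2 * a by rewrite mulr_ge0.
have nn c (A : set X) x : 0 <= c -> (0 <= (c * \1_A x)%:E :> \bar R)%E.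
  by move=> c0; rewrite lee_fin mulr_ge0// indicE.
have mF : measurable_fun setT
    (fun x => \sum_(0 <= i < n) (2 * a * \1_(B i) x)%:E : \bar R)%E.
  by apply: emeasurable_sum => i; exact: mE.
have mG i : measurable_fun setT
    (fun x => \sum_(0 <= j < n) (1 * \1_(B i `&` B j) x)%:E : \bar R)%E.
  by apply: emeasurable_sum => j; exact: mE.
have G0 i x : (0 <= \sum_(0 <= j < n) (1 * \1_(B i `&` B j) x)%:E :> \bar R)%E.
  by apply: sume_ge0 => j _; exact: nn.
(* With N the number of events and a its mean, (N - a)^2 >= a^2 on [Z]. *)
have key : (\int[mu]_x (\sum_(0 <= i < n) (2 * a * \1_(B i) x)%:E +
      (a ^+ 2 * \1_Z x)%:E) <=
    \int[mu]_x (\sum_(0 <= i < n) \sum_(0 <= j < n) (1 * \1_(B i `&` B j) x)%:E +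
      (a ^+ 2 * \1_[set: X] x)%:E))%E.
  apply: ge0_le_integral => //.
  - move=> x _; rewrite adde_ge0 ?nn ?sqr_ge0//.
    by apply: sume_ge0 => i _; exact: nn.
  - by apply: emeasurable_funD => //; exact: mE.
  - apply: emeasurable_funD; last exact: mE.
    exact: emeasurable_sum.
  - move=> x _; rewrite sumEFin -EFinD; under [X in (_ <= X + _)%E]eq_bigr do rewrite sumEFin.
    rewrite sumEFin -EFinD lee_fin -mulr_sumr indicT mulr1.
    have -> : \sum_(0 <= i < n) \sum_(0 <= j < n) (1 * \1_(B i `&` B j) x) =
        (\sum_(0 <= i < n) \1_(B i) x) ^+ 2 :> R.
      rewrite expr2 mulr_suml; apply: eq_bigr => i _; rewrite mulr_sumr.
      by apply: eq_bigr => j _; rewrite mul1r indicI.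
    have [xZ|xZ] := pselect (Z x); last first.
      rewrite [\1_Z x]indicE memNset// mulr0 addr0.
      set N := \sum_(_ <= _ < _) _; have := sqr_ge0 (N - a); nra.
    rewrite [\1_Z x]indicE mem_set// mulr1 big_nat big1 ?mulr0 ?expr0n//=.
    move=> i /= lin; rewrite indicE memNset// => xB.
    by have : (Z `&` B i) x by []; rewrite ZB.
have i1 : (\int[mu]_x (\sum_(0 <= i < n) (2 * a * \1_(B i) x)%:E +
      (a ^+ 2 * \1_Z x)%:E) = (2 * a * S + a ^+ 2 * fine (mu Z))%:E)%E.
  rewrite ge0_integralD//=; first last.
  - exact: mE.
  - by move=> x _; rewrite nn ?sqr_ge0.
  - by move=> x _; apply: sume_ge0 => i _; exact: nn.
  rewrite ge0_integral_sum//=; [|by move=> i; exact: mE|by move=> i x _; exact: nn].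
  under eq_bigr do rewrite iE//.
  by rewrite sumEFin iE ?sqr_ge0// -EFinD /S mulr_sumr.
have i2 : (\int[mu]_x (\sum_(0 <= i < n) \sum_(0 <= j < n) (1 * \1_(B i `&` B j) x)%:E +
      (a ^+ 2 * \1_[set: X] x)%:E) = (\sum_(0 <= i < n) \sum_(0 <= j < n) fine (mu (B i `&` B j)) +
      a ^+ 2 * M)%:E)%E.
  rewrite ge0_integralD//=; first last.
  - exact: mE.
  - by move=> x _; rewrite nn ?sqr_ge0.
  - exact: emeasurable_sum.
  - by move=> x _; apply: sume_ge0 => i _.
  rewrite ge0_integral_sum//= iE ?sqr_ge0// muT /= EFinD -sumEFin; congr (_ + _)%E.
  apply: eq_bigr => i _; rewrite ge0_integral_sum//=.
  - by rewrite -sumEFin; apply: eq_bigr => j _; rewrite iE// mul1r.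
  by move=> j; exact: mE.
move: key; rewrite i1 i2 lee_fin => key.
have := second_moment_le n; rewrite -/S => h2.
have aM : a * M = S by rewrite /a divfK// gt_eqF.
rewrite ler_pdivlMr// -(ler_pM2r S0).
have := ler_wpM2l (ltW M0) key; rewrite !mulrDr => {}key.
have e1 : M * (2 * a * S) = 2 * S ^+ 2 by rewrite -aM; ring.
have e2 : M * (a ^+ 2 * M) = S ^+ 2 by rewrite -aM; ring.
have e3 : M * (M * (a ^+ 2 * fine (mu Z))) = fine (mu Z) * S * S by rewrite -aM; ring.
have : M * (a ^+ 2 * fine (mu Z)) <= C * S by lra.
by move/(ler_wpM2l (ltW M0)); rewrite e3 mulrA.
Qed.

Lemma null_missed (Z : set X) : measurable Z -> (forall i, Z `&` B i = set0) ->
  (forall A, exists n, A <= \sum_(0 <= i < n) b i) -> mu Z = 0%E.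
Proof.
move=> mZ ZB bu; apply/eqP; rewrite eq_le measure_ge0 andbT -(fineK (mu_fin mZ)) lee_fin.
have MC0 : 0 <= M * C.
  have /andP[_ q1] := q01.
  by rewrite mulr_ge0 ?(ltW M0)// divr_ge0 ?mulr_ge0// subr_ge0 ltW.
apply/ler_addgt0Pl => e e0; rewrite addr0.
have [n hn] := bu (1 + M * C / e).
have S0 : 0 < \sum_(0 <= i < n) b i.
  by apply: lt_le_trans hn; rewrite ltr_wpDr// divr_ge0// ltW.
apply: (le_trans (measure_missed_le mZ _ S0)); first by move=> i _.
rewrite ler_pdivrMr// [leRHS]mulrC -ler_pdivrMr//; apply: le_trans hn.
by rewrite lerDr.
Qed.

End borel_cantelli.

(** * Mixing *)

Section mixing.
Variable R : realType.
Local Notation leb := (@lebesgue_measure R).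
Variables (f : nat -> R[i] -> R[i]) (T : nat -> RM R -> RM R) (c : R).
Hypothesis f1 : forall n z, cabs z < 1 -> cabs (f n z) < 1.
Hypothesis f00 : forall n, f n 0 = 0.
Hypothesis c0 : 0 < c.
Hypothesis contr : forall n z, cabs z < 1 ->
  cabs (f n z) <= cabs z * (1 - c * (1 - cabs z)).
Hypothesis mT : forall n, measurable_fun setT (T n).
Hypothesis harmT : forall n z (z1 : cabs z < 1) (fz1 : cabs (f n z) < 1) B,
  measurable B -> harm z1 (T n @^-1` B) = harm fz1 B.

(** The starting index [m] is free because events at times i <= j are compared through the block of
    maps between them, the earlier maps being removed by invariance. *)
Fixpoint disc_orbit m k z := if k is k'.+1 then f (m + k')%N (disc_orbit m k' z) else z.
Fixpoint angle_orbit m k t := if k is k'.+1 then T (m + k')%N (angle_orbit m k' t) else t.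

Lemma disc_orbit_lt1 m k z : cabs z < 1 -> cabs (disc_orbit m k z) < 1.
Proof. by move=> z1; elim: k => //= k; exact: f1. Qed.

Lemma disc_orbit0 m k : disc_orbit m k 0 = 0.
Proof. by elim: k => //= k ->. Qed.

Lemma measurable_angle_orbit m k : measurable_fun setT (angle_orbit m k).
Proof.
elim: k => [|k IH]; first exact: measurable_id.
exact: measurableT_comp (mT _) IH.
Qed.

Lemma measurable_angle_preimage m k (B : set (RM R)) :
  measurable B -> measurable (angle_orbit m k @^-1` B).
Proof. by move=> mB; rewrite -[X in measurable X]setTI; exact: measurable_angle_orbit. Qed.

Lemma harm_orbit m k z (z1 : cabs z < 1) (Fz1 : cabs (disc_orbit m k z) < 1) B :
  measurable B -> harm z1 (angle_orbit m k @^-1` B) = harm Fz1 B.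
Proof.
elim: k Fz1 B => [|k IH] Fz1 B mB /=; first by congr harm; exact: bool_irrelevance.
have Fz1' := disc_orbit_lt1 m k z1.
rewrite -[LHS]/(harm z1 (angle_orbit m k @^-1` (T (m + k)%N @^-1` B))).
rewrite (IH Fz1') ?harmT//.
by rewrite -[X in measurable X]setTI; exact: mT.
Qed.

(* The quantity x / (1 - x) at x = |z| is divided by at least 1 + c at each
   step. *)
Lemma disc_orbit_contract m k z : cabs z < 1 ->
  cabs (disc_orbit m k z) * (1 + c) ^+ k * (1 - cabs z) <=
  cabs z * (1 - cabs (disc_orbit m k z)).
Proof.
move=> z1; elim: k => [|k IH]; first by rewrite expr0 mulr1.
set x := cabs (disc_orbit m k z) in IH.
have x1 : x < 1 by exact: disc_orbit_lt1.
have x0 : 0 <= x by exact: cabs_ge0.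
have := contr (m + k)%N (disc_orbit_lt1 m k z1); rewrite -/x => h.
set y := cabs (disc_orbit m k.+1 z); have {}h : y <= x * (1 - c * (1 - x)) by [].
(* Since (1 + c) (1 - x) + x = 1 + c (1 - x), the bound on y gives y (1 + c (1 - x)) <= x (1 - c^2
   (1 - x)^2) <= x. *)
have hy : y * (1 + c) * (1 - x) <= x * (1 - y).
  have p1 : 0 <= (1 + c) * (1 - x) + x.
    by rewrite addr_ge0// mulr_ge0 ?subr_ge0 ?addr_ge0// ltW.
  have := ler_wpM2r p1 h.
  have : x * (1 - c * (1 - x)) * ((1 + c) * (1 - x) + x) <= x.
    have c2 := ltW c0; have x1' : 0 <= 1 - x by rewrite subr_ge0 ltW.
    have : 0 <= x * (1 - x) * (1 - x) * (c * c) by rewrite !mulr_ge0.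
    lra.
  lra.
have x1' : 0 < 1 - x by rewrite subr_gt0.
rewrite -(ler_pM2r x1').
have e1 : y * (1 + c) ^+ k.+1 * (1 - cabs z) * (1 - x) =
  (y * (1 + c) * (1 - x)) * ((1 + c) ^+ k * (1 - cabs z)) by rewrite exprSr; ring.
rewrite e1; have p : 0 <= (1 + c) ^+ k * (1 - cabs z).
  by rewrite mulr_ge0 ?subr_ge0 ?(ltW z1)// exprn_ge0// addr_ge0// ltW.
apply: le_trans (ler_wpM2r p hy) _.
have y1 : 0 <= 1 - y by rewrite subr_ge0 ltW//; exact: disc_orbit_lt1.
have := ler_wpM2r y1 IH; lra.
Qed.

(** For x the modulus of the image, contraction gives x / (1 - x) <= (1 - sg^2) / sg^2 * sg^4 <=
    sg^2, and the Harnack constant is 1 + 2 x / (1 - x). *)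
Lemma disc_orbit_harnack m k z sg : cabs z = 1 - sg ^+ 2 -> 0 < sg < 1 ->
  sg ^+ 4 * (1 + c) ^+ k = 1 ->
  (1 + cabs (disc_orbit m k z)) / (1 - cabs (disc_orbit m k z)) <= 1 + 2 * sg ^+ 2.
Proof.
move=> zE /andP[s0 s1] sgE.
have s2 : 0 < sg ^+ 2 by rewrite exprn_gt0.
have z1 : cabs z < 1 by rewrite zE ltrBlDr ltrDl.
have := disc_orbit_contract m k z1; rewrite zE; set x := cabs (disc_orbit m k z).
have x0 : 0 <= x by exact: cabs_ge0.
have x1 : 0 < 1 - x by rewrite subr_gt0; exact: disc_orbit_lt1.
rewrite ler_pdivrMr// => /(ler_wpM2l (ltW s2)).
have -> : sg ^+ 2 * (x * (1 + c) ^+ k * (1 - (1 - sg ^+ 2))) =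
  x * (sg ^+ 4 * (1 + c) ^+ k) by ring.
rewrite sgE mulr1 => h.
have : sg ^+ 2 * ((1 - sg ^+ 2) * (1 - x)) <= sg ^+ 2 * (1 - x).
  by rewrite ler_pM2l// ler_piMl// ltW// ltrBlDr ltrDl.
lra.
Qed.

Lemma disc0 : cabs (0 : R[i]) < 1.
Proof. by rewrite cabs0. Qed.

Local Notation m0 A := (fine (harm disc0 A)).

Lemma harm0_lebesgue (A : set (RM R)) : measurable A ->
  harm disc0 A = leb (@circ R `&` A).
Proof.
move=> mA; rewrite /harm; under eq_integral do rewrite poisson0.
rewrite integral_cst ?mul1e//.
by apply: measurableI => //; exact: measurable_circ.
Qed.

Lemma harm0_orbit m k (B : set (RM R)) : measurable B ->
  harm disc0 (angle_orbit m k @^-1` B) = harm disc0 B.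
Proof.
move=> mB; have z1 : cabs (disc_orbit m k 0) < 1 by rewrite disc_orbit0 disc0.
by rewrite (harm_orbit disc0 z1)// /harm disc_orbit0.
Qed.

(** The factor 1 - 2 sg is the kernel mass kept by smoothing, b - a + 2 sg the length of the
    interval of centres, and 1 + 2 sg^2 the Harnack constant at the image of each centre, from which
    [B] is seen almost as from 0. *)
Lemma smoothed_mixing_le m k (A B : set (RM R)) (a b sg : R) :
  measurable A -> measurable B -> a <= b ->
  (forall t, A t -> exists2 t', cis t' = cis t & a <= t' <= b) ->
  0 < sg < 1 / 2 -> sg ^+ 4 * (1 + c) ^+ k = 1 ->
  (1 - 2 * sg) * (pi *+ 2) * m0 (A `&` angle_orbit m k @^-1` B) <=
  (b - a + 2 * sg) * ((1 + 2 * sg ^+ 2) * m0 B).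
Proof.
move=> mA mB ab Aab sg12 sgE; have /andP[s0 s1] := sg12.
set G := angle_orbit m k @^-1` B.
have mG : measurable G by exact: measurable_angle_preimage.
have mcirc := @measurable_circ R.
have mcG : measurable (@circ R `&` G) by exact: measurableI.
pose psi : RM R -> RM R := \1_(@circ R `&` G).
have mpsi : measurable_fun setT psi by exact: measurable_indic.
have psi0 t : 0 <= psi t by rewrite /psi indicE.
have r01 : 0 < 1 - sg ^+ 2 < 1.
  by have := exprn_gt0 2 s0; rewrite expr2 => ?; apply/andP; split; nra.
have /andP[r0 r1] := r01.
have rs1 s : cabs ((1 - sg ^+ 2)%:C * cis s) < 1 by rewrite cabs_scale_cis// ltW.
have := poisson_smoothing sg12 mpsi psi0 (@measurable_id _ _ _) mA Aab.
set J := `[_, _]%classic => h; have mJ : measurable J by exact: measurable_itv.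
pose Kb (p : RM R * RM R) : RM R :=
  psi p.2 * poisson ((1 - sg ^+ 2)%:C * cis p.1) p.2.
have mK : measurable_fun setT (EFin \o Kb).
  apply/measurable_EFinP; apply: measurable_funM.
    by apply: measurableT_comp mpsi _; exact: measurable_snd.
  exact: (measurable_poisson2 r01 (@measurable_id _ _ _)).
have K0 p : (0 <= (EFin \o Kb) p)%E.
  by rewrite lee_fin mulr_ge0// poisson_ge0.
have e : (\int[leb]_(t in A) (psi t)%:E = (m0 (A `&` G))%:E)%E.
  rewrite fineK ?harm_fin_num//; last exact: measurableI.
  rewrite harm0_lebesgue ?integral_indic//; last exact: measurableI.
  by congr (leb _); rewrite [A `&` G]setIC setIA.
rewrite e -EFinM in h; rewrite -lee_fin; apply: (le_trans h) => {h e}.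
apply: (@le_trans _ _ (\int[leb]_(s in J) ((1 + 2 * sg ^+ 2) * m0 B)%:E)%E).
  apply: ge0_le_integral => //.
  - by move=> s _; apply: integral_ge0 => t _; exact: (K0 (s, t)).
  - apply: measurable_funTS.
    exact: (@measurable_fun_fubini_tonelli_F _ _ (RM R) (RM R) R leb (EFin \o Kb) mK K0).
  - move=> s _.
    have Fz1 := disc_orbit_lt1 m k (rs1 s).
    have -> : (\int[leb]_t (psi t * poisson ((1 - sg ^+ 2)%:C * cis s) t)%:E =
        harm (rs1 s) G)%E.
      rewrite /harm [RHS]integral_mkcond; apply: eq_integral => t _.
      by rewrite patchE /psi indicE; case: ifP => _; rewrite ?mul1r ?mul0r.
    rewrite (harm_orbit _ Fz1)//; apply: (le_trans (harm_lebesgue _ mB)).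
    rewrite -harm0_lebesgue// -(fineK (harm_fin_num disc0 mB)) -EFinM lee_fin.
    rewrite ler_wpM2r ?fine_ge0 ?measure_ge0//.
    apply: disc_orbit_harnack => //; first by rewrite cabs_scale_cis// ltW.
    by apply/andP; split => //; lra.
have JE : leb J = (b - a + 2 * sg)%:E.
  rewrite lebesgue_measure_itv/= lte_fin ifT; last by lra.
  by rewrite -EFinD; congr EFin; ring.
by rewrite integral_cst//= [X in (_ * X)%E]JE -EFinM mulrC.
Qed.

(** The mixing rate: a fourth root, so that sg = varpi^k solves sg^4 (1 + c)^k = 1. *)
Let varpi := Num.sqrt (Num.sqrt (1 + c)^-1) : R.

Lemma varpi_ge0_lt1 : 0 <= varpi < 1.
Proof.
have sqrt_lt1 (x : R) : x < 1 -> Num.sqrt x < 1.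
  by move=> x1; rewrite -[ltRHS]sqrtr1 ltr_sqrt// ltr01.
by rewrite sqrtr_ge0 !sqrt_lt1// invf_lt1 ?ltrDl// addr_gt0.
Qed.

Lemma varpi_pow k : (varpi ^+ k) ^+ 4 * (1 + c) ^+ k = 1.
Proof.
rewrite exprAC -exprMn (exprM _ 2 2) !sqr_sqrtr ?invr_ge0 ?addr_ge0 ?sqrtr_ge0 ?(ltW c0)//.
by rewrite mulVf ?expr1n// gt_eqF// addr_gt0.
Qed.

Lemma mixing m k (A B : set (RM R)) (a b : R) :
  measurable A -> measurable B -> a <= b -> b - a <= m0 A ->
  (forall t, A t -> exists2 t', cis t' = cis t & a <= t' <= b) ->
  pi *+ 2 * m0 (A `&` angle_orbit m k @^-1` B) <=
  m0 A * m0 B + 8 * (pi *+ 2) * varpi ^+ k * m0 B.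
Proof.
move=> mA mB ab abA Aab; set X := m0 (A `&` _).
have mG := measurable_angle_preimage m k mB.
have m0_le C : measurable C -> m0 C <= pi *+ 2.
  by move=> mC; rewrite -lee_fin fineK ?harm_fin_num// harm_le_setT.
have m0_ge0 C : 0 <= m0 C by rewrite fine_ge0 ?measure_ge0.
have XB : X <= m0 B.
  rewrite -(harm0_orbit m k mB).
  rewrite fine_le ?harm_fin_num//; first exact: measurableI.
  apply: le_measure; rewrite ?inE//; first exact: measurableI.
(* [sg ^+ 4 * (1 + c) ^+ k = 1]: points at distance [sg ^+ 2] from the circle are
   sent within [sg ^+ 2] of 0. *)
set sg := varpi ^+ k.
set M := pi *+ 2; set al := m0 A in abA *; set be := m0 B in XB *.
have M4 : 4 <= M by rewrite /M; have := pi_ge2 R; lra.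
have al0 : 0 <= al by exact: m0_ge0.
have be0 : 0 <= be by exact: m0_ge0.
have alM : al <= M by exact: m0_le.
have /andP[v0 v1] := varpi_ge0_lt1.
have sg0 : 0 < sg.
  have := varpi_pow k; rewrite -/sg; have : 0 <= sg by rewrite exprn_ge0.
  rewrite le_eqVlt => /orP[/eqP <-|//]; rewrite expr0n mul0r => /eqP.
  by rewrite eq_sym oner_eq0.
(* For sg > 1 / 4 the error term alone exceeds M * be, which bounds the left side trivially. *)
have [sg4|sg4] := leP sg (1 / 4); last first.
  have : M * X <= M * be by rewrite ler_wpM2l//; lra.
  have : 0 <= M * be * (8 * sg - 1) by rewrite !mulr_ge0//; lra.
  have : 0 <= al * be by exact: mulr_ge0.
  lra.
have sg12 : 0 < sg < 1 / 2 by apply/andP; split => //; lra.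
have := smoothed_mixing_le m mA mB ab Aab sg12 (varpi_pow k); rewrite -/X -/M => h.
have : (b - a + 2 * sg) * ((1 + 2 * sg ^+ 2) * be) <=
    (1 - 2 * sg) * (al + 8 * M * sg) * be.
  rewrite mulrA ler_wpM2r//.
  apply: (@le_trans _ _ ((al + 2 * sg) * (1 + 2 * sg ^+ 2))).
    by rewrite ler_wpM2r ?addr_ge0 ?mulr_ge0 ?sqr_ge0//; lra.
  (* The difference of the two sides, with sg factored out. For sg <= 1 / 4 and al <= M the bracket
     is at least 3 M / 2 - 9 / 4, positive as M >= 4; this is where the constant 8 is spent. *)
  suff : 0 <= sg * (8 * M - 2 - 2 * al - 16 * M * sg - 2 * sg * al - 4 * sg ^+ 2) by lra.
  rewrite mulr_ge0 ?(ltW sg0)//.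
  have s1 : 0 <= M * (1 / 4 - sg) by rewrite mulr_ge0//; lra.
  have s2 : sg * al <= 1 / 4 * M by rewrite ler_pM// ltW.
  have s3 : sg ^+ 2 <= 1 / 4 * (1 / 4) by rewrite expr2 ler_pM// ltW.
  lra.
move=> {}h'; have := le_trans h h'.
have -> : (1 - 2 * sg) * (al + 8 * M * sg) * be =
  (1 - 2 * sg) * (al * be + 8 * M * sg * be) by ring.
by rewrite -mulrA ler_pM2l//; lra.
Qed.

Lemma angle_orbitD m k l t :
  angle_orbit m (k + l) t = angle_orbit (m + k) l (angle_orbit m k t).
Proof. by elim: l => [|l IH]; rewrite ?addn0// addnS /= IH addnA. Qed.

(** [A n] is the target at time n + 1, after the maps of indices 0 to n. The set is that of angles
    missing every target after time N; points with finitely many hits are covered by these sets as N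
    varies. *)
Lemma null_missed_tail (A : nat -> set (RM R)) (a b : nat -> R) N :
  (forall n, measurable (A n)) -> (forall n, a n <= b n) ->
  (forall n, b n - a n <= m0 (A n)) ->
  (forall n t, A n t -> exists2 t', cis t' = cis t & a n <= t' <= b n) ->
  (forall S, exists n, S <= \sum_(0 <= i < n) m0 (A i)) ->
  harm disc0 (\bigcap_n ~` (angle_orbit 0 (N + n).+1 @^-1` A (N + n)%N)) = 0%E.
Proof.
move=> mA ab abA Aab div.
pose B n := angle_orbit 0 (N + n).+1 @^-1` A (N + n)%N.
have mB n : measurable (B n) by exact: measurable_angle_preimage.
have BE n : m0 (B n) = m0 (A (N + n)%N) by rewrite /B harm0_orbit.
have M0 : 0 < pi *+ 2 :> R by rewrite mulrn_wgt0// pi_gt0.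
have K0 : 0 <= 8 * (pi *+ 2) :> R by rewrite mulr_ge0// ltW.
have p0 n : 0 <= m0 (A n) by rewrite fine_ge0 ?measure_ge0.
apply: (null_missed M0 K0 varpi_ge0_lt1 (harm_setT disc0) mB).
- move=> i j ij; rewrite !BE.
  (* Both events are preimages under the first N + i + 1 steps, which preserve the measure; a block
     of length j - i remains for [mixing]. *)
  have -> : B i `&` B j = angle_orbit 0 (N + i).+1 @^-1`
      (A (N + i)%N `&` angle_orbit (N + i).+1 (j - i) @^-1` A (N + j)%N).
    rewrite /B preimage_setI; congr (_ `&` _); apply/seteqP; split => t /=;
    by rewrite -[X in angle_orbit X (j - i)](add0n) -angle_orbitD addSn -addnA subnKC.
  have mAA : measurable
      (A (N + i)%N `&` angle_orbit (N + i).+1 (j - i) @^-1` A (N + j)%N).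
    by apply: measurableI => //; exact: measurable_angle_preimage.
  rewrite [X in fine X](harm0_orbit 0 (N + i).+1 mAA).
  exact: (mixing _ _ (mA _) (mA _) (ab _) (abA _) (Aab _)).
- by apply: bigcapT_measurable => n; apply: measurableC; exact: mB.
- move=> i; apply/seteqP; split => // t [/(_ i I)] //.
(* Dropping the first N terms keeps the sums unbounded: their total is added to the level to be
   reached. *)
move=> S; have [n hn] := div (S + \sum_(0 <= i < N) m0 (A i)).
exists n; under eq_bigr do rewrite BE.
rewrite -(lerD2r (\sum_(0 <= i < N) m0 (A i))); apply: (le_trans hn).
rewrite addrC -[in X in _ + X](addnK N n) -{2}[N]add0n.
under [X in _ + X]eq_bigr do rewrite addnC.
rewrite -(big_addn 0 (n + N) N xpredT (fun i => m0 (A i))).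
rewrite -(big_cat_nat (n := N)) ?leq_addl//=.
rewrite [leRHS](big_cat_nat (n := n)) ?leq_addr//= lerDl.
by apply: sumr_ge0.
Qed.
End mixing.

(** * Arcs *)

Section arcs.
Variable R : realType.
Implicit Types (s t a b c : R).
Local Notation leb := (@lebesgue_measure R).

Lemma cisE s t : cis s = cis t -> cos s = cos t /\ sin s = sin t.
Proof. by rewrite /cis => -[]. Qed.

Lemma eq_cisD s t c : cis s = cis t -> cis (s + c) = cis (t + c).
Proof. by move=> /cisE[ec es]; rewrite /cis !cosD !sinD ec es. Qed.

Lemma cisD2pi t : cis (t + pi *+ 2) = cis t.
Proof. by rewrite /cis cosD2pi sinD2pi. Qed.

Lemma cis_inj s t : 0 <= s < pi *+ 2 -> 0 <= t < pi *+ 2 -> cis s = cis t -> s = t.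
Proof.
wlog st : s t / s <= t.
  move=> h s2 t2 e; have [st|/ltW ts] := leP s t; first exact: h.
  by apply/esym; apply: h.
move=> /andP[s0 _] /andP[_ t2] /cisE[ec es]; apply/eqP; rewrite eq_le st /= leNgt.
apply/negP => st'; pose x := (t - s) / 2.
have xpi : 0 < x < pi by rewrite /x mulr2n in t2 *; apply/andP; split; lra.
have : cos (x *+ 2) = 1.
  have -> : x *+ 2 = t - s by rewrite /x -mulr_natr divfK// pnatr_eq0.
  by rewrite cosB ec es -!expr2 cos2Dsin2.
rewrite cos_mulr2n => cx; have := cos2Dsin2 x; have := exprn_gt0 2 (sin_gt0_pi xpi).
by rewrite mulr2n in cx; lra.
Qed.

Lemma measurable_translate c (A : set (RM R)) : measurable A ->
  measurable ((fun t => t + c : RM R) @^-1` A).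
Proof.
move=> mA; rewrite -[X in measurable X]setTI.
have : measurable_fun [set: RM R] ((fun t => t + c) : RM R -> RM R).
  by apply: measurable_funD => //; exact: measurable_cst.
exact.
Qed.

(** An arc through the point 1 has a disconnected set of angles in [0, 2 pi[, yet its lift [a, b]
    remains one interval. The lift is no longer than the measure of the arc, which is what [mixing]
    asks for. *)
Lemma arc_angles (A : set R[i]) : is_arc A -> exists a b : R,
  [/\ a <= b, measurable (angles A : set (RM R)),
      ((b - a)%:E <= leb (angles A))%E &
      forall t, angles A t -> exists2 t', cis t' = cis t & a <= t' <= b].
Proof.
move=> [a0 [b0 [l [r [ab0 ba0 AE0]]]]].
have p0 : 0 < pi :> R by exact: pi_gt0.
have cs : cos a0 ^+ 2 + sin a0 ^+ 2 = 1 by exact: cos2Dsin2.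
pose a := arg (cos a0) (sin a0); pose d := a - a0; pose b := b0 + d.
have ea : cis a = cis a0 by rewrite cis_arg.
have /andP[a_ge0 a_lt] : 0 <= a < pi *+ 2 by have := arg_circ cs; rewrite /circ/= in_itv.
have ab : a < b by rewrite /b /d; lra.
have ba : b <= a + pi *+ 2 by rewrite /b /d; lra.
pose I : set (RM R) := [set` Interval (BSide l a) (BSide (~~ r) b)].
have mI : measurable I by exact: measurable_itv.
(* [d] is a multiple of 2 pi, but this is used only through cis a = cis a0 and the addition
   formulas. *)
have cisd s : cis (s + d) = cis s.
  have := eq_cisD (s - a0) ea; rewrite -/d.
  have -> : a + (s - a0) = s + d by rewrite /d; ring.
  by rewrite [a0 + _]addrC subrK.
have ID t : I (t + d) <-> [set` Interval (BSide l a0) (BSide (~~ r) b0)] t.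
  rewrite /I/= !in_itv/= (_ : a = a0 + d); last by rewrite /d addrC subrK.
  by rewrite /b !lteifD2r.
have AE : A = @cis R @` I.
  rewrite AE0; apply/seteqP; split => z [t].
    by move=> /ID tI <-; exists (t + d).
  by rewrite -{1}(subrK d t) => /ID tI <-; exists (t - d) => //; rewrite -cisd subrK.
have Iab t : I t -> a <= t <= b.
  by rewrite /I/= in_itv/= => /andP[/lteifW -> /lteifW].
have Ioo t : a < t < b -> I t.
  by move=> /andP[ta tb]; rewrite /I/= in_itv/= !lteifS.
have anglesE : angles A = @circ R `&` (I `|` (fun t => t + pi *+ 2 : RM R) @^-1` I).
  rewrite /angles AE; apply/seteqP; split => t [ct].
    move=> [s sI st]; split => //; rewrite mulr2n in a_lt ba ct *.
    have /andP[as_ sb] := Iab s sI.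
    have ct' : 0 <= t < pi *+ 2 by rewrite mulr2n; move: ct; rewrite /= in_itv.
    have [s2|s2] := ltP s (pi *+ 2).
      left; rewrite (cis_inj ct' _ (esym st))//.
      by rewrite s2 (le_trans a_ge0).
    right => /=; rewrite -mulr2n.
    suff -> : t = s - pi *+ 2 by rewrite subrK.
    apply: (cis_inj ct'); first by rewrite mulr2n in s2 *; apply/andP; split; lra.
    by rewrite -[in RHS]cisD2pi subrK.
  move=> [tI|tI]; split => //; first by exists t.
  by exists (t + pi *+ 2) => //; exact: cisD2pi.
have mA : measurable (angles A : set (RM R)).
  rewrite anglesE; apply: measurableI; first exact: measurable_circ.
  by apply: measurableU => //; exact: measurable_translate.
exists a, b; split => //; first exact: ltW.
- have mo x y : measurable (`]x, y[%classic : set (RM R)) by exact: measurable_itv.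
  have le (U : set (RM R)) : measurable U -> U `<=` angles A ->
      (leb U <= leb (angles A : set (RM R)))%E.
    by move=> mU UA; apply: le_measure; rewrite ?inE.
  have oo x y : x < y -> leb (`]x, y[%classic : set (RM R)) = (y - x)%:E.
    by move=> xy; rewrite lebesgue_measure_itv/= lte_fin xy EFinB.
  have [b2|b2] := leP b (pi *+ 2).
    rewrite -(oo _ _ ab); apply: le => // t; rewrite /= in_itv/= => /andP[ta tb].
    rewrite anglesE; split; last by left; apply: Ioo; rewrite ta.
    by rewrite /circ/= in_itv/= (le_trans a_ge0 (ltW ta)) (lt_le_trans tb).
  (* The arc wraps around: the part of [a, b] beyond 2 pi is moved back to start at 0. The two
     pieces are disjoint because b <= a + 2 pi, and open intervals make the kind of endpoints
     irrelevant. *)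
  have -> : ((b - a)%:E = leb (`]0%R, (b - pi *+ 2)%R[%classic : set (RM R)) +
      leb (`]a, (pi *+ 2)%R[%classic : set (RM R)))%E.
    by rewrite !oo// ?subr_gt0// -EFinD; congr EFin; ring.
  rewrite -measureU//; last first.
    apply/seteqP; split => // t [] /=; rewrite !in_itv/= => /andP[_ h1] /andP[h2 _].
    by have := lt_trans h2 h1; lra.
  apply: le; first exact: measurableU.
  move=> t; rewrite anglesE => -[|] /=; rewrite in_itv/= => /andP[h1 h2].
    split; first by rewrite /circ/= in_itv/=; apply/andP; split; lra.
    by right; apply: Ioo; apply/andP; split; lra.
  split; first by rewrite /circ/= in_itv/= h2 andbT; lra.
  by left; apply: Ioo; apply/andP; split; lra.
move=> t; rewrite /angles AE => -[_ [s sI st]].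
by exists s => //; exact: Iab.
Qed.
End arcs.

(** * From orbits of angles to hits on the targets *)

Lemma finite_nat_bounded (A : set nat) :
  finite_set A -> exists N, forall n, A n -> (n < N)%N.
Proof.
move=> /finite_seqP[X ->]; exists (\max_(x <- X) x).+1 => n /= nX.
by rewrite ltnS; exact: leq_bigmax_seq.
Qed.

Section hitting.
Variables (R : realType) (f : nat -> R[i] -> R[i]) (T : nat -> RM R -> RM R).
Variable E : nat -> set (RM R).
Hypothesis Tc : forall n t, circ (T n t).
Hypothesis fT : forall n t, E n t -> radial_ext (f n.+1) (cis t) = cis (T n t).

Lemma boundary_comp_angle_orbit n t :
  (forall k, (k < n)%N -> E k (angle_orbit T 0 k t)) ->
  boundary_comp f n (cis t) = cis (angle_orbit T 0 n t).
Proof.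
elim: n => //= n IH h; rewrite IH; first exact: fT (h _ (ltnSn n)).
by move=> k kn; apply: h; exact: ltnW.
Qed.

Lemma angle_orbit_circ n t : circ t -> circ (angle_orbit T 0 n t).
Proof. by case: n => [//|n] _; exact: Tc. Qed.

(** Either the orbit leaves the set [E n] of good angles at some time n, or [boundary_comp] follows
    [angle_orbit] for ever and finitely many hits mean none after some time N. *)
Lemma missed_subset (I : nat -> set R[i]) :
  angles (~` [set z | hits (fun n => boundary_comp f n z) I]) `<=`
  \bigcup_n (@circ R `&` angle_orbit T 0 n @^-1` (@circ R `\` E n)) `|`
  \bigcup_N (@circ R `&`
    \bigcap_n ~` (angle_orbit T 0 (N + n).+1 @^-1` angles (I (N + n).+1))).
Proof.
move=> t [ct] /= /contrapT/finite_nat_bounded[N hN].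
have [tE|] := pselect (forall n, E n (angle_orbit T 0 n t)).
  right; exists N => //; split => // n _ /= [_ /= In].
  suff : ((N + n).+1 < N)%N by rewrite ltnNge -addnS leq_addr.
  by apply: hN; split => //; rewrite boundary_comp_angle_orbit.
move=> /existsNP[n nE]; left; exists n => //; split => //; split => //=.
exact: angle_orbit_circ.
Qed.
End hitting.

Theorem theoremC (R : realType) (f : nat -> R[i] -> R[i]) (lambda : R)
    (hf : forall n : nat, (0 < n)%N -> centred_inner_function (f n))
    (hlambda : lambda < 1)
    (hder : forall n : nat, (0 < n)%N ->
      `|derive1 (f n : R[i]^o -> R[i]^o) 0| <= lambda%:C) :
  forall I : nat -> set R[i],
    shrinking_target I ->
    (\sum_(1 <= n <oo) arc_length (I n) = +oo)%E ->
    ae_circle [set z : R[i] | hits (fun n => boundary_comp f n z) I].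
Proof.
(* The maps start at index 1 and the orbits at index 0, hence the shift; the targets are shifted
   alike below. *)
move=> I [It _] Isum; pose g n := f n.+1.
have g_inner n : inner_function (g n) by have [] := hf n.+1 isT.
have g00 n : g n 0 = 0 by have [] := hf n.+1 isT.
have g1 n z : cabs z < 1 -> cabs (g n z) < 1.
  by have [_ + _] := g_inner n; rewrite -!unit_discE; exact.
have gc n z : cabs z < 1 ->
    cabs (g n z) <= cabs z * (1 - (1 - lambda) / 2 * (1 - cabs z)).
  apply: schwarz_contraction => //; [|exact: g1| |exact: ltW].
    move=> w w1; apply/holomorphic_atE; have [+ _ _] := g_inner n; apply.
    by rewrite unit_discE.
  by have := hder n.+1 isT; rewrite cabsE lecR.
have c0 : 0 < (1 - lambda) / 2 by rewrite divr_gt0// subr_gt0.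
have /choice[T hT] : forall n, exists Tn, exists En, _ := fun n => boundary_map (g_inner n).
have /choice[E hE] := hT.
have mE n : measurable (E n) by have [[]] := hE n.
have mT n : measurable_fun setT (T n) by have [[]] := hE n.
have Tc n : forall t, circ (T n t) by have [] := hE n.
have Ec n : E n `<=` @circ R by have [_ _ []] := hE n.
have E0 n : lebesgue_measure (@circ R `\` E n) = 0%E by have [_ _ []] := hE n.
have fT n t : E n t -> radial_ext (f n.+1) (cis t) = cis (T n t).
  by have [_ _ _ h _] := hE n; exact: h.
have harmT n z (z1 : cabs z < 1) (gz1 : cabs (g n z) < 1) B :
    measurable B -> harm z1 (T n @^-1` B) = harm gz1 B.
  have [g_hol g_disc _] := g_inner n; have [_ _ _ _ gT] := hE n.
  exact: (harm_transport g_hol g_disc (mE n) (mT n) (Tc n) (Ec n) (E0 n) gT).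
pose A n : set (RM R) := angles (I n.+1).
have /choice[a /choice[b hab]] : forall n, exists a b : R, _ :=
  fun n => arc_angles (It n.+1 isT).
have mA n : measurable (A n) by have [] := hab n.
have Acirc n : @circ R `&` A n = A n.
  by apply/setIidr => t [].
have m0A n : harm (disc0 R) (A n) = arc_length (I n.+1).
  by rewrite harm0_lebesgue// Acirc.
have Afin n : harm (disc0 R) (A n) \is a fin_num by exact: harm_fin_num.
(* Divergence in the extended reals is turned into unbounded real partial sums: if all stayed below
   [S], so would the series. *)
have Adiv S : exists n, S <= \sum_(0 <= i < n) fine (harm (disc0 R) (A i)).
  apply: contrapT => /forallNP h.
  have : (\sum_(1 <= n <oo) arc_length (I n) <= S%:E)%E.
    apply: lime_le; first by apply: is_cvg_nneseries => n _ _; exact: measure_ge0.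
    apply: nearW => -[|n].
      rewrite big_geq// lee_fin ltW// ltNge; apply/negP => S0.
      by apply: (h 0%N); rewrite big_geq.
    rewrite big_add1/=; under eq_bigr do rewrite -m0A -(fineK (Afin _)).
    rewrite sumEFin lee_fin; apply: ltW; rewrite ltNge; apply/negP; exact: h.
  by rewrite Isum.
have mcirc := @measurable_circ R.
(* Invariance of arc length pulls null sets back to null sets, so almost no orbit ever reaches an
   angle where the next radial limit is bad. *)
have orbit_null n (B : set (RM R)) : measurable B ->
    lebesgue_measure (@circ R `&` B) = 0%E ->
    lebesgue_measure (@circ R `&` angle_orbit T 0 n @^-1` B) = 0%E.
  move=> mB B0; rewrite -harm0_lebesgue; last exact: measurable_angle_preimage.
  by rewrite (harm0_orbit g1 g00 mT harmT)// harm0_lebesgue.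
have Z0 N : harm (disc0 R)
    (\bigcap_n ~` (angle_orbit T 0 (N + n).+1 @^-1` A (N + n)%N)) = 0%E.
  apply: (null_missed_tail g1 g00 c0 gc mT harmT (a := a) (b := b)) => //.
  - by move=> n; have [] := hab n.
  - move=> n; rewrite -lee_fin fineK// m0A.
    by have [] := hab n.
  - by move=> n; have [] := hab n.
suff [N [mN N0 sN]] : (@lebesgue_measure R).-negligible
    (\bigcup_n (@circ R `&` angle_orbit T 0 n @^-1` (@circ R `\` E n)) `|`
     \bigcup_N (@circ R `&`
       \bigcap_n ~` (angle_orbit T 0 (N + n).+1 @^-1` A (N + n)%N))).
  by exists N; split => //; exact: subset_trans (missed_subset Tc fT (I := I)) sN.
apply: negligibleU; apply: negligible_bigcup => n.
  apply/negligibleP.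
    apply: measurableI => //; apply: measurable_angle_preimage => //.
    exact: measurableD.
  by apply: orbit_null; [exact: measurableD|rewrite setIDA setIid E0].
have mZ : measurable (\bigcap_k ~` (angle_orbit T 0 (n + k).+1 @^-1` A (n + k)%N)).
  apply: bigcapT_measurable => k; apply: measurableC.
  exact: measurable_angle_preimage.
apply/negligibleP; first exact: measurableI.
by rewrite -[LHS]harm0_lebesgue// Z0.
Qed.
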